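(* Let $K_m=\mathbb C^m\times S^1$ be the quotient of the Heisenberg group $H_m$, with its induced Webster metric $g$ and the foliation $\mathcal F$ by the fibers of $\pi:K_m\to\mathbb C^m$, and let $f:(K_m,\mathcal F,g)\to(N,\widetilde{\mathcal F},\widetilde g)$ be a horizontally harmonic map into a Riemannian foliation. For $\rho>0$ let $D_\rho=\{(z,t)\in K_m: z\in\mathbb C^m,\ t\in S^1,\ |z|\le\rho\}$. Suppose that there are constants $\delta$ and $\rho_0>0$ such that $$2\rho\left(\int_{D_\rho}|df_{\mathcal V,\widetilde{\mathcal H}}|^2\,dV_g\right)^{1/2}\le\delta\left(\int_{D_\rho}|df_{\mathcal H,\widetilde{\mathcal H}}|^2\,dV_g\right)^{1/2}\quad\text{for }\rho\ge\rho_0,$$ and $2m-2-2\delta>0$. Then $$\sigma^{2-2m+2\delta}\int_{D_\sigma}e_{\mathcal H,\widetilde{\mathcal H}}(f)\,dV_g\le\rho^{2-2m+2\delta}\int_{D_\rho}e_{\mathcal H,\widetilde{\mathcal H}}(f)\,dV_g$$ holds for any $\rho_0<\sigma\le\rho$, where $e_{\mathcal H,\widetilde{\mathcal H}}(f)=\frac12|df_{\mathcal H,\widetilde{\mathcal H}}|^2$.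
   Context: $K_m$: the Heisenberg group $H_m=\mathbb C^m\times\mathbb R$ has global coordinates $(x^1,\dots,x^m,y^1,\dots,y^m,t)$, $z^j=x^j+\sqrt{-1}\,y^j$. Put $\eta=\frac12dt+\sum_j(x^jdy^j-y^jdx^j)$ and $g=\sum_j\big((dx^j)^2+(dy^j)^2\big)+\eta\otimes\eta$. The field $\xi=\partial/\partial t$ is Killing, and $K_m=H_m/\{\exp(k\xi)\}_{k\in\mathbb Z}=\mathbb C^m\times S^1$ (i.e. $t$ is taken modulo $1$) with the induced metric, still denoted $g$. The projection $\pi:K_m\to\mathbb C^m$ is a Riemannian submersion onto Euclidean $\mathbb C^m=\mathbb R^{2m}$ with totally geodesic fibers. A global orthonormal frame is $X_j=\partial_{x^j}+2y^j\partial_t$, $Y_j=\partial_{y^j}-2x^j\partial_t$, $T=2\partial_t$, with $\mathcal H=\operatorname{span}\{X_j,Y_j\}$, $\mathcal V=\operatorname{span}\{T\}$. General definitions: a foliation on a smooth manifold $M$ is given by an integrable distribution $\mathcal V\subset TM$. Given a Riemannian metric $g$, put $\mathcal H=\mathcal V^\perp$ with orthogonal projections $\pi_{\mathcal H},\pi_{\mathcal V}$ and $g_{\mathcal H}=g(\pi_{\mathcal H}\cdot,\pi_{\mathcal H}\cdot)$. $(M,\mathcal F,g)$ is a Riemannian foliation if $\mathcal L_Ug_{\mathcal H}=0$ for every section $U$ of $\mathcal V$. Let $\nabla$ be the Levi-Civita connection. For $X,Y$ horizontal, $U$ vertical: $\mathcal W_XU=-\pi_{\mathcal V}(\nabla_UX)$,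 $\mathcal T_XY=\pi_{\mathcal V}(\nabla_XY)=\frac12\pi_{\mathcal V}([X,Y])$, extended to $TM$ by first projecting the arguments; $\mathcal T^*$ is defined by $g(\mathcal T_X^*Y,Z)=g(Y,\mathcal T_XZ)$. Objects on $N$ carry a tilde. For a smooth map $f:M\to N$: $df_{\mathcal H,\widetilde{\mathcal H}}=\pi_{\widetilde{\mathcal H}}\circ df\circ\pi_{\mathcal H}$, $df_{\mathcal V,\widetilde{\mathcal H}}=\pi_{\widetilde{\mathcal H}}\circ df\circ\pi_{\mathcal V}$, $df_{\mathcal H,\widetilde{\mathcal V}}=\pi_{\widetilde{\mathcal V}}\circ df\circ\pi_{\mathcal H}$; squared norms are $|\omega|^2=\sum_A|\omega(e_A)|^2$ over a local orthonormal frame of $TM$. With $\widetilde\nabla$ also the pull-back connection on $f^{-1}TN$, $\beta_{\mathcal H,\widetilde{\mathcal H}}(X,Y)=\widetilde\nabla_X(df_{\mathcal H,\widetilde{\mathcal H}}(Y))-df_{\mathcal H,\widetilde{\mathcal H}}(\nabla_XY)$. The map $f$ is horizontally harmonic if it is a critical point of $E_{\mathcal H,\widetilde{\mathcal H}}(f)=\frac12\int_M|df_{\mathcal H,\widetilde{\mathcal H}}|^2dV_g$, that is, $\operatorname{tr}_g\beta_{\mathcal H,\widetilde{\mathcal H}}+\sum_i\big(\widetilde{\mathcal T}^*_{df_{\mathcal H,\widetilde{\mathcal H}}(e_i)}df_{\mathcal H,\widetilde{\mathcal V}}(e_i)+\widetilde{\mathcal W}_{df_{\mathcal H,\widetilde{\mathcal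 H}}(e_i)}df_{\mathcal H,\widetilde{\mathcal V}}(e_i)\big)=0$, with $\{e_i\}$ a local orthonormal frame of $\mathcal H$. *)

(* Defs.v *)
From mathcomp Require Import all_boot all_order all_algebra.
From mathcomp Require Import ring lra.
From mathcomp Require Import all_classical all_reals all_analysis.
Set Implicit Arguments.
Unset Strict Implicit.
Unset Printing Implicit Defensive.
Import Order.TTheory GRing.Theory Num.Theory.
Import numFieldNormedType.Exports.
Local Open Scope classical_set_scope.
Local Open Scope ring_scope.

(* Tangent vectors at a point of R^n are row vectors, and a matrix field
   V : 'rV_n -> 'M_n stands for the distribution x |-> row space of V x. *)

Section SmoothMaps.
Variable R : realType.

Definition basis_vec (n : nat) (i : 'I_n) : 'rV[R]_n := delta_mx 0 i.

(* [iter_pd [:: i1; ...; ik] f] is d_{i1} ... d_{ik} f. *)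
Definition iter_pd (n : nat) (W : normedModType R) (s : seq 'I_n)
    (f : 'rV[R]_n -> W) : 'rV[R]_n -> W :=
  foldr (fun i h => 'D_(basis_vec i) h) f s.

(* C^infinity on an open set U: all iterated partial derivatives exist and are
   (Frechet) differentiable, hence continuous, at every point of U. *)
Definition smooth_on (n : nat) (W : normedModType R) (U : set 'rV[R]_n)
    (f : 'rV[R]_n -> W) : Prop :=
  forall (s : seq 'I_n) x, U x -> differentiable (iter_pd s f) x.

Definition lie_bracket (n : nat) (X Y : 'rV[R]_n -> 'rV[R]_n) :
    'rV[R]_n -> 'rV[R]_n :=
  fun x => 'D_(X x) Y x - 'D_(Y x) X x.

End SmoothMaps.

Section LocalRiemannianGeometry.
Variables (R : realType) (n : nat).
Variables (g V : 'rV[R]_n -> 'M[R]_n).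

Definition inner (x u v : 'rV[R]_n) : R := (u *m g x *m v^T) 0 0.

(* Row space { v | inner x v w = 0 for every w in the row space of V x }. *)
Definition horizontal (x : 'rV[R]_n) : 'M[R]_n := kermx (g x *m (V x)^T).

(* Orthogonal projections, acting on row vectors from the right. *)
Definition projV (x : 'rV[R]_n) : 'M[R]_n := proj_mx (V x) (horizontal x).
Definition projH (x : 'rV[R]_n) : 'M[R]_n := proj_mx (horizontal x) (V x).

Definition christoffel (x : 'rV[R]_n) (i j k : 'I_n) : R :=
  2^-1 * \sum_(l < n) invmx (g x) k l *
    ('D_(basis_vec R i) (fun y => g y j l) x
     + 'D_(basis_vec R j) (fun y => g y i l) x
     - 'D_(basis_vec R l) (fun y => g y i j) x).

(* Derivative in the direction v, at p, of a section s along F, for the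
   pull-back by F of the Levi-Civita connection of g. *)
Definition pullback_nabla (q : nat) (F : 'rV[R]_q -> 'rV[R]_n)
    (v : 'rV[R]_q) (s : 'rV[R]_q -> 'rV[R]_n) (p : 'rV[R]_q) : 'rV[R]_n :=
  'D_v s p + \row_(k < n) \sum_(i < n) \sum_(j < n)
    christoffel (F p) i j k * ('D_v F p) 0 i * (s p) 0 j.

Definition nabla (v : 'rV[R]_n) (Y : 'rV[R]_n -> 'rV[R]_n) (x : 'rV[R]_n) :
    'rV[R]_n :=
  pullback_nabla id v Y x.

(* The tensors T and W at a point: after projection, the differentiated vector
   v is extended to the horizontal field y |-> v *m projH y; both tensors are
   independent of the horizontal extension. *)
Definition tensorT (x u v : 'rV[R]_n) : 'rV[R]_n :=
  nabla (u *m projH x) (fun y => v *m projH y) x *m projV x.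

(* [tensorW x v u] is W_v u. *)
Definition tensorW (x v u : 'rV[R]_n) : 'rV[R]_n :=
  - (nabla (u *m projV x) (fun y => v *m projH y) x *m projV x).

(* The vector w = T*_u y determined by
   inner x w z = inner x y (tensorT x u z) for all z. *)
Definition tensorTadj (x u y : 'rV[R]_n) : 'rV[R]_n :=
  (\row_(l < n) inner x y (tensorT x u (basis_vec R l))) *m invmx (g x).

End LocalRiemannianGeometry.

(* Coordinate expressions for a map F from (R^q, gM, VM) to (R^n, gN, VN),
   near a point p; e is an orthonormal frame of the source. *)
Section LocalMaps.
Variables (R : realType) (q n : nat).
Variables (gM VM : 'rV[R]_q -> 'M[R]_q) (gN VN : 'rV[R]_n -> 'M[R]_n).
Variable F : 'rV[R]_q -> 'rV[R]_n.

Definition dHH (p v : 'rV[R]_q) : 'rV[R]_n :=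
  'D_(v *m projH gM VM p) F p *m projH gN VN (F p).

Definition dVH (p v : 'rV[R]_q) : 'rV[R]_n :=
  'D_(v *m projV gM VM p) F p *m projH gN VN (F p).

Definition dHV (p v : 'rV[R]_q) : 'rV[R]_n :=
  'D_(v *m projH gM VM p) F p *m projV gN VN (F p).

Definition betaHH (X Y : 'rV[R]_q -> 'rV[R]_q) (p : 'rV[R]_q) : 'rV[R]_n :=
  pullback_nabla gN F (X p) (fun p' => dHH p' (Y p')) p
  - dHH p (nabla gM (X p) Y p).

(* The frame e is indexed by I; its elements with index satisfying h form an
   orthonormal frame of the horizontal distribution. *)
Definition horizontal_tension (I : finType) (h : pred I)
    (e : I -> 'rV[R]_q -> 'rV[R]_q) (p : 'rV[R]_q) : 'rV[R]_n :=
  \sum_(A : I) betaHH (e A) (e A) p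
  + \sum_(i | h i)
     (tensorTadj gN VN (F p) (dHH p (e i p)) (dHV p (e i p))
      + tensorW gN VN (F p) (dHH p (e i p)) (dHV p (e i p))).

End LocalMaps.

(* A smooth manifold of dimension n, given by an atlas: [chart_map c] is a
   homeomorphism from the open set [chart_dom c] onto an open subset of R^n,
   with inverse [chart_inv c]. *)
Record smoothManifold (R : realType) (n : nat) := SmoothManifold {
  points :> topologicalType;
  chart : Type;
  chart_dom : chart -> set points;
  chart_map : chart -> points -> 'rV[R]_n;
  chart_inv : chart -> 'rV[R]_n -> points;
  chart_at : points -> chart;
  points_hausdorff : hausdorff_space points;
  points_second_countable : @second_countable points;
  chart_at_dom : forall a, chart_dom (chart_at a) a;
  chart_dom_open : forall c, open (chart_dom c);
  chart_img_open : forall c, open (chart_map c @` chart_dom c);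
  chart_mapK : forall c a, chart_dom c a -> chart_inv c (chart_map c a) = a;
  chart_map_continuous :
    forall c a, chart_dom c a -> {for a, continuous (chart_map c)};
  chart_inv_continuous :
    forall c x, (chart_map c @` chart_dom c) x ->
    {for x, continuous (chart_inv c)};
  transition_smooth : forall c d,
    smooth_on (chart_map c @` (chart_dom c `&` chart_dom d))
              (chart_map d \o chart_inv c) }.

Section RiemannianFoliations.
Variables (R : realType) (n : nat) (M : smoothManifold R n).

Definition chart_img (c : chart M) : set 'rV[R]_n :=
  chart_map c @` chart_dom c.
Definition overlap (c d : chart M) : set 'rV[R]_n :=
  chart_map c @` (chart_dom c `&` chart_dom d).
Definition transition (c d : chart M) : 'rV[R]_n -> 'rV[R]_n :=
  chart_map d \o chart_inv c.

(* [g c x] is the Gram matrix of the coordinate frame of the chart c. *)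
Record riemannian_metric (g : chart M -> 'rV[R]_n -> 'M[R]_n) : Prop := {
  metric_smooth : forall c, smooth_on (chart_img c) (g c);
  metric_sym : forall c x, chart_img c x -> (g c x)^T = g c x;
  metric_pos : forall c x (v : 'rV[R]_n),
    chart_img c x -> v != 0 -> 0 < inner (g c) x v v;
  metric_compat : forall c d x (u v : 'rV[R]_n), overlap c d x ->
    inner (g c) x u v =
    inner (g d) (transition c d x)
      ('D_u (transition c d) x) ('D_v (transition c d) x) }.

(* A smooth distribution of rank r. *)
Record distribution (r : nat) (V : chart M -> 'rV[R]_n -> 'M[R]_n) : Prop := {
  distribution_frame : forall c x, chart_img c x ->
    exists (U : set 'rV[R]_n) (B : 'rV[R]_n -> 'M[R]_(r, n)),
      [/\ open U, U x, U `<=` chart_img c, smooth_on U B &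
          forall y, U y -> row_free (B y) /\ (B y == V c y)%MS];
  distribution_compat : forall c d x (u : 'rV[R]_n), overlap c d x ->
    (u <= V c x)%MS =
    ('D_u (transition c d) x <= V d (transition c d x))%MS }.

Definition section_of (V : 'rV[R]_n -> 'M[R]_n) (U : set 'rV[R]_n)
    (X : 'rV[R]_n -> 'rV[R]_n) : Prop :=
  smooth_on U X /\ forall x, U x -> (X x <= V x)%MS.

(* Integrability: local sections are closed under the Lie bracket. *)
Definition integrable_distribution (V : chart M -> 'rV[R]_n -> 'M[R]_n) : Prop :=
  forall c (U : set 'rV[R]_n) X Y, open U -> U `<=` chart_img c ->
    section_of (V c) U X -> section_of (V c) U Y ->
    forall x, U x -> (lie_bracket X Y x <= V c x)%MS.

Definition inner_horizontal (g V : 'rV[R]_n -> 'M[R]_n) (x u v : 'rV[R]_n) : R :=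
  inner g x (u *m projH g V x) (v *m projH g V x).

(* L_U g_H = 0 for sections U of V:
   U (g_H (X, Y)) = g_H ([U, X], Y) + g_H (X, [U, Y]). *)
Definition bundle_like (g V : chart M -> 'rV[R]_n -> 'M[R]_n) : Prop :=
  forall c (O : set 'rV[R]_n) U X Y, open O -> O `<=` chart_img c ->
    section_of (V c) O U -> smooth_on O X -> smooth_on O Y ->
    forall x, O x ->
    'D_(U x) (fun y => inner_horizontal (g c) (V c) y (X y) (Y y)) x
    - inner_horizontal (g c) (V c) x (lie_bracket U X x) (Y x)
    - inner_horizontal (g c) (V c) x (X x) (lie_bracket U Y x) = 0.

End RiemannianFoliations.

Record riemannianFoliation (R : realType) (n : nat) := RiemannianFoliation {
  manifold :> smoothManifold R n;
  metric : chart manifold -> 'rV[R]_n -> 'M[R]_n;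
  leaf_dim : nat;
  vertical : chart manifold -> 'rV[R]_n -> 'M[R]_n;
  metricP : riemannian_metric metric;
  verticalP : distribution leaf_dim vertical;
  vertical_integrable : integrable_distribution vertical;
  metric_bundle_like : bundle_like metric vertical }.

(* H_m in its global coordinates (x^1..x^m, y^1..y^m, t).  The quotient K_m is
   handled through its universal cover H_m: a map on K_m is a map on H_m that
   is 1-periodic in t, the local geometry is that of H_m, and integrals over
   K_m are integrals over the fundamental domain 0 <= t < 1. *)
Section Heisenberg.
Variables (R : realType) (m : nat).

Definition heisenberg := 'rV[R]_(m + m + 1).

Definition ix (j : 'I_m) : 'I_(m + m + 1) := lshift 1 (lshift m j).
Definition iy (j : 'I_m) : 'I_(m + m + 1) := lshift 1 (rshift m j).
Definition it : 'I_(m + m + 1) := rshift (m + m) ord0.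

Definition eta (p v : heisenberg) : R :=
  2^-1 * v 0 it
  + \sum_(j < m) (p 0 (ix j) * v 0 (iy j) - p 0 (iy j) * v 0 (ix j)).

Definition webster_form (p u v : heisenberg) : R :=
  \sum_(j < m) (u 0 (ix j) * v 0 (ix j) + u 0 (iy j) * v 0 (iy j))
  + eta p u * eta p v.

Definition webster_metric (p : heisenberg) : 'M[R]_(m + m + 1) :=
  \matrix_(i, k) webster_form p (basis_vec R i) (basis_vec R k).

(* The fibres of (z, t) |-> z are tangent to the t direction. *)
Definition webster_vertical (p : heisenberg) : 'M[R]_(m + m + 1) :=
  delta_mx it it.

Definition frameX (j : 'I_m) (p : heisenberg) : heisenberg :=
  basis_vec R (ix j) + (2 * p 0 (iy j)) *: basis_vec R it.
Definition frameY (j : 'I_m) (p : heisenberg) : heisenberg :=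
  basis_vec R (iy j) - (2 * p 0 (ix j)) *: basis_vec R it.
Definition frameT (p : heisenberg) : heisenberg := 2 *: basis_vec R it.

Definition webster_frame (A : 'I_(m + m + 1)) (p : heisenberg) : heisenberg :=
  match fintype.split A with
  | inl i => match fintype.split i with
             | inl j => frameX j p
             | inr j => frameY j p
             end
  | inr _ => frameT p
  end.

Lemma eta_lin (p : heisenberg) a (u v : heisenberg) :
  eta p (a *: u + v) = a * eta p u + eta p v.
Proof.
rewrite /eta; under eq_bigr => j _.
  rewrite !mxE (_ : _ - _ = a * (p 0 (ix j) * u 0 (iy j) - p 0 (iy j) * u 0 (ix j))
    + (p 0 (ix j) * v 0 (iy j) - p 0 (iy j) * v 0 (ix j))); last by ring.
  over.
by rewrite big_split -mulr_sumr !mxE /=; ring.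
Qed.

Lemma webster_formC p u v : webster_form p u v = webster_form p v u.
Proof.
rewrite /webster_form [eta p u * _]mulrC; congr (_ + _).
by apply: eq_bigr => j _; rewrite [_ * v 0 (ix j)]mulrC [_ * v 0 (iy j)]mulrC.
Qed.

Lemma webster_form_lin p a u v w :
  webster_form p (a *: u + v) w = a * webster_form p u w + webster_form p v w.
Proof.
rewrite /webster_form eta_lin; under eq_bigr => j _.
  rewrite !mxE (_ : _ + _ = a * (u 0 (ix j) * w 0 (ix j) + u 0 (iy j) * w 0 (iy j))
    + (v 0 (ix j) * w 0 (ix j) + v 0 (iy j) * w 0 (iy j))); last by ring.
  over.
by rewrite big_split -mulr_sumr /=; ring.
Qed.

Lemma webster_form_suml p (c : 'I_(m + m + 1) -> R)
    (F : 'I_(m + m + 1) -> heisenberg) w :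
  webster_form p (\sum_i c i *: F i) w = \sum_i c i * webster_form p (F i) w.
Proof.
elim/big_rec2: _ => [|i x y _ IH]; last by rewrite webster_form_lin IH.
by have := webster_form_lin p (-1) 0 0 w; rewrite scaleN1r oppr0 addr0 mulN1r addNr.
Qed.

Lemma inner_webster p u v : inner webster_metric p u v = webster_form p u v.
Proof.
have E (w : heisenberg) : w = \sum_i w 0 i *: basis_vec R i.
  exact: row_sum_delta.
rewrite [in RHS](E u) webster_form_suml /inner -mulmxA mxE.
apply: eq_bigr => i _; congr (_ * _).
rewrite [in RHS](E v) webster_formC webster_form_suml mxE.
by apply: eq_bigr => k _; rewrite !mxE mulrC webster_formC.
Qed.

Lemma frameX_ix p j k : frameX j p 0 (ix k) = (k == j)%:R.
Proof. by rewrite !mxE !eq_lshift eq_lrshift /= mulr0 addr0. Qed.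
Lemma frameX_iy p j k : frameX j p 0 (iy k) = 0.
Proof. by rewrite !mxE !eq_lshift eq_lrshift eq_rlshift /= mulr0 addr0. Qed.
Lemma frameX_it p j : frameX j p 0 it = 2 * p 0 (iy j).
Proof. by rewrite !mxE eq_rlshift !eqxx mulr1 add0r. Qed.
Lemma frameY_ix p j k : frameY j p 0 (ix k) = 0.
Proof. by rewrite !mxE !eq_lshift !eq_lrshift /= mulr0 subr0. Qed.
Lemma frameY_iy p j k : frameY j p 0 (iy k) = (k == j)%:R.
Proof. by rewrite !mxE !eq_lshift eq_rshift eq_lrshift /= mulr0 subr0. Qed.
Lemma frameY_it p j : frameY j p 0 it = - (2 * p 0 (ix j)).
Proof. by rewrite !mxE eq_rlshift !eqxx mulr1 add0r. Qed.
Lemma frameT_ix p k : frameT p 0 (ix k) = 0.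
Proof. by rewrite !mxE eq_lrshift /= mulr0. Qed.
Lemma frameT_iy p k : frameT p 0 (iy k) = 0.
Proof. by rewrite !mxE eq_lrshift /= mulr0. Qed.
Lemma frameT_it p : frameT p 0 it = 2.
Proof. by rewrite !mxE !eqxx mulr1. Qed.

Let frameE := (frameX_ix, frameX_iy, frameX_it, frameY_ix, frameY_iy, frameY_it,
  frameT_ix, frameT_iy, frameT_it).

Lemma eta_frameX p j : eta p (frameX j p) = 0.
Proof.
rewrite /eta (bigD1 j) //= big1 => [|k kj]; rewrite !frameE ?eqxx.
  by rewrite mulr0 mulr1 mulKf // sub0r addr0 subrr.
by rewrite (negbTE kj) !mulr0 subrr.
Qed.

Lemma eta_frameY p j : eta p (frameY j p) = 0.
Proof.
rewrite /eta (bigD1 j) //= big1 => [|k kj]; rewrite !frameE ?eqxx.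
  by rewrite mulr0 mulr1 mulrN mulKf // subr0 addr0 addNr.
by rewrite (negbTE kj) !mulr0 subrr.
Qed.

Lemma eta_frameT p : eta p (frameT p) = 1.
Proof.
rewrite /eta big1 => [|k _]; rewrite !frameE; last by rewrite !mulr0 subrr.
by rewrite addr0 mulVf.
Qed.

Lemma webster_frame_orthonormal p A B :
  inner webster_metric p (webster_frame A p) (webster_frame B p) = (A == B)%:R.
Proof.
have sum_delta (i j : 'I_m) :
    \sum_k ((k == i)%:R * (k == j)%:R) = (i == j)%:R :> R.
  rewrite (bigD1 i) //= big1 => [|k /negbTE ->]; last by rewrite mul0r.
  by rewrite eqxx mul1r addr0.
rewrite inner_webster /webster_form /webster_frame.
case: (split_ordP A) => a ->; [case: (split_ordP a) => i ->|rewrite (ord1 a)];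
  (case: (split_ordP B) => b ->; [case: (split_ordP b) => j ->|rewrite (ord1 b)]);
  rewrite ?eta_frameX ?eta_frameY ?eta_frameT ?mul0r ?mulr0 ?mulr1 ?addr0;
  under eq_bigr do rewrite !frameE ?mul0r ?mulr0 ?addr0 ?add0r.
all: rewrite ?eq_lshift ?eq_rshift ?eq_lrshift ?eq_rlshift ?eqxx ?sum_delta //.
all: by rewrite ?big1 // ?add0r.
Qed.

Definition znorm (p : heisenberg) : R :=
  Num.sqrt (\sum_(j < m) (p 0 (ix j) ^+ 2 + p 0 (iy j) ^+ 2)).

(* Fundamental domain of D_rho. *)
Definition disk (rho : R) : set heisenberg :=
  [set p | znorm p <= rho /\ 0 <= p 0 it < 1].

End Heisenberg.

(* Lebesgue integral over R^n of a nonnegative measurable function, as an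
   iterated integral. *)
Fixpoint integralRn (R : realType) (n : nat) : ('rV[R]_n -> \bar R) -> \bar R :=
  match n return ('rV[R]_n -> \bar R) -> \bar R with
  | 0 => fun h => h 0
  | k.+1 => fun h =>
      (\int[@lebesgue_measure R]_a
        integralRn (fun v : 'rV[R]_k => h (row_mx (const_mx a : 'rV_1) v)))%E
  end.

(* The integral over D_rho of a nonnegative function h on K_m with respect to
   dV_g = sqrt (det g) dx dy dt.  It is finite, D_rho being compact, as soon as
   h is continuous. *)
Definition integral_disk (R : realType) (m : nat) (rho : R)
    (h : heisenberg R m -> R) : R :=
  fine (integralRn (fun p : heisenberg R m =>
    (\1_(disk rho) p * (h p * Num.sqrt (\det (webster_metric p))))%:E)).

Section MapsFromK.
Variables (R : realType) (m n : nat) (N : riemannianFoliation R n).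
Variable f : heisenberg R m -> N.

Definition K_map : Prop :=
  forall (p : heisenberg R m) (k : int),
    f (p + k%:~R *: basis_vec R (it m)) = f p.

Definition smooth_map : Prop :=
  continuous f /\
  forall c : chart N, smooth_on (f @^-1` chart_dom c) (chart_map c \o f).

Definition horizontally_harmonic : Prop :=
  forall (c : chart N) (p : heisenberg R m), chart_dom c (f p) ->
    horizontal_tension (@webster_metric R m) (@webster_vertical R m)
      (metric c) (vertical c) (chart_map c \o f)
      (fun A => A != it m) (@webster_frame R m) p = 0.

(* Squared norms, computed in a chart around f p; the value does not depend on
   the chart. *)
Definition sqnorm_dHH (p : heisenberg R m) : R :=
  let c := chart_at (f p) in
  \sum_A inner (metric c) (chart_map c (f p))
    (dHH (@webster_metric R m) (@webster_vertical R m)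
       (metric c) (vertical c) (chart_map c \o f) p (webster_frame A p))
    (dHH (@webster_metric R m) (@webster_vertical R m)
       (metric c) (vertical c) (chart_map c \o f) p (webster_frame A p)).

Definition sqnorm_dVH (p : heisenberg R m) : R :=
  let c := chart_at (f p) in
  \sum_A inner (metric c) (chart_map c (f p))
    (dVH (@webster_metric R m) (@webster_vertical R m)
       (metric c) (vertical c) (chart_map c \o f) p (webster_frame A p))
    (dVH (@webster_metric R m) (@webster_vertical R m)
       (metric c) (vertical c) (chart_map c \o f) p (webster_frame A p)).

Definition energy_density (p : heisenberg R m) : R := 2^-1 * sqnorm_dHH p.

End MapsFromK.

(* Main.v *)
From HB Require Import structures.
Require Import Defs.
From mathcomp Require Import all_boot all_order all_algebra.
From mathcomp Require Import ring lra.
From mathcomp Require Import all_classical all_reals all_analysis.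
From mathcomp Require Import measurable_realfun.
Set Implicit Arguments.
Unset Strict Implicit.
Unset Printing Implicit Defensive.
Import Order.TTheory GRing.Theory Num.Theory.
Import numFieldNormedType.Exports.
Local Open Scope classical_set_scope.
Local Open Scope ring_scope.

(** The theorem is a monotonicity formula: the stress-energy tensor of the map is
   paired with the radial field of [C^m], and the contribution of the fibres is
   absorbed by the growth hypothesis.

   Let [h] be the horizontal part of the target metric, extended by zero to
   vertical vectors ([transverse]), and let [H] be its pull-back by [f]
   ([pullback]).  With the horizontal frame [X_a] and [T = 2 d/dt],
   [|df_HH|^2 = \sum_a H (X_a, X_a)] and [|df_VH|^2 = H (T, T)], so that only [H]
   matters.

   Harmonicity.  The target is a Riemannian foliation, that is, [h] is invariant
   along the leaves.  Because of this the terms [tensorTadj] and [tensorW] of the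
   tension field turn the Levi-Civita connection of the target into the first
   Christoffel symbols of the degenerate metric [h] ([connection_transverse],
   [tension_pairing]), and the resulting equation holds for vertical test vectors
   too ([harmonic_pairing]).  By symmetry of second derivatives this says that
   [\sum_a (X_a (H (X_a, Z)) - Z (H (X_a, X_a)) / 2) = 0] for constant [Z], the
   frame being frozen ([pullback_conserved]).

   Stress identity.  Put [e = \sum_a H (X_a, X_a) / 2] and take for [Z] the radial
   field [r = \sum_a z_a X_a].  Then
   [\sum_a X_a (H (X_a, r)) - r e = 2 e + twist], where
   [twist = 2 H (J r, T)] arises from the brackets [[X_j, Y_j] = - 2 T]
   ([flux_identity]).  All functions are periodic in [t] and the volume density is
   constant, so that the identity can be integrated by parts against cutoffs of
   [s = |z|^2].  The flux term [H (r, r)] at the boundary is nonnegative; leaving it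
   out gives, for [E s] the energy of the disk of squared radius [s], the
   inequality [(2m - 2) E - \int twist <= 2 s E'] ([weighted_energy_le],
   [disk_balance]).

   Growth.  By Cauchy-Schwarz and the hypothesis on [|df_VH|],
   [\int twist <= 2 rho |df_HH| |df_VH| <= 2 delta E], the norms being those of
   square integrable functions on the disk ([twist_le], [disk_twist_le]).  Hence
   [(2m - 2 - 2 delta) E <= 2 s E'], and [s^(- (m - 1 - delta)) E] is
   nondecreasing.  The function [E] is only known to be monotone and continuous
   from the right, so [E'] is a lower right derivative, and the last step is made
   for smaller exponents first ([power_monotone]). *)

(** * Calculus of functions of a row vector *)

Section Calculus.
Variable R : realType.

Lemma derive_partials (n : nat) (W : normedModType R) (u : 'rV[R]_n -> W) x v :
  differentiable u x ->
  'D_v u x = \sum_i v 0 i *: 'D_(basis_vec R i) u x.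
Proof.
move=> du; rewrite (deriveE _ du) {1}(row_sum_delta v) linear_sum.
by apply: eq_bigr => i _; rewrite linearZ -(deriveE _ du).
Qed.

Lemma continuous_at_sum (T : topologicalType) (I : Type) (r : seq I) (P : pred I)
    (f : I -> T -> R) x : (forall i, P i -> {for x, continuous (f i)}) ->
  {for x, continuous (fun y => \sum_(i <- r | P i) f i y)}.
Proof.
move=> cf; apply: (@cvg_big _ _ _ _ _ _ _ (nbhs x)) => [|i Pi]; last exact: cf.
exact: add_continuous.
Qed.

Lemma derive_linear_dir (n : nat) (W : normedModType R) (u : 'rV[R]_n -> W) x a v w :
  differentiable u x -> 'D_(a *: v + w) u x = a *: 'D_v u x + 'D_w u x.
Proof. by move=> du; rewrite !(deriveE _ du) linearP. Qed.

Lemma coord_derive (n k l : nat) (A : 'rV[R]_n -> 'M[R]_(k, l)) x v i j :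
  derivable A x v -> ('D_v A x) i j = 'D_v (fun y => A y i j) x.
Proof. by move=> dA; rewrite derive_mx // mxE. Qed.

Lemma differentiable_entry (n k l : nat) (A : 'rV[R]_n -> 'M[R]_(k, l)) x i j :
  differentiable A x -> differentiable (fun y => A y i j) x.
Proof.
move=> dA; have := @differentiable_comp _ _ _ _ A (fun N : 'M[R]_(k, l) => N i j) x dA.
by apply; exact: differentiable_coord.
Qed.

Lemma differentiable_mx (n k l : nat) (A : 'rV[R]_n -> 'M[R]_(k, l)) x :
  (forall i j, differentiable (fun y => A y i j) x) -> differentiable A x.
Proof.
move=> dA; have -> : A = fun y => \sum_i \sum_j A y i j *: delta_mx i j.
  by apply/funext => y; exact: matrix_sum_delta.
rewrite (_ : (fun y => _) = \sum_i \sum_j (fun y => A y i j *: delta_mx i j)).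
  by apply: differentiable_sum => i; apply: differentiable_sum => j; exact: differentiableZl.
by apply/funext => y; rewrite fct_sumE; apply: eq_bigr => i _; rewrite fct_sumE.
Qed.

(** Differentiability is local: the difference vanishes near [x], so it is a
   little-o there. *)
Lemma near_eq_differentiable (n : nat) (W : normedModType R)
    (u v : 'rV[R]_n -> W) x :
  (\near x, u x = v x) -> differentiable u x -> differentiable v x.
Proof.
move=> uv du; have -> : v = u + (v - u) by rewrite addrC subrK.
apply: differentiableD => //; set r := v - u.
have r0 : \near x, r x = 0 by near=> y; rewrite /r fctE -(near uv y) ?subrr.
have rE : r \o shift x = cst (r x) + (\0 : {linear _ -> _}) +o_ 0 id.
  apply/eqaddoP => e e0; near=> y.
  rewrite /= !fctE /= (nbhs_singleton r0) addr0 subr0.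
  suff -> : r (y + x) = 0 by rewrite normr0 mulr_ge0 // ltW.
  by near: y; have := r0; rewrite (near_shift 0 x) subr0; apply: filterS => z.
apply/diff_locallyP.
have c0 : continuous (\0 : {linear 'rV[R]_n -> W}) by move=> y; apply: (@cst_continuous _ _ (0 : W)).
have dE : 'd r x = (\0 : {linear 'rV[R]_n -> W}) :> (_ -> _) by apply: diff_unique.
by rewrite dE.
Unshelve. all: by end_near. Qed.

(** The integral identities involve first derivatives of the pulled-back metric
   only, so this is the regularity that is carried through inverse metrics,
   projections and changes of charts. *)
Definition C1_on (n : nat) (U : set 'rV[R]_n) (u : 'rV[R]_n -> R) : Prop :=
  forall x, U x -> differentiable u x /\
    forall i, {for x, continuous (fun y => 'D_(basis_vec R i) u y)}.

Section C1.
Variables (n : nat) (U : set 'rV[R]_n).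
Hypothesis oU : open U.
Implicit Types u v : 'rV[R]_n -> R.

Lemma open_near x : U x -> \forall y \near x, U y.
Proof. by move=> Ux; exact: open_nbhs_nbhs. Qed.

Lemma C1_on_continuous u x : C1_on U u -> U x -> {for x, continuous u}.
Proof. by move=> cu Ux; exact: differentiable_continuous (cu x Ux).1. Qed.

(** The partial derivatives only have to be known up to pointwise equality on the
   open set [U], which makes the closure properties below one-line computations. *)
Lemma C1_on_partials u (du : 'I_n -> 'rV[R]_n -> R) :
  (forall x, U x -> differentiable u x) ->
  (forall x i, U x -> 'D_(basis_vec R i) u x = du i x) ->
  (forall x i, U x -> {for x, continuous (du i)}) -> C1_on U u.
Proof.
move=> h1 h2 h3 x Ux; split=> [|i]; first exact: h1.
have E : du i @ x --> 'D_(basis_vec R i) u x by rewrite h2 //; exact: h3.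
apply: cvg_trans E; apply: (@near_eq_cvg _ _ (nbhs x)).
by have := open_near Ux; apply: filterS => y Uy; rewrite h2.
Qed.

Lemma eq_C1_on u v : (forall x, U x -> u x = v x) -> C1_on U u -> C1_on U v.
Proof.
move=> uv cu.
have nuv x : U x -> \near x, u x = v x.
  by move=> Ux; have := open_near Ux; apply: filterS => y; exact: uv.
apply: (@C1_on_partials _ (fun i x => 'D_(basis_vec R i) u x)).
- by move=> x Ux; exact: near_eq_differentiable (nuv x Ux) (cu x Ux).1.
- by move=> x i Ux; apply/esym/near_eq_derive; exact: nuv.
- by move=> x i Ux; exact: (cu x Ux).2.
Qed.

Lemma C1_on_cst (c : R) : C1_on U (fun=> c).
Proof.
apply: (@C1_on_partials _ (fun _ _ => 0)) => x *; first exact: differentiable_cst.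
- exact: derive_cst.
- exact: cst_continuous.
Qed.

Lemma C1_on_coord (i : 'I_n) : C1_on U (fun y => y 0 i).
Proof.
apply: (@C1_on_partials _ (fun j _ => basis_vec R j 0 i)) => [x _|x j _|x j _].
- exact: differentiable_coord.
- by rewrite -(coord_derive _ _ (@derivable_id _ _ x _)) derive_id.
- exact: cst_continuous.
Qed.

Lemma C1_onD u v : C1_on U u -> C1_on U v -> C1_on U (fun y => u y + v y).
Proof.
move=> cu cv; apply: (@C1_on_partials _ (fun i y => 'D_(basis_vec R i) u y + 'D_(basis_vec R i) v y)).
- by move=> x Ux; apply: differentiableD; [exact: (cu x Ux).1|exact: (cv x Ux).1].
- by move=> x i Ux; apply: deriveD; apply: diff_derivable; [exact: (cu x Ux).1|exact: (cv x Ux).1].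
- by move=> x i Ux; apply: continuousD; [exact: (cu x Ux).2|exact: (cv x Ux).2].
Qed.

Lemma C1_onM u v : C1_on U u -> C1_on U v -> C1_on U (fun y => u y * v y).
Proof.
move=> cu cv; apply: (@C1_on_partials _ (fun i y => u y * 'D_(basis_vec R i) v y + v y * 'D_(basis_vec R i) u y)).
- by move=> x Ux; apply: differentiableM; [exact: (cu x Ux).1|exact: (cv x Ux).1].
- by move=> x i Ux; apply: deriveM; apply: diff_derivable; [exact: (cu x Ux).1|exact: (cv x Ux).1].
- move=> x i Ux; apply: continuousD; apply: continuousM; try exact: C1_on_continuous.
  + exact: (cv x Ux).2.
  + exact: (cu x Ux).2.
Qed.

Lemma C1_onN u : C1_on U u -> C1_on U (fun y => - u y).
Proof.
move=> cu; apply: (eq_C1_on _ (C1_onM (C1_on_cst (-1)) cu)) => x _.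
by rewrite mulN1r.
Qed.

Lemma C1_onB u v : C1_on U u -> C1_on U v -> C1_on U (fun y => u y - v y).
Proof. by move=> cu cv; apply: C1_onD => //; exact: C1_onN. Qed.

Lemma C1_on_sum (I : Type) (r : seq I) (P : pred I) (f : I -> 'rV[R]_n -> R) :
  (forall i, P i -> C1_on U (f i)) -> C1_on U (fun y => \sum_(i <- r | P i) f i y).
Proof.
move=> cf; elim: r => [|i r IH].
  by apply: (eq_C1_on _ (C1_on_cst 0)) => x _; rewrite big_nil.
have [Pi|nPi] := boolP (P i).
  by apply: (eq_C1_on _ (C1_onD (cf i Pi) IH)) => x _; rewrite big_cons Pi.
by apply: (eq_C1_on _ IH) => x _; rewrite big_cons (negbTE nPi).
Qed.

Lemma C1_on_prod (I : Type) (r : seq I) (P : pred I) (f : I -> 'rV[R]_n -> R) :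
  (forall i, P i -> C1_on U (f i)) -> C1_on U (fun y => \prod_(i <- r | P i) f i y).
Proof.
move=> cf; elim: r => [|i r IH].
  by apply: (eq_C1_on _ (C1_on_cst 1)) => x _; rewrite big_nil.
have [Pi|nPi] := boolP (P i).
  by apply: (eq_C1_on _ (C1_onM (cf i Pi) IH)) => x _; rewrite big_cons Pi.
by apply: (eq_C1_on _ IH) => x _; rewrite big_cons (negbTE nPi).
Qed.

Lemma derive_comp1 (k : R -> R) (dk : R) u x w :
  is_derive (u x) (1 : R) k dk -> differentiable u x ->
  'D_w (fun y => k (u y)) x = dk * 'D_w u x.
Proof.
move=> [kd kdE] du.
have dk1 : differentiable k (u x) by exact/derivable1_diffP.
rewrite deriveE; last exact: (differentiable_comp du).
by rewrite (diff_comp du dk1) /= -(deriveE _ du) (deriv1E kd) derive1E kdE mulrC.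
Qed.

Lemma C1_on_comp1 (k dk : R -> R) u :
  (forall s : R, is_derive s (1 : R) k (dk s)) -> continuous dk ->
  C1_on U u -> C1_on U (fun y => k (u y)).
Proof.
move=> kd cdk cu.
have dk1 s : differentiable k s by apply/derivable1_diffP; have [] := kd s.
apply: (@C1_on_partials _ (fun i y => dk (u y) * 'D_(basis_vec R i) u y)).
- by move=> x Ux; exact: (differentiable_comp (cu x Ux).1).
- by move=> x i Ux; exact: (derive_comp1 _ (kd _) (cu x Ux).1).
- move=> x i Ux; apply: continuousM; last exact: (cu x Ux).2.
  by apply: continuous_comp; [exact: C1_on_continuous|exact: cdk].
Qed.

Lemma C1_onV u : (forall x, U x -> u x != 0) -> C1_on U u ->
  C1_on U (fun y => (u y)^-1).
Proof.
move=> u0 cu.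
apply: (@C1_on_partials _ (fun i y => - (u y) ^- 2 *: 'D_(basis_vec R i) u y)).
- by move=> x Ux; apply: differentiableV; [exact: (cu x Ux).1|exact: u0].
- by move=> x i Ux; apply: deriveV; [exact: u0|apply: diff_derivable; exact: (cu x Ux).1].
- move=> x i Ux; apply: continuousZ; last exact: (cu x Ux).2.
  apply: continuousN; apply: continuousV; first by rewrite expf_neq0 // u0.
  by apply: continuousM; exact: C1_on_continuous.
Qed.

End C1.

Lemma derive_comp (q n : nat) (W : normedModType R) (F : 'rV[R]_q -> 'rV[R]_n)
    (u : 'rV[R]_n -> W) x v :
  differentiable F x -> differentiable u (F x) ->
  'D_v (fun y => u (F y)) x = 'D_('D_v F x) u (F x).
Proof.
move=> dF du; rewrite deriveE; last exact: (differentiable_comp dF).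
by rewrite (diff_comp dF du) /= -!deriveE.
Qed.

Lemma C1_on_comp (q n : nat) (U : set 'rV[R]_q) (V : set 'rV[R]_n)
    (F : 'rV[R]_q -> 'rV[R]_n) (u : 'rV[R]_n -> R) :
  open U -> (forall x, U x -> V (F x)) ->
  (forall j, C1_on U (fun x => F x 0 j)) -> C1_on V u ->
  C1_on U (fun x => u (F x)).
Proof.
move=> oU FV cF cu.
have dF x : U x -> differentiable F x.
  by move=> Ux; apply: differentiable_mx => i j; rewrite (ord1 i); exact: (cF j x Ux).1.
have du x : U x -> differentiable u (F x) by move=> /FV /cu[].
apply: (@C1_on_partials _ _ oU _ (fun i x => \sum_j 'D_(basis_vec R i) (fun y => F y 0 j) x *
    'D_(basis_vec R j) u (F x))).
- by move=> x Ux; apply: (differentiable_comp (dF x Ux)); exact: du.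
- move=> x i Ux; rewrite (derive_comp _ (dF x Ux) (du x Ux)).
  rewrite derive_partials; last exact: du.
  by apply: eq_bigr => j _; rewrite coord_derive //; exact/diff_derivable/dF.
- move=> x i Ux; apply: continuous_at_sum => j _; apply: continuousM; first exact: (cF j x Ux).2.
  have FVx := FV x Ux.
  apply: (@continuous_comp _ _ _ F (fun y => 'D_(basis_vec R j) u y)); first exact/differentiable_continuous/dF.
  exact: (cu _ FVx).2.
Qed.

(** The partial derivatives of an iterated derivative are again iterated
   derivatives, which are differentiable, hence continuous. *)
Lemma smooth_on_C1 (n k l : nat) (U : set 'rV[R]_n) (A : 'rV[R]_n -> 'M[R]_(k, l)) i j s :
  open U -> smooth_on U A -> C1_on U (fun x => iter_pd s A x i j).
Proof.
move=> oU sA.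
have dA t x : U x -> differentiable (iter_pd t A) x by exact: sA.
apply: (@C1_on_partials _ _ oU _ (fun a x => iter_pd (a :: s) A x i j)).
- by move=> x Ux; exact/differentiable_entry/dA.
- by move=> x a Ux; rewrite -coord_derive //; exact/diff_derivable/dA.
- by move=> x a Ux; exact/differentiable_continuous/differentiable_entry/dA.
Qed.

End Calculus.

(* These restate the derivation rules for functions written with a bound
   variable, the form in which they occur under integrals and sums. *)
Section PointwiseCalculus.
Variables (R : realType) (n : nat).
Implicit Types u w : 'rV[R]_n -> R.

Lemma deriveD_at u w p v : differentiable u p -> differentiable w p ->
  'D_v (fun y => u y + w y) p = 'D_v u p + 'D_v w p.
Proof. by move=> du dw; apply: deriveD; exact: diff_derivable. Qed.

Lemma deriveM_at u w p v : differentiable u p -> differentiable w p ->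
  'D_v (fun y => u y * w y) p = 'D_v u p * w p + u p * 'D_v w p.
Proof.
move=> du dw; rewrite (@deriveM _ _ u w); try exact: diff_derivable.
by rewrite addrC; congr (_ + _); exact: mulrC.
Qed.

Lemma derive_sum_at (I : finType) (f : I -> 'rV[R]_n -> R) p v :
  (forall i, differentiable (f i) p) ->
  'D_v (fun y => \sum_i f i y) p = \sum_i 'D_v (f i) p.
Proof.
move=> df; have -> : (fun y => \sum_i f i y) = \sum_(i < #|I|) f (enum_val i).
  apply/funext => y; rewrite fct_sumE (reindex_onto enum_val enum_rank) /=; last first.
    by move=> i _; rewrite enum_rankK.
  by apply: eq_bigl => i; rewrite enum_valK eqxx.
rewrite derive_sum => [|i]; last exact: diff_derivable.
rewrite [RHS](reindex_onto enum_val enum_rank) /=; last by move=> i _; rewrite enum_rankK.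
by apply: eq_bigl => i; rewrite enum_valK eqxx.
Qed.

Lemma derive_coord (i : 'I_n) p v : 'D_v (fun y : 'rV[R]_n => y 0 i) p = v 0 i.
Proof. by rewrite -(coord_derive _ _ (@derivable_id _ _ p v)) derive_id. Qed.

End PointwiseCalculus.

Section Schwarz.
Variable R : realType.

Lemma is_derive_line (n : nat) (u : 'rV[R]_n -> R) (x v : 'rV[R]_n) (s : R) :
  differentiable u (x + s *: v) ->
  is_derive s (1 : R) (fun t : R => u (x + t *: v)) ('D_v u (x + s *: v)).
Proof.
move=> du.
have E : (fun h : R => h^-1 *: (((fun t : R => u (x + t *: v)) \o shift s) (h *: (1 : R)) - u (x + s *: v)))
       = (fun h : R => h^-1 *: ((u \o shift (x + s *: v)) (h *: v) - u (x + s *: v))).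
  apply/funext => h /=; congr (_ *: (u _ - _)).
  by rewrite [h *: 1]mulr1 scalerDl addrCA.
have dv := @diff_derivable _ _ _ _ _ v du.
by apply: DeriveDef; rewrite /derivable /derive E.
Qed.

(** Second differences: by the mean value theorem applied in each direction, the
   second difference of [u] over the parallelogram spanned by [h *: a] and
   [h *: b] is [h ^+ 2] times a mixed derivative somewhere in it. *)
Lemma second_difference (n : nat) (u : 'rV[R]_n -> R) (x a b : 'rV[R]_n) (h : R) :
  0 < h ->
  (forall s t : R, 0 <= s <= h -> 0 <= t <= h ->
    differentiable u (x + s *: a + t *: b) /\
    differentiable (fun y => 'D_a u y) (x + s *: a + t *: b)) ->
  exists s t : R, [/\ 0 <= s <= h, 0 <= t <= h &
    u (x + h *: a + h *: b) - u (x + h *: a) - u (x + h *: b) + u x =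
    h ^+ 2 * 'D_b ('D_a u) (x + s *: a + t *: b)].
Proof.
move=> h0 du.
pose phi (s : R) := u ((x + h *: b) + s *: a) - u (x + s *: a).
pose dphi (s : R) := 'D_a u ((x + h *: b) + s *: a) - 'D_a u (x + s *: a).
have hh : 0 <= h <= h by rewrite ltW //= lexx.
have h00 : (0 : R) <= 0 <= h by rewrite lexx ltW.
have phid (s : R) : 0 <= s <= h -> is_derive s (1 : R) phi (dphi s).
  move=> sh; have [d1 _] := du s h sh hh; have [d2 _] := du s 0 sh h00.
  rewrite addrAC in d1; rewrite scale0r addr0 in d2.
  exact: (is_deriveB (is_derive_line d1) (is_derive_line d2)).
have [s] : exists2 c, c \in `]0, h[ & phi h - phi 0 = dphi c * (h - 0).
  apply: (@MVT R phi dphi 0 h h0) => [y|]; first by rewrite in_itv /= => /andP[y0 yh]; apply: phid; rewrite !ltW.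
  apply: derivable_within_continuous => y; rewrite in_itv /= => /phid yh.
  exact: ex_derive.
rewrite in_itv /= subr0 => /andP[/ltW s0 /ltW sh] Es.
have ss : 0 <= s <= h by rewrite s0.
pose psi (t : R) := 'D_a u ((x + s *: a) + t *: b).
have psid (t : R) : 0 <= t <= h ->
    is_derive t (1 : R) psi ('D_b ('D_a u) ((x + s *: a) + t *: b)).
  by move=> th; have [_ d1] := du s t ss th; exact: (is_derive_line d1).
have [t] : exists2 c, c \in `]0, h[ & psi h - psi 0 =
    'D_b ('D_a u) ((x + s *: a) + c *: b) * (h - 0).
  apply: (@MVT R psi (fun c => 'D_b ('D_a u) ((x + s *: a) + c *: b)) 0 h h0) => [y|].
    by rewrite in_itv /= => /andP[y0 yh]; apply: psid; rewrite !ltW.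
  apply: derivable_within_continuous => y; rewrite in_itv /= => /psid yh.
  exact: ex_derive.
rewrite in_itv /= subr0 => /andP[/ltW t0 /ltW th] Et.
exists s, t; split=> //; first by rewrite t0.
have E1 : dphi s = psi h - psi 0 by rewrite /dphi /psi scale0r addr0 addrAC.
rewrite E1 Et in Es.
transitivity (phi h - phi 0); last by rewrite Es; ring.
rewrite /phi !scale0r !addr0 [x + h *: b + h *: a]addrAC; ring.
Qed.

Lemma dist_midpoint (e p p' c : R) :
  `|p - c| <= e / 2 -> `|p' - c| <= e / 2 -> `|p' - p| <= e.
Proof.
rewrite distrC => h1 h2; rewrite -(subrKA c) addrC.
by rewrite (le_trans (ler_normD _ _)) // [leRHS]splitr lerD.
Qed.

(** Schwarz's theorem.  The second difference is symmetric in [a] and [b], so it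
   is [h ^+ 2] times either mixed derivative at nearby points; continuity lets
   both points tend to [x]. *)
Lemma derive_comm (n : nat) (u : 'rV[R]_n -> R) (U : set 'rV[R]_n) (x a b : 'rV[R]_n) :
  open U -> U x ->
  (forall y, U y -> [/\ differentiable u y, differentiable (fun z => 'D_a u z) y &
                        differentiable (fun z => 'D_b u z) y]) ->
  {for x, continuous (fun y => 'D_b ('D_a u) y)} ->
  {for x, continuous (fun y => 'D_a ('D_b u) y)} ->
  'D_a ('D_b u) x = 'D_b ('D_a u) x.
Proof.
move=> oU Ux du cab cba; apply/eqP; rewrite -subr_eq0 -normr_le0.
apply/ler_addgt0Pr => e e0; rewrite add0r.
have e2 : 0 < e / 2 by rewrite divr_gt0.
have n0 := open_near oU Ux.
have n1 : \forall y \near x, `|'D_b ('D_a u) x - 'D_b ('D_a u) y| <= e / 2.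
  by move/cvgrPdist_le : cab => /(_ _ e2).
have n2 : \forall y \near x, `|'D_a ('D_b u) x - 'D_a ('D_b u) y| <= e / 2.
  by move/cvgrPdist_le : cba => /(_ _ e2).
have /nbhs_ballP[r /= r0 rP] : nbhs x [set y | [/\ U y,
    `|'D_b ('D_a u) x - 'D_b ('D_a u) y| <= e / 2 &
    `|'D_a ('D_b u) x - 'D_a ('D_b u) y| <= e / 2]].
  by apply: (@filterS3 _ (nbhs x) _ _ _ _ _ _ n0 n1 n2) => y.
pose h := r / 2 / (1 + `|a| + `|b|).
have ab0 : 0 < 1 + `|a| + `|b| by rewrite -addrA ltr_pwDl // addr_ge0.
have h0 : 0 < h by rewrite !divr_gt0.
have bh s t : 0 <= s <= h -> 0 <= t <= h -> ball x r (x + s *: a + t *: b).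
  move=> /andP[s0 sh] /andP[t0 th].
  rewrite -ball_normE /= -addrA opprD addrA subrr add0r normrN.
  rewrite (le_lt_trans (ler_normD _ _)) // !normrZ !ger0_norm //.
  have : s * `|a| + t * `|b| <= h * (1 + `|a| + `|b|).
    rewrite -addrA mulrDr mulrDr mulr1 -[leLHS]add0r lerD ?(ltW h0) // lerD // ler_wpM2r //.
  rewrite /h divfK ?gt_eqF // => /le_lt_trans; apply.
  by rewrite ltr_pdivrMr // ltr_pMr // ltr1n.
have d1 s t : 0 <= s <= h -> 0 <= t <= h ->
    differentiable u (x + s *: a + t *: b) /\
    differentiable (fun y => 'D_a u y) (x + s *: a + t *: b).
  by move=> sh th; have [/du[]] := rP _ (bh s t sh th).
have d2 s t : 0 <= s <= h -> 0 <= t <= h ->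
    differentiable u (x + s *: b + t *: a) /\
    differentiable (fun y => 'D_b u y) (x + s *: b + t *: a).
  by move=> sh th; rewrite addrAC; have [/du[]] := rP _ (bh t s th sh).
have [s [t [sh th E1]]] := second_difference h0 d1.
have [s' [t' [sh' th' E2]]] := second_difference h0 d2.
have [_ m1 _] := rP _ (bh s t sh th).
have [_ _ m2] := rP _ (bh t' s' th' sh').
have E : 'D_b ('D_a u) (x + s *: a + t *: b) = 'D_a ('D_b u) (x + t' *: a + s' *: b).
  apply: (mulfI (lt0r_neq0 (exprn_gt0 2 h0))).
  have ac (y z : 'rV[R]_n) : x + y + z = x + z + y by rewrite addrAC.
  rewrite (ac (h *: b)) (ac (s' *: b)) in E2.
  apply: (etrans (esym E1)); apply: etrans E2.
  by congr (_ + _); exact: addrAC.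
by rewrite E in m1; exact: dist_midpoint m1 m2.
Qed.

End Schwarz.

Section MatrixC1.
Variables (R : realType) (n : nat) (U : set 'rV[R]_n).
Hypothesis oU : open U.

Definition C1mx_on (k l : nat) (A : 'rV[R]_n -> 'M[R]_(k, l)) : Prop :=
  forall i j, C1_on U (fun x => A x i j).

Lemma C1mx_mul k l p (A : 'rV[R]_n -> 'M[R]_(k, l)) (B : 'rV[R]_n -> 'M[R]_(l, p)) :
  C1mx_on A -> C1mx_on B -> C1mx_on (fun x => A x *m B x).
Proof.
move=> cA cB i j.
have c : C1_on U (fun x => \sum_s A x i s * B x s j).
  by apply: C1_on_sum => // s _; exact: C1_onM.
by apply: eq_C1_on c => // x _; rewrite mxE.
Qed.

Lemma C1mx_tr k l (A : 'rV[R]_n -> 'M[R]_(k, l)) :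
  C1mx_on A -> C1mx_on (fun x => (A x)^T).
Proof. by move=> cA i j; apply: eq_C1_on (cA j i) => // x _; rewrite mxE. Qed.

Lemma C1mx_sub k l (A B : 'rV[R]_n -> 'M[R]_(k, l)) :
  C1mx_on A -> C1mx_on B -> C1mx_on (fun x => A x - B x).
Proof.
by move=> cA cB i j; apply: eq_C1_on (C1_onB oU (cA i j) (cB i j)) => // x _; rewrite !mxE.
Qed.

Lemma C1mx_cst k l (A : 'M[R]_(k, l)) : C1mx_on (fun=> A).
Proof. by move=> i j; exact: C1_on_cst. Qed.

Lemma eq_C1mx k l (A B : 'rV[R]_n -> 'M[R]_(k, l)) :
  (forall x, U x -> A x = B x) -> C1mx_on A -> C1mx_on B.
Proof. by move=> AB cA i j; apply: eq_C1_on (cA i j) => // x Ux; rewrite AB. Qed.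

Lemma C1_on_det k (A : 'rV[R]_n -> 'M[R]_k) :
  C1mx_on A -> C1_on U (fun x => \det (A x)).
Proof.
move=> cA; apply: C1_on_sum => // s _; apply: C1_onM => //; first exact: C1_on_cst.
by apply: C1_on_prod => // i _; exact: cA.
Qed.

(** Cramer's formula expresses the inverse through determinants of minors. *)
Lemma C1mx_inv k (A : 'rV[R]_n -> 'M[R]_k) :
  (forall x, U x -> A x \in unitmx) -> C1mx_on A -> C1mx_on (fun x => invmx (A x)).
Proof.
move=> uA cA i j.
have c : C1_on U (fun x => (\det (A x))^-1 * cofactor (A x) j i).
  apply: C1_onM => //; first apply: C1_onV => //.
  - by move=> x /uA; rewrite unitmxE unitfE.
  - exact: C1_on_det.
  - apply: C1_onM => //; first exact: C1_on_cst.
    by apply: C1_on_det => a b; apply: eq_C1_on (cA (lift j a) (lift i b)) => // x _; rewrite !mxE.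
by apply: eq_C1_on c => // x Ux; rewrite /invmx uA // !mxE.
Qed.

Lemma C1mx_differentiable k l (A : 'rV[R]_n -> 'M[R]_(k, l)) x :
  C1mx_on A -> U x -> differentiable A x.
Proof. by move=> cA Ux; apply: differentiable_mx => i j; exact: (cA i j x Ux).1. Qed.

End MatrixC1.

(** * Lebesgue measure in coordinates *)

Section ProductMeasure.
Variables (R : realType) (d1 d2 : measure_display).
Variables (T1 : measurableType d1) (T2 : measurableType d2).
Variables (m1 : {sigma_finite_measure set T1 -> \bar R}).
Variables (m2 : {sigma_finite_measure set T2 -> \bar R}).

(** The product measure under a name of its own, so that it is inferred to be
   sigma-finite and products can be iterated. *)
Definition sigma_product : set (T1 * T2) -> \bar R := (m1 \x m2)%E.

HB.instance Definition _ := Measure.on sigma_product.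

Lemma sigma_product_sigma_finite : sigma_finite setT sigma_product.
Proof.
exact: (isSigmaFinite.sigma_finiteT
 (lebesgue_integral_fubini.measure_function_Measure_isSigmaFinite__to__measure_function_isSigmaFinite
   m1 m2)).
Qed.

HB.instance Definition _ := Measure_isSigmaFinite.Build _ _ _ sigma_product
  sigma_product_sigma_finite.
End ProductMeasure.

Section CoordinateSpace.
Variable R : realType.
Local Notation leb := (@lebesgue_measure R).
Local Notation RT := (measurableTypeR R).

Lemma basis_vecE (n : nat) (i j : 'I_n) : basis_vec R i 0 j = (j == i)%:R.
Proof. by rewrite mxE eqxx. Qed.

Lemma shift_coord (n : nat) (x : 'rV[R]_n) s (i j : 'I_n) :
  (x + s *: basis_vec R i) 0 j = x 0 j + s * (j == i)%:R.
Proof. by rewrite mxE [X in _ + X]mxE basis_vecE. Qed.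

Section Measurability.
Variables (d : measure_display) (T : measurableType d) (n : nat).
Variable pos : T -> 'rV[R]_n.
Hypothesis mpos : forall i, measurable_fun setT (fun t => pos t 0 i).

(** An open set is a countable union of balls with rational centres and radii,
   and a ball for the maximum norm is a product of intervals. *)
Lemma open_pos_measurable (O : set 'rV[R]_n) : open O -> measurable (pos @^-1` O).
Proof.
move=> oO.
pose cen (c : 'rV[rat]_n) : 'rV[R]_n := \row_i ratr (c 0 i).
pose rad (k : nat) : R := k.+1%:R^-1.
pose good := [set p : 'rV[rat]_n * nat | ball (cen p.1) (rad p.2) `<=` O].
have OE : O = \bigcup_(p in good) ball (cen p.1) (rad p.2).
  apply/seteqP; split=> [x Ox|x [p gp]]; last exact: gp.
  have /nbhs_ballP[e /= e0 eO] : nbhs x O by exact: open_nbhs_nbhs.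
  have [k ke] : exists k, rad k < e / 2.
    have e2 : 0 < e / 2 by rewrite divr_gt0.
    have [k _ kP] := near_infty_natSinv_lt (PosNum e2).
    by exists k; exact: (kP k (leqnn k)).
  have r0 : 0 < rad k by rewrite invr_gt0 ltr0n.
  have cP i : exists q : rat, ratr q \in `]x 0 i - rad k, x 0 i + rad k[.
    by apply: rat_in_itvoo; rewrite ltrD2l (lt_trans _ r0) // oppr_lt0.
  have [c cE] := choice cP.
  have cx : ball x (rad k) (cen (\row_i c i)).
    split=> // i j; rewrite (ord1 i) !mxE.
    have := cE j; rewrite in_itv /= => /andP[h1 h2].
    by rewrite -ball_normE /= ltr_distlC h1 h2.
  exists (\row_i c i, k); last exact: ball_sym.
  move=> y /= by1; apply: eO.
  have : ball x (rad k + rad k) y by apply: ball_triangle cx by1.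
  by apply: le_ball; rewrite [leRHS]splitr lerD // ltW.
rewrite OE preimage_bigcup bigcup_mkcond.
have -> : \bigcup_i (if i \in good then pos @^-1` ball (cen i.1) (rad i.2) else set0) =
   \bigcup_m (if unpickle m is Some i then
     (if i \in good then pos @^-1` ball (cen i.1) (rad i.2) else set0) else set0).
  apply/seteqP; split=> [t [i _ ti]|t [m _]].
    by exists (pickle i) => //; rewrite pickleK.
  by case: (unpickle m) => // i ti; exists i.
apply: bigcupT_measurable => m; case: (unpickle m) => // i.
case: ifP => // _.
rewrite (_ : _ @^-1` _ = \bigcap_(j in [set: 'I_n])
   (fun t => pos t 0 j) @^-1` ball (cen i.1 0 j) (rad i.2)).
  apply: fin_bigcap_measurable => // j _; rewrite -[X in measurable X]setTI.
  by apply: mpos => //; apply: open_measurable; exact: ball_open.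
apply/seteqP; split=> t.
  by move=> [_ bt] k _; exact: bt.
move=> h; split=> [|a j]; first by rewrite invr_gt0 ltr0n.
by rewrite (ord1 a); exact: h.
Qed.

Lemma continuous_pos_measurable (u : 'rV[R]_n -> R) :
  continuous u -> measurable_fun setT (u \o pos).
Proof.
move=> cu; apply: (measurability _ (RGenOpens.measurableE R)).
move=> _ [_ [a [b ->]] <-]; rewrite setTI.
have -> : (u \o pos) @^-1` `]a, b[ = pos @^-1` (u @^-1` `]a, b[) by [].
by apply: open_pos_measurable; apply: open_comp => // x _; exact: cu.
Qed.

Definition box (M : R) : set 'rV[R]_n := [set x | forall i, `|x 0 i| <= M].

Lemma box_pos_measurable M : measurable (pos @^-1` (box M)).
Proof.
rewrite (_ : _ @^-1` _ = \bigcap_(j in [set: 'I_n])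
   (fun t => pos t 0 j) @^-1` `[- M, M]).
  apply: fin_bigcap_measurable => // j _; rewrite -[X in measurable X]setTI.
  by apply: mpos => //; exact: measurable_itv.
apply/seteqP; split=> t /= h => [i _|i]; first by rewrite /= in_itv /= -ler_norml; exact: h.
by rewrite ler_norml; have := h i I; rewrite /= in_itv.
Qed.

(** These functions are integrable, and stay in the class when one coordinate is
   fixed, so that Fubini's theorem can be iterated on them. *)
Definition test_fun (k : 'rV[R]_n -> R) : Prop :=
  measurable_fun setT (k \o pos) /\
  exists C M, forall x, `|k x| <= C /\ (k x != 0 -> box M x).

Lemma test_fun_integrable (mu : {measure set T -> \bar R}) k :
  (forall M, (mu (pos @^-1` (box M)) < +oo)%E) -> test_fun k ->
  mu.-integrable setT (EFin \o (k \o pos)).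
Proof.
move=> mufin [mk [C [M kCM]]].
have mB := box_pos_measurable M.
have -> : EFin \o (k \o pos) = (EFin \o (k \o pos)) \_ (pos @^-1` (box M)).
  apply/funext => t; rewrite /patch; case: ifPn => // /negP tB.
  have [k0|/eqP k0] := pselect (k (pos t) = 0); first by rewrite /= k0.
  by exfalso; apply: tB; rewrite inE /=; exact: (kCM _).2.
apply: (iffLR (integrable_mkcond _ mB)); apply: measurable_bounded_integrable => //.
  exact: measurable_funS mk.
exists C; split; first exact: num_real.
by move=> y Cy t _ /=; rewrite (le_trans (kCM _).1) // ltW.
Qed.

End Measurability.

(** A measure space together with a map to [R^n].  No sigma-algebra is put on
   the space of row vectors itself: functions of a row vector are measured
   through this map. *)
Record coord_space (n : nat) := CoordSpace {
  cs_disp : measure_display;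
  cs_type : measurableType cs_disp;
  cs_measure : {sigma_finite_measure set cs_type -> \bar R};
  cs_pos : cs_type -> 'rV[R]_n }.
Arguments cs_pos {n} c _.

(** The properties of Lebesgue measure on [R^n] that are used.  The last one is
   the part of Fubini's theorem behind integration by parts: a function whose
   integral along every line of one coordinate direction vanishes has integral
   zero. *)
Record lebesgue_coords (n : nat) (S : coord_space n) : Prop := {
  coords_measurable : forall i, measurable_fun setT (fun t => cs_pos S t 0 i);
  coords_finite : forall M, (cs_measure S (cs_pos S @^-1` (@box n M)) < +oo)%E;
  coords_integralRn : forall h : 'rV[R]_n -> \bar R, (forall x, (0 <= h x)%E) ->
    measurable_fun setT (h \o cs_pos S) ->
    integralRn h = (\int[cs_measure S]_t h (cs_pos S t))%E;
  coords_fubini : forall (k : 'rV[R]_n -> R) (i : 'I_n), test_fun (cs_pos S) k ->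
    (forall x, (\int[leb]_(s in setT) (k (x + s *: basis_vec R i))%:E = 0)%E) ->
    (\int[cs_measure S]_t (k (cs_pos S t))%:E = 0)%E }.

(* The spaces are built one coordinate at a time, in the order in which
   [integralRn] integrates. *)
Definition point_space : coord_space 0 :=
  @CoordSpace 0 _ unit (@dirac _ unit tt R) (fun=> 0).

Lemma point_coords : lebesgue_coords point_space.
Proof.
split=> /= [[]//|M|h h0 mh|k []//].
- by rewrite diracE; case: (_ \in _); rewrite ltry.
- by rewrite integral_dirac // diracT mul1e.
Qed.

Section Extend.
Variables (n : nat) (S : coord_space n).
Hypothesis okS : lebesgue_coords S.
Local Notation T := (cs_type S).
Local Notation mu := (cs_measure S).
Local Notation pos := (cs_pos S).

Definition extend_pos (p : RT * T) : 'rV[R]_(1 + n) :=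
  row_mx (const_mx p.1 : 'rV_1) (pos p.2).

Definition extend_space : coord_space (1 + n) :=
  @CoordSpace (1 + n) _ (RT * T)%type (sigma_product leb mu) extend_pos.

Lemma measurable_extend_pos i : measurable_fun setT (fun t => extend_pos t 0 i).
Proof.
case: (split_ordP i) => j ->.
  rewrite (_ : (fun t => _) = fst); first exact: measurable_fst.
  by apply/funext => t; rewrite row_mxEl mxE.
rewrite (_ : (fun t => _) = (fun t => pos t 0 j) \o snd).
  apply: measurableT_comp; last exact: measurable_snd.
  exact: (coords_measurable okS).
by apply/funext => t; rewrite row_mxEr.
Qed.

Lemma extend_finite M : (sigma_product leb mu (extend_pos @^-1` (@box (1 + n) M)) < +oo)%E.
Proof.
rewrite (_ : _ @^-1` _ = `[- M, M] `*` (pos @^-1` (@box n M))).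
  rewrite /sigma_product product_measure1E //; last first.
    exact: box_pos_measurable (coords_measurable okS) M.
  apply: lte_mul_pinfty => //; last exact: (coords_finite okS).
  have lI : lebesgue_measure (`[- M, M]%classic : set R) \is a fin_num by rewrite lebesgue_measure_itv; case: ifP.
  exact: lI.
apply/seteqP; split=> [[a v] h|[a v] [/= h1 h2] i].
  split=> /= [|i]; last by have := h (rshift 1 i); rewrite row_mxEr.
  by have := h (lshift n ord0); rewrite row_mxEl mxE /= in_itv /= ler_norml.
case: (split_ordP i) => j ->; last by rewrite row_mxEr; exact: h2.
by move: h1; rewrite row_mxEl mxE in_itv /= ler_norml.
Qed.

Lemma extend_integralRn (h : 'rV[R]_(1 + n) -> \bar R) : (forall x, (0 <= h x)%E) ->
    measurable_fun setT (h \o extend_pos) ->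
    integralRn h = (\int[sigma_product leb mu]_t h (extend_pos t))%E.
Proof.
move=> h0 mh; rewrite [RHS](@fubini_tonelli1 _ _ _ _ _ leb mu (h \o extend_pos)) //=.
apply: eq_integral => a _; rewrite (coords_integralRn okS) //.
exact: (measurableT_comp mh (pair1_measurable a)).
Qed.

Lemma extend_fubini (k : 'rV[R]_(1 + n) -> R) (i : 'I_(1 + n)) :
  test_fun extend_pos k ->
  (forall x, (\int[leb]_(s in setT) (k (x + s *: basis_vec R i))%:E = 0)%E) ->
  (\int[sigma_product leb mu]_t (k (extend_pos t))%:E = 0)%E.
Proof.
move=> tk k0.
have ik := test_fun_integrable measurable_extend_pos extend_finite tk.
have [mk [C [M kCM]]] := tk.
case: (split_ordP i) => j ij; rewrite {i}ij in k0.
  rewrite -(@integral21_prod_meas1 _ _ _ _ _ leb mu _ ik) integral0_eq // => v _.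
  rewrite -[RHS](k0 (row_mx 0 (pos v))); apply: eq_integral => s _ /=.
  congr (k _)%:E; apply/rowP => l; case: (split_ordP l) => l' ->.
    rewrite /extend_pos shift_coord !row_mxEl !mxE.
    by rewrite (ord1 j) (ord1 l') eqxx mulr1 add0r.
  rewrite /extend_pos shift_coord !row_mxEr.
  by rewrite eq_rlshift mulr0 addr0.
rewrite -(@integral12_prod_meas1 _ _ _ _ _ leb mu _ ik) integral0_eq // => a _.
apply: (coords_fubini okS (k := fun v => k (row_mx (const_mx a) v)) (i := j)).
  split; first exact: (measurableT_comp mk (pair1_measurable a)).
  exists C, M => v; split; first exact: (kCM _).1.
  by move=> /(kCM _).2 kv l; have := kv (rshift 1 l); rewrite row_mxEr.
move=> v; rewrite -[RHS](k0 (row_mx (const_mx a) v)); apply: eq_integral => s _.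
congr (k _)%:E; apply/rowP => l; case: (split_ordP l) => l' ->.
  by rewrite shift_coord !row_mxEl eq_lrshift mulr0 addr0.
by rewrite shift_coord !row_mxEr eq_rshift shift_coord.
Qed.

Lemma extend_coords : lebesgue_coords extend_space.
Proof.
split=> /=.
- exact: measurable_extend_pos.
- exact: extend_finite.
- exact: extend_integralRn.
- exact: extend_fubini.
Qed.

End Extend.

Lemma lebesgue_coords_exist n : exists S : coord_space n, lebesgue_coords S.
Proof.
elim: n => [|n [S okS]]; first by exists point_space; exact: point_coords.
by exists (extend_space S); exact: extend_coords.
Qed.

End CoordinateSpace.
Arguments cs_pos {R n} c _.

Section LineIntegrals.
Variable R : realType.
Local Notation leb := (@lebesgue_measure R).

Lemma integral_derivative_itv (W w : R -> R) (a b : R) : a < b ->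
  (forall s : R, is_derive s (1 : R) W (w s)) -> continuous w ->
  (\int[leb]_(s in `[a, b]) (w s)%:E = (W b - W a)%:E)%E.
Proof.
move=> ab dW cw.
have cW : continuous W.
  move=> s; apply/differentiable_continuous/derivable1_diffP.
  by have [] := dW s.
rewrite (@continuous_FTC2 _ w W) //.
- by apply: continuous_subspaceT => s; exact: cw.
- split => [s _||]; first by have [] := dW s.
  + exact/cvg_at_right_filter/cW.
  + exact/cvg_at_left_filter/cW.
- by move=> s _; rewrite derive1E; have [_ ->] := dW s.
Qed.

(** The fundamental theorem of calculus without boundary terms: they vanish
   because the primitive has compact support here, and because it is periodic in
   the next lemma. *)
Lemma integral_derivative_compact (W w : R -> R) (L : R) : 0 < L ->
  (forall s : R, is_derive s (1 : R) W (w s)) -> continuous w ->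
  (forall s, L <= `|s| -> W s = 0 /\ w s = 0) ->
  (\int[leb]_(s in setT) (w s)%:E = 0)%E.
Proof.
move=> L0 dW cw W0.
have -> : (fun s => (w s)%:E) = (EFin \o w) \_ `[- L, L].
  apply/funext => s; rewrite /patch; case: ifPn => // sL.
  suff [_ ->] : W s = 0 /\ w s = 0 by [].
  apply: W0; rewrite leNgt; apply/negP => sL'; move/negP: sL; apply.
  by rewrite inE /= in_itv /= -ler_norml ltW.
rewrite -integral_mkcond (integral_derivative_itv _ dW cw) ?gtrN //.
have [-> _] : W L = 0 /\ w L = 0 by apply: W0; rewrite ger0_norm // ltW.
have [-> _] : W (- L) = 0 /\ w (- L) = 0 by apply: W0; rewrite normrN ger0_norm // ltW.
by rewrite subrr.
Qed.

Lemma integral_derivative_period (W w : R -> R) (x : R) :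
  (forall s : R, is_derive s (1 : R) W (w s)) -> continuous w ->
  W (1 - x) = W (- x) ->
  (\int[leb]_(s in setT) (w s * (0 <= x + s < 1)%R%:R)%:E = 0)%E.
Proof.
move=> dW cw Wp.
have -> : (fun s => (w s * (0 <= x + s < 1)%R%:R)%:E) = (EFin \o w) \_ `[- x, (1 - x)[.
  apply/funext => s; rewrite /patch mem_setE in_itv /=.
  rewrite -lerBlDl sub0r -ltrBrDl.
  by case: ifP; rewrite ?mulr1 ?mulr0.
rewrite -integral_mkcond integral_itv_bndo_bndc; last first.
  by apply: (measurable_funS measurableT) => //; apply/measurable_EFinP; exact: continuous_measurable_fun.
by rewrite (integral_derivative_itv _ dW cw) ?Wp ?subrr // ltrBrDr addNr.
Qed.

End LineIntegrals.

(** * Weighted integrals over one period *)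

Section DiskIntegrals.
Variables (R : realType) (m : nat).
Local Notation leb := (@lebesgue_measure R).
Local Notation q := (m + m + 1)%N.
Local Notation K := (heisenberg R m).
Variable S : coord_space R q.
Hypothesis okS : lebesgue_coords S.
Local Notation mu := (cs_measure S).
Local Notation pos := (cs_pos S).

(** Disks are described by the squared radius, because radial cutoffs are then
   differentiable on the axis as well. *)
Definition zsq (p : K) : R := \sum_(a < m + m) p 0 (lshift 1 a) ^+ 2.

Lemma zsq_ge0 p : 0 <= zsq p.
Proof. by apply: sumr_ge0 => a _; exact: sqr_ge0. Qed.

Lemma znormE p : znorm p = Num.sqrt (zsq p).
Proof. by rewrite /znorm /zsq big_split_ord big_split. Qed.

Lemma C1_zsq : C1_on setT zsq.
Proof.
have c : C1_on setT (fun p : K => \sum_(a < m + m) p 0 (lshift 1 a) * p 0 (lshift 1 a)).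
  apply: C1_on_sum => [|a _]; first exact: openT.
  by apply: (C1_onM openT); apply: (C1_on_coord openT).
by apply: eq_C1_on c; [exact: openT|move=> x _; apply: eq_bigr => a _; rewrite expr2].
Qed.

Lemma C1_onT_continuous (u : K -> R) : C1_on setT u -> continuous u.
Proof. by move=> cu x; exact: C1_on_continuous cu I. Qed.

Lemma continuous_add (u w : K -> R) :
  continuous u -> continuous w -> continuous (fun p => u p + w p).
Proof. by move=> cu cw x; exact: (cvgD (cu x) (cw x)). Qed.

Lemma continuous_sub (u w : K -> R) :
  continuous u -> continuous w -> continuous (fun p => u p - w p).
Proof. by move=> cu cw x; exact: (cvgB (cu x) (cw x)). Qed.

Lemma continuous_sum (I : finType) (u : I -> K -> R) :
  (forall i, continuous (u i)) -> continuous (fun p => \sum_i u i p).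
Proof. by move=> cu x; apply: continuous_at_sum => i _; exact: cu. Qed.

(** The argument of a weight is the squared radius; the bound on its support makes
   the support of [cut chi u] below compact. *)
Definition weight (chi : R -> R) : Prop :=
  measurable_fun setT chi /\ exists C s : R, forall c, `|chi c| <= C /\ (s < c -> chi c = 0).

(** Restricting to [0 <= t < 1] turns integrals over the circle factor into
   integrals over Euclidean space. *)
Definition cut (chi : R -> R) (u : K -> R) (p : K) : R :=
  u p * chi (zsq p) * (0 <= p 0 (it m) < 1)%R%:R.

Lemma continuous_box_bounded (u : K -> R) (M : R) : continuous u ->
  exists C, forall x : K, box M x -> `|u x| <= C.
Proof.
move=> cu.
have cB : compact (box M : set K).
  have := @rV_compact R q (fun=> `[- M, M]%classic) (fun=> @segment_compact _ _ _).
  rewrite (_ : mkset _ = (box M : set K)) //; apply/seteqP; split => x /= h i.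
    by rewrite ler_norml; have := h i; rewrite in_itv.
  by rewrite in_itv /= -ler_norml; exact: h.
have /compact_bounded [C [_ hC]] : compact (u @` box M).
  by apply: continuous_compact => //; apply: continuous_subspaceT => x; exact: cu.
exists (C + 1) => x Bx; apply: (hC (C + 1)); first by rewrite ltrDl.
by exists x.
Qed.

Lemma cut_test chi u : weight chi -> continuous u -> test_fun pos (cut chi u).
Proof.
move=> [mchi [C [s chiP]]] cu.
have mcoord := coords_measurable okS.
split.
  have -> : cut chi u \o pos = (fun t => (u \o pos) t * (chi \o (zsq \o pos)) t *
      ((fun c => (0 <= c < 1)%R%:R) \o (fun t => pos t 0 (it m))) t) by [].
  apply: measurable_funM; first apply: measurable_funM.
  - exact: continuous_pos_measurable.
  - apply: measurableT_comp => //; apply: continuous_pos_measurable => //.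
    exact: C1_onT_continuous C1_zsq.
  - apply: measurableT_comp => //.
    have -> : (fun c : R => (0 <= c < 1)%R%:R) = \1_(`[0, 1[%classic : set R) :> (R -> R).
      by apply/funext => c; rewrite indicE mem_setE in_itv.
    exact: measurable_indic.
have [D uD] := continuous_box_bounded (Num.max 1 (s + 1)) cu.
have supp x : cut chi u x != 0 -> box (Num.max 1 (s + 1)) x.
  rewrite /cut; have [t01|] := boolP (0 <= _ < 1); last by rewrite mulr0 eqxx.
  rewrite mulr1; have [zs|sz] := leP (zsq x) s; last first.
    by rewrite ((chiP _).2 sz) mulr0 eqxx.
  move=> _ i; rewrite le_max; case: (split_ordP i) => a ->; last first.
    move: t01; rewrite (ord1 a) => /andP[t0 /ltW t1].
    by rewrite ger0_norm // t1.
  apply/orP; right; have : x 0 (lshift 1 a) ^+ 2 <= s.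
    apply: le_trans zs; rewrite /zsq (bigD1 a) //= lerDl.
    by apply: sumr_ge0 => b _; exact: sqr_ge0.
  rewrite -real_normK ?num_real //; set z := `|_|; have : 0 <= z by exact: normr_ge0.
  nra.
exists (`|D| * C), (Num.max 1 (s + 1)) => x; split; last exact: supp.
have C0 : 0 <= C by rewrite (le_trans (normr_ge0 _) (chiP 0).1).
have [->|n0] := eqVneq (cut chi u x) 0; first by rewrite normr0 mulr_ge0.
rewrite /cut normrM -[leRHS]mulr1 ler_pM // ?normrM ?ler_pM //.
- by rewrite (le_trans (uD _ (supp _ n0))) // ler_norm.
- exact: (chiP _).1.
- by case: (_ && _); rewrite ?normr0 ?normr1.
Qed.

Definition Int (chi : R -> R) (u : K -> R) : R :=
  (\int[mu]_t cut chi u (pos t))%R.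

Lemma cut_integrable chi u : weight chi -> continuous u ->
  mu.-integrable setT (EFin \o (cut chi u \o pos)).
Proof.
move=> wc cu; apply: test_fun_integrable; first exact: coords_measurable.
- exact: coords_finite.
- exact: cut_test.
Qed.

Lemma le_Int chi chi' (u u' : K -> R) : weight chi -> weight chi' ->
  continuous u -> continuous u' ->
  (forall p, u p * chi (zsq p) <= u' p * chi' (zsq p)) ->
  Int chi u <= Int chi' u'.
Proof.
move=> w w' cu cu' h; apply: le_Rintegral => //; try exact: cut_integrable.
by move=> t _; rewrite /cut; apply: ler_wpM2r => //; case: (_ && _).
Qed.

Lemma eq_Int chi chi' (u u' : K -> R) :
  (forall p, u p * chi (zsq p) = u' p * chi' (zsq p)) -> Int chi u = Int chi' u'.
Proof. by move=> h; apply: eq_Rintegral => t _; rewrite /cut h. Qed.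

Lemma Int_ge0 chi (u : K -> R) : (forall p, 0 <= u p * chi (zsq p)) -> 0 <= Int chi u.
Proof. by move=> h; apply: Rintegral_ge0 => t _; rewrite /cut mulr_ge0. Qed.

Lemma IntD chi (u v : K -> R) : weight chi -> continuous u -> continuous v ->
  Int chi (fun p => u p + v p) = Int chi u + Int chi v.
Proof.
move=> w cu cv; rewrite /Int -RintegralD //; try exact: cut_integrable.
by apply: eq_Rintegral => t _; rewrite /cut !mulrDl.
Qed.

Lemma IntZ chi (a : R) (u : K -> R) : weight chi -> continuous u ->
  Int chi (fun p => a * u p) = a * Int chi u.
Proof.
move=> w cu; rewrite /Int -RintegralZl //; try exact: cut_integrable.
by apply: eq_Rintegral => t _; rewrite /cut !mulrA.
Qed.

Lemma IntB chi (u v : K -> R) : weight chi -> continuous u -> continuous v ->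
  Int chi (fun p => u p - v p) = Int chi u - Int chi v.
Proof.
move=> w cu cv; rewrite /Int -RintegralB //; try exact: cut_integrable.
by apply: eq_Rintegral => t _; rewrite /cut !mulrBl.
Qed.

Lemma Int_sum chi (I : Type) (r : seq I) (u : I -> K -> R) :
  weight chi -> (forall i, continuous (u i)) ->
  Int chi (fun p => \sum_(i <- r) u i p) = \sum_(i <- r) Int chi (u i).
Proof.
move=> w cu; elim: r => [|i r IH].
  rewrite [RHS]big_nil -[RHS](mul0r (Int chi (fun=> 0))) -IntZ //; last exact: cst_continuous.
  by apply: eq_Int => p; rewrite big_nil !mul0r.
rewrite big_cons -IH -IntD //; last first.
  by move=> x; apply: continuous_at_sum => j _; exact: cu.
by apply: eq_Int => p; rewrite big_cons.
Qed.

Lemma IntB_weight chi chi' (u : K -> R) : weight chi -> weight chi' -> continuous u ->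
  Int chi u - Int chi' u = Int (fun c => chi c - chi' c) u.
Proof.
move=> w w' cu; rewrite /Int -RintegralB //; try exact: cut_integrable.
by apply: eq_Rintegral => t _; rewrite /cut mulrBr !mulrBl.
Qed.

End DiskIntegrals.

(** * The frame of the Heisenberg group *)

Section Heis.
Variables (R : realType) (m : nat).
Local Notation q := (m + m + 1)%N.
Local Notation K := (heisenberg R m).
Local Notation zix a := (lshift 1 a : 'I_q).
Local Notation "'t'" := (it m).

Lemma split_lshift k l (i : 'I_k) : fintype.split (lshift l i) = inl i.
Proof. exact: (unsplitK (inl i)). Qed.

Lemma split_rshift k l (i : 'I_l) : fintype.split (rshift k i) = inr i.
Proof. exact: (unsplitK (inr i)). Qed.

(** The vertical component of the horizontal frame field over the coordinate
   [zix a]. *)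
Definition slope (a : 'I_(m + m)) (p : K) : R :=
  match fintype.split a with
  | inl j => 2 * p 0 (iy j)
  | inr j => - (2 * p 0 (ix j))
  end.

Lemma frame_zix a p :
  webster_frame (zix a) p = basis_vec R (zix a) + slope a p *: basis_vec R t.
Proof.
rewrite /webster_frame split_lshift /slope; case: (split_ordP a) => j -> //.
by rewrite /frameY scaleNr.
Qed.

Lemma frame_it p : webster_frame t p = 2 *: basis_vec R t :> K.
Proof. by rewrite /webster_frame split_rshift. Qed.

Lemma slopeD a p v s : slope a (p + s *: v) = slope a p + s * slope a v.
Proof.
by rewrite /slope; case: (fintype.split a) => j; rewrite mxE [X in _ + X]mxE; ring.
Qed.

Lemma slope_t a : slope a (basis_vec R t) = 0.
Proof.
by rewrite /slope; case: (fintype.split a) => j; rewrite basis_vecE eq_lrshift mulr0 ?oppr0.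
Qed.

Lemma slope_zix a : slope a (basis_vec R (zix a)) = 0.
Proof.
rewrite /slope; case: (split_ordP a) => j ->.
  by rewrite basis_vecE eq_lshift eq_rlshift mulr0.
by rewrite basis_vecE eq_lshift eq_lrshift mulr0 oppr0.
Qed.

Lemma sum_slope_sqr p : \sum_a slope a p ^+ 2 = 4 * zsq p.
Proof.
rewrite /zsq !big_split_ord /= mulrDr !mulr_sumr addrC; congr (_ + _).
  by apply: eq_bigr => j _; rewrite /slope split_rshift sqrrN exprMn -natrX.
by apply: eq_bigr => j _; rewrite /slope split_lshift exprMn -natrX.
Qed.

Lemma C1_slope a : C1_on setT (slope a).
Proof.
have c (b : R) i : C1_on setT (fun p : K => b * p 0 i).
  by apply: (C1_onM openT); [exact: (C1_on_cst openT)|exact: (C1_on_coord openT)].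
rewrite /slope; case: (fintype.split a) => j; first exact: c.
by apply: (C1_onN openT); exact: c.
Qed.

Lemma derive_slope a p v : 'D_v (slope a) p = slope a v.
Proof.
have -> : slope a = fun p : K => slope a p by [].
rewrite /slope; case: (fintype.split a) => j.
  have d := @diff_derivable _ _ _ _ _ v (@differentiable_coord R 1 q p 0 (iy j)).
  rewrite (_ : (fun p => _) = 2 *: (fun p : K => p 0 (iy j))) // deriveZ //.
  by rewrite -coord_derive ?derive_id.
have d := @diff_derivable _ _ _ _ _ v (@differentiable_coord R 1 q p 0 (ix j)).
rewrite (_ : (fun p => _) = (- 2) *: (fun p : K => p 0 (ix j))); last first.
  by apply/funext => y; rewrite -mulNr.
by rewrite deriveZ // -coord_derive ?derive_id // scaleNr.
Qed.

(** The frame is obtained from the coordinate basis by a triangular change, with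
   constant diagonal. *)
Lemma frame_matrix_det (p : K) :
  \det (\matrix_A webster_frame A p) = \det (\matrix_A webster_frame A (0 : K)).
Proof.
have trig (p' : K) : is_trig_mx (\matrix_A webster_frame A p')^T.
  apply/is_trig_mxP => i j ij; rewrite !mxE.
  case: (split_ordP j) ij => b ->.
    rewrite frame_zix shift_coord basis_vecE => ij.
    have -> : (i == zix b) = false by rewrite -val_eqE ltn_eqF.
    have -> : (i == t) = false.
      by rewrite -val_eqE ltn_eqF //= (ltn_trans ij) //= addn0; exact: ltn_ord b.
    by rewrite mulr0 addr0.
  rewrite (ord1 b) frame_it mxE basis_vecE => ij.
  by rewrite -val_eqE ltn_eqF // mulr0.
rewrite -det_tr -[RHS]det_tr !det_trig //; apply: eq_bigr => i _; rewrite !mxE.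
case: (split_ordP i) => b ->; last by rewrite (ord1 b) !frame_it.
by rewrite !frame_zix !shift_coord !eq_lrshift !mulr0.
Qed.

(** The volume density is constant: the frame is orthonormal and its matrix has
   constant determinant. *)
Lemma webster_det (p : K) : \det (webster_metric p) = \det (webster_metric (0 : K)).
Proof.
have E (p' : K) : (\det (\matrix_A webster_frame A p')) ^+ 2 * \det (webster_metric p') = 1.
  rewrite -[RHS](det1 R q) expr2 mulrAC -[X in _ * X]det_tr -!det_mulmx.
  congr (\det _); apply/matrixP => A B.
  rewrite [RHS]mxE -(webster_frame_orthonormal p' A B) /inner.
  rewrite !mxE; apply: eq_bigr => k _; rewrite !mxE; congr (_ * _).
  by apply: eq_bigr => l _; rewrite !mxE.
have d0 : (\det (\matrix_A webster_frame A (0 : K))) ^+ 2 != 0.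
  by apply/eqP => d0; have := E 0; rewrite d0 mul0r => /eqP; rewrite eq_sym oner_eq0.
by apply: (mulfI d0); rewrite E -(frame_matrix_det p) E.
Qed.

Lemma derive_zsq (p v : K) : 'D_v (@zsq R m) p = \sum_a 2 * p 0 (zix a) * v 0 (zix a).
Proof.
pose F := fun (a : 'I_(m + m)) (p : K) => p 0 (zix a) : R.
have dF a : differentiable (F a) p by exact: differentiable_coord.
have -> : @zsq R m = \sum_a (F a * F a) :> (K -> R).
  by apply/funext => y; rewrite /zsq fct_sumE; apply: eq_bigr => a _; rewrite expr2.
rewrite derive_sum => [|a]; last by apply: diff_derivable; exact: differentiableM.
apply: eq_bigr => a _; have da := @diff_derivable _ _ _ _ _ v (dF a).
rewrite deriveM // -coord_derive ?derive_id //.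
by rewrite -mulr2n -scaler_nat -[RHS]mulrA.
Qed.

End Heis.

(** * Integration by parts *)

Section RadialCalculus.
Variables (R : realType) (m : nat).
Local Notation leb := (@lebesgue_measure R).
Local Notation q := (m + m + 1)%N.
Local Notation K := (heisenberg R m).
Local Notation zix a := (lshift 1 a : 'I_q).
Local Notation "'t'" := (it m).
Variable S : coord_space R q.
Hypothesis okS : lebesgue_coords S.
Local Notation mu := (cs_measure S).
Local Notation pos := (cs_pos S).
Local Notation Int := (@Int R m S).

Lemma test_funD (k l : K -> R) : test_fun pos k -> test_fun pos l ->
  test_fun pos (fun p => k p + l p).
Proof.
move=> [mk [C [M kP]]] [ml [D [L lP]]]; split; first exact: measurable_funD.
exists (C + D), (Num.max M L) => x; split.
  by rewrite (le_trans (ler_normD _ _)) // lerD; [| exact: (kP x).1| exact: (lP x).1].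
move=> n0 i; rewrite le_max.
have [k0|k0] := eqVneq (k x) 0; last by rewrite (kP x).2.
by rewrite (lP x).2 ?orbT //; move: n0; rewrite k0 add0r.
Qed.

Variables (chi dchi : R -> R).
Hypothesis chiD : forall s : R, is_derive s (1 : R) chi (dchi s).
Hypothesis dchi_cont : continuous dchi.
Hypothesis chi_weight : weight chi.
Hypothesis dchi_weight : weight dchi.

Lemma cvg_line (u : K -> R) (x v : K) : continuous u ->
  continuous (fun s : R => u (x + s *: v)).
Proof.
move=> cu s; apply: (@continuous_comp _ _ _ (fun s : R => x + s *: v) u); last exact: cu.
by apply: continuousD; [exact: cst_continuous|exact: scalel_continuous].
Qed.

Lemma C1_cutoff (u : K -> R) : C1_on setT u -> C1_on setT (fun p => u p * chi (zsq p)).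
Proof.
by move=> cu; exact: (C1_onM openT cu (C1_on_comp1 openT chiD dchi_cont (@C1_zsq R m))).
Qed.

Lemma derive_cutoff (u : K -> R) p v : C1_on setT u ->
  'D_v (fun p => u p * chi (zsq p)) p =
  'D_v u p * chi (zsq p) + u p * (dchi (zsq p) * 'D_v (@zsq R m) p).
Proof.
move=> cu; have du := (cu p I).1; have dz := (@C1_zsq R m p I).1.
have dc : differentiable (fun p : K => chi (zsq p)) p.
  exact: (C1_on_comp1 openT chiD dchi_cont (@C1_zsq R m) I).1.
rewrite (@deriveM _ _ u (fun p => chi (zsq p))); try exact: diff_derivable.
rewrite (derive_comp1 _ (chiD _) dz) addrC; congr (_ + _); exact: mulrC.
Qed.

Lemma zsq_dir (p : K) i : 'D_(basis_vec R i) (@zsq R m) p =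
  if i == t then 0 else 2 * p 0 i.
Proof.
rewrite derive_zsq; case: (split_ordP i) => a ->.
  rewrite eq_lrshift (bigD1 a) //= big1 ?addr0 => [|b ba].
    by rewrite basis_vecE eqxx mulr1.
  by rewrite basis_vecE eq_lshift (negbTE ba) mulr0.
rewrite (ord1 a) eqxx big1 // => b _.
by rewrite basis_vecE eq_lrshift mulr0.
Qed.

Lemma C1_pd_continuous (u : K -> R) i : C1_on setT u -> continuous (fun p => 'D_(basis_vec R i) u p).
Proof. by move=> cu x; exact: (cu x I).2. Qed.

(** The horizontal coordinate fields differentiate the cutoff as well; its
   derivative along [z_a] is [2 * z_a * dchi]. *)
Lemma Int_byparts_z (a : 'I_(m + m)) (u : K -> R) : C1_on setT u ->
  Int chi (fun p => 'D_(basis_vec R (zix a)) u p) +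
  Int dchi (fun p => 2 * p 0 (zix a) * u p) = 0.
Proof.
move=> cu; set b := basis_vec R (zix a).
have cDu : continuous (fun p => 'D_b u p) by exact: C1_pd_continuous.
have cz : continuous (fun p : K => 2 * p 0 (zix a) * u p).
  exact: (C1_onT_continuous (C1_onM openT (C1_onM openT (C1_on_cst openT 2)
    (C1_on_coord openT (zix a))) cu)).
pose k1 := cut chi (fun p => 'D_b u p); pose k2 := cut dchi (fun p : K => 2 * p 0 (zix a) * u p).
have t1 : test_fun pos k1 by exact: cut_test.
have t2 : test_fun pos k2 by exact: cut_test.
rewrite /Int -RintegralD //; try exact: cut_integrable.
rewrite /Rintegral (coords_fubini okS (test_funD t1 t2) (i := zix a)) // => x.
set one := ((0 <= x 0 t < 1)%R%:R : R).
pose v := fun p => u p * chi (zsq p).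
have cv : C1_on setT v by exact: C1_cutoff.
pose W s := v (x + s *: b) * one.
pose w s := 'D_b v (x + s *: b) * one.
have -> : (fun s => (k1 (x + s *: b) + k2 (x + s *: b))%:E) = (fun s => (w s)%:E).
  apply/funext => s; congr (_%:E); rewrite /k1 /k2 /cut /w derive_cutoff // zsq_dir.
  by rewrite eq_lrshift shift_coord eq_rlshift mulr0 addr0 -/one; ring.
have Wd (s : R) : is_derive s (1 : R) W (w s).
  have dv : differentiable v (x + s *: b) by exact: (cv _ I).1.
  have := is_deriveM (is_derive_line dv) (@is_derive_cst _ _ _ one s 1).
  by rewrite scaler0 add0r => h; apply: is_derive_eq h _; exact: mulrC.
have cw : continuous w.
  have cDv : continuous (fun s : R => 'D_b v (x + s *: b)).
    by apply: (@cvg_line (fun p => 'D_b v p)); exact: C1_pd_continuous.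
  by move=> s; apply: cvgM; [exact: cDv|exact: cst_continuous].
have [_ [C1 [s1 h1]]] := chi_weight; have [_ [C2 [s2 h2]]] := dchi_weight.
pose L := `|x 0 (zix a)| + `|s1| + `|s2| + 1.
apply: (@integral_derivative_compact _ W w L) => //.
  by rewrite ltr_wpDl // !addr_ge0.
move=> s Ls.
have zL : s1 < zsq (x + s *: b) /\ s2 < zsq (x + s *: b).
  have : (x 0 (zix a) + s) ^+ 2 <= zsq (x + s *: b).
    rewrite /zsq (bigD1 a) //= shift_coord eqxx mulr1 lerDl.
    by apply: sumr_ge0 => c _; exact: sqr_ge0.
  have : `|s1| + `|s2| + 1 <= `|x 0 (zix a) + s|.
    have tri : `|s| <= `|x 0 (zix a)| + `|x 0 (zix a) + s|.
      by rewrite -{1}(addKr (x 0 (zix a)) s) (le_trans (ler_normD _ _)) // normrN.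
    move: Ls tri; rewrite /L; lra.
  rewrite -real_normK ?num_real //.
  have := ler_norm s1; have := ler_norm s2.
  have := normr_ge0 s1; have := normr_ge0 s2.
  move: `|s1| `|s2| `|_ + s| (zsq _) => A B Y Z; nra.
have z1 : chi (zsq (x + s *: b)) = 0 by exact: (h1 _).2 zL.1.
have z2 : dchi (zsq (x + s *: b)) = 0 by exact: (h2 _).2 zL.2.
by rewrite /W /w /v derive_cutoff // z1 z2 !(mulr0, mul0r, addr0).
Qed.

(** The cutoff does not depend on [t], and over one period the boundary terms
   cancel. *)
Lemma Int_byparts_t (u : K -> R) : C1_on setT u ->
  (forall p, u (p + basis_vec R t) = u p) ->
  Int chi (fun p => 'D_(basis_vec R t) u p) = 0.
Proof.
move=> cu up; set b := basis_vec R t.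
have cDu : continuous (fun p => 'D_b u p) by exact: C1_pd_continuous.
have t1 : test_fun pos (cut chi (fun p => 'D_b u p)) by exact: cut_test.
rewrite /Int /Rintegral (coords_fubini okS t1 (i := t)) // => x.
pose v := fun p => u p * chi (zsq p).
have cv : C1_on setT v by exact: C1_cutoff.
pose W s := v (x + s *: b).
pose w s := 'D_b v (x + s *: b).
have -> : (fun s => (cut chi (fun p => 'D_b u p) (x + s *: b))%:E) =
          (fun s => (w s * (0 <= x 0 t + s < 1)%R%:R)%:E).
  apply/funext => s; congr (_%:E); rewrite /cut /w derive_cutoff // zsq_dir eqxx.
  by rewrite !mulr0 addr0 shift_coord eqxx mulr1.
apply: (@integral_derivative_period _ W).
- by move=> s; apply: is_derive_line; exact: (cv _ I).1.
- by apply: (@cvg_line (fun p => 'D_b v p)); exact: C1_pd_continuous.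
- rewrite /W (_ : x + (1 - x 0 t) *: b = (x + (- x 0 t) *: b) + b); last first.
    by rewrite scalerDl scale1r -addrA [b + _]addrC.
  rewrite /v up; congr (_ * chi _).
  rewrite /zsq; apply: eq_bigr => a _; congr (_ ^+ 2).
  by rewrite mxE basis_vecE eq_lrshift addr0.
Qed.

End RadialCalculus.

(** * Integrals over disks *)

Section Disks.
Variables (R : realType) (m : nat).
Local Notation q := (m + m + 1)%N.
Local Notation K := (heisenberg R m).
Variable S : coord_space R q.
Hypothesis okS : lebesgue_coords S.
Local Notation mu := (cs_measure S).
Local Notation pos := (cs_pos S).

Definition disk_weight (s c : R) : R := (c <= s)%R%:R.

Lemma disk_weight_ge0 s c : 0 <= disk_weight s c.
Proof. by rewrite /disk_weight ler0n. Qed.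

Lemma disk_weightP s : weight (disk_weight s).
Proof.
split.
  have -> : disk_weight s = \1_(`]-oo, s]%classic : set R) :> (R -> R).
    by apply/funext => c; rewrite indicE mem_setE in_itv.
  exact: measurable_indic.
exists 1, s => c; split => [|sc]; rewrite /disk_weight.
  by case: (c <= s); rewrite ?normr1 ?normr0.
by rewrite leNgt sc.
Qed.

Local Notation D s u := (Int S (disk_weight s) u).

Lemma mem_disk (rho : R) (p : K) : 0 <= rho ->
  (p \in disk rho) = (zsq p <= rho ^+ 2) && (0 <= p 0 (it m) < 1).
Proof.
move=> r0; have E : (znorm p <= rho) = (zsq p <= rho ^+ 2).
  by rewrite znormE -{1}(ger0_norm r0) -sqrtr_sqr ler_sqrt // sqr_ge0.
apply/idP/idP; rewrite inE /disk /=; first by rewrite E => -[-> ->].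
by rewrite E => /andP[].
Qed.

(** The constant volume density comes out of the integral. *)
Lemma integral_disk_Int (rho : R) (h : K -> R) : 0 <= rho -> continuous h ->
  (forall p, 0 <= h p) ->
  integral_disk rho h =
    Num.sqrt (\det (webster_metric (0 : K))) * D (rho ^+ 2) h.
Proof.
move=> r0 ch h0; set c0 := Num.sqrt _.
have ci : mu.-integrable setT (EFin \o (cut (disk_weight (rho ^+ 2)) h \o pos)).
  by apply: cut_integrable => //; exact: disk_weightP.
rewrite /Int -RintegralZl // /Rintegral /integral_disk; congr fine.
have -> : (fun p : K => (\1_(disk rho) p * (h p * Num.sqrt (\det (webster_metric p))))%:E)
   = (fun p => (c0 * cut (disk_weight (rho ^+ 2)) h p)%:E).
  apply/funext => p; congr (_%:E); rewrite indicE mem_disk // webster_det -/c0 /cut /disk_weight.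
  case: (zsq p <= _); case: (0 <= p 0 (it m) < 1); rewrite /= ?(mul0r, mulr0, mul1r, mulr1) //.
  exact: mulrC.
rewrite (coords_integralRn okS) //.
  move=> p; rewrite lee_fin mulr_ge0 ?sqrtr_ge0 // /cut !mulr_ge0 //; exact: disk_weight_ge0.
have /integrableP[mci _] := ci.
apply/measurable_EFinP; apply: measurable_funM => //.
by move/measurable_EFinP : mci.
Qed.

Lemma Int_disk_mono s s' (u : K -> R) : continuous u -> (forall p, 0 <= u p) ->
  s <= s' -> D s u <= D s' u.
Proof.
move=> cu u0 ss; apply: le_Int => //; try exact: disk_weightP.
move=> p; rewrite ler_wpM2l // /disk_weight ler_nat.
by case: (leP (zsq p) s) => // zs; rewrite (le_trans zs ss).
Qed.

(** The disks are closed, so their indicators decrease to the indicator of the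
   smaller disk as the radius decreases: dominated convergence. *)
Lemma Int_disk_right (s eta : R) (u : K -> R) : continuous u -> (forall p, 0 <= u p) ->
  0 < eta -> exists2 e, 0 < e & forall s', s' <= s + e -> D s' u <= D s u + eta.
Proof.
move=> cu u0 eta0.
pose f n t := (cut (disk_weight (s + n.+1%:R^-1)) u (pos t))%:E.
pose f' t := (cut (disk_weight s) u (pos t))%:E.
have ci s' : mu.-integrable setT (EFin \o (cut (disk_weight s') u \o pos)).
  by apply: cut_integrable => //; exact: disk_weightP.
have mci s' : measurable_fun setT (EFin \o (cut (disk_weight s') u \o pos)).
  by have /integrableP[] := ci s'.
have cut0 s' p : 0 <= cut (disk_weight s') u p.
  by rewrite /cut !mulr_ge0 //; exact: disk_weight_ge0.
have [_ _ fcvg] : [/\ mu.-integrable setT f',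
    [sequence (\int[mu]_(x in setT) `|f n x - f' x|)%E]_n @ \oo --> 0%E &
    [sequence (\int[mu]_(x in setT) (f n x))%E]_n @ \oo --> (\int[mu]_(x in setT) (f' x))%E].
  apply: (@dominated_convergence _ _ _ mu setT measurableT f f'
     (fun t => (cut (disk_weight (s + 1)) u (pos t))%:E)) => //.
  - by move=> n; exact: mci.
  - exact: mci.
  - apply: aeW => t _; apply: cvg_EFin; first by near=> n.
    rewrite /cut; apply: cvgM; last exact: cvg_cst.
    apply: cvgM; first exact: cvg_cst.
    rewrite /disk_weight; case: (leP (zsq (pos t)) s) => zs.
      under eq_cvg => n do rewrite /= (le_trans zs) ?lerDl //; exact: cvg_cst.
    have zs0 : 0 < zsq (pos t) - s by rewrite subr_gt0.
    apply: cvg_near_cst; have := near_infty_natSinv_lt (PosNum zs0).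
    by apply: filterS => n /= hn; rewrite leNgt -ltrBrDl hn.
  - exact: ci.
  - apply: aeW => t n _; rewrite /f gee0_abs ?lee_fin // /cut.
    rewrite ler_wpM2r // ler_wpM2l // /disk_weight ler_nat.
    case: (leP (zsq _) (s + n.+1%:R^-1)) => // /le_trans -> //.
    by rewrite lerD2l invf_le1 // ler1n.
have fE s' : (\int[mu]_t (cut (disk_weight s') u (pos t))%:E)%E = (D s' u)%:E.
  by rewrite /Int /Rintegral fineK //; exact: (integrable_fin_num measurableT (ci s')).
have {}fcvg : (fun n => D (s + n.+1%:R^-1) u) @ \oo --> D s u.
  move: fcvg; rewrite /f' fE /f.
  under eq_fun do rewrite fE.
  by move/fine_cvg.
move/cvgrPdist_lt : fcvg => /(_ _ eta0)[n _ nP].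
exists n.+1%:R^-1 => [|s' ss']; first by rewrite invr_gt0 ltr0n.
rewrite (le_trans (Int_disk_mono cu u0 ss')) //.
have := nP n (leqnn n); rewrite /= ltr_norml => /andP[h _].
by move: h; set A := Int _ _ _; set B := Int _ _ _; lra.
Unshelve. all: by end_near. Qed.

End Disks.

(** * The stress identity *)

Section BilinearForms.
Variable R : realType.

Definition form (n : nat) (M : 'M[R]_n) (u v : 'rV[R]_n) : R := (u *m M *m v^T) 0 0.

Variable n : nat.
Implicit Types (M N : 'M[R]_n) (u v w : 'rV[R]_n).

Lemma formDl M u w v : form M (u + w) v = form M u v + form M w v.
Proof. by rewrite /form !mulmxDl mxE. Qed.

Lemma formZl M a u v : form M (a *: u) v = a * form M u v.
Proof. by rewrite /form -!scalemxAl mxE. Qed.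

Lemma form0l M v : form M 0 v = 0.
Proof. by rewrite /form !mul0mx mxE. Qed.

Lemma form_tr M u v : form M^T u v = form M v u.
Proof.
rewrite /form -[in LHS](trmxK (u *m M^T *m v^T)) mxE.
by rewrite !trmx_mul !trmxK mulmxA.
Qed.

Lemma formDr M u w v : form M v (u + w) = form M v u + form M v w.
Proof. by rewrite -!(form_tr M) formDl. Qed.

Lemma formZr M a u v : form M v (a *: u) = a * form M v u.
Proof. by rewrite -!(form_tr M) formZl. Qed.

Lemma form_addmx M N u v : form (M + N) u v = form M u v + form N u v.
Proof. by rewrite /form mulmxDr mulmxDl mxE. Qed.

Lemma form_mulmx M N u v : form (M *m N) u v = form N (u *m M) v.
Proof. by rewrite /form mulmxA. Qed.

Lemma form_mulmx_tr M N u v : form (M *m N^T) u v = form M u (v *m N).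
Proof. by rewrite /form trmx_mul !mulmxA. Qed.

Lemma formE M u v : form M u v = \sum_i \sum_j u 0 i * M i j * v 0 j.
Proof.
rewrite /form mxE exchange_big; apply: eq_bigr => j _ /=.
by rewrite [(_ *m _) 0 j]mxE mulr_suml; apply: eq_bigr => i _; rewrite [v^T _ _]mxE.
Qed.

Lemma form_suml (I : finType) M (F : I -> 'rV[R]_n) v :
  form M (\sum_i F i) v = \sum_i form M (F i) v.
Proof.
elim/big_rec2: _ => [|i y z _ IH]; first exact: form0l.
by rewrite formDl IH.
Qed.

Lemma form_sumr (I : finType) M (F : I -> 'rV[R]_n) v :
  form M v (\sum_i F i) = \sum_i form M v (F i).
Proof. by rewrite -form_tr form_suml; apply: eq_bigr => i _; rewrite form_tr. Qed.

Lemma form_pd M i j : form M (basis_vec R i) (basis_vec R j) = M i j.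
Proof. by rewrite /form /basis_vec -rowE trmx_delta -colE !mxE. Qed.

(** A matrix is determined by its bilinear form; equalities of metrics are proved
   on vectors, where adjoints and projections act visibly. *)
Lemma form_mx_inj M N : (forall u v, form M u v = form N u v) -> M = N.
Proof. by move=> MN; apply/matrixP => i j; rewrite -!form_pd. Qed.

End BilinearForms.

Section EnergyIdentity.
Variables (R : realType) (m : nat).
Local Notation q := (m + m + 1)%N.
Local Notation K := (heisenberg R m).
Local Notation zix a := (lshift 1 a : 'I_q).
Local Notation "'t'" := (it m).
Local Notation pd i := (basis_vec R i : K).
Local Notation fr a p := (webster_frame (zix a) p : K).

(** The monotonicity formula depends on the map only through the pull-back [H] of
   the transverse metric of the target.  The last field is the horizontal
   harmonic map equation: the stress-energy tensor is divergence free.  The frame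
   is frozen at [p] while differentiating, and [Z] is constant. *)
Record conserved_tensor (H : K -> 'M[R]_q) : Prop := {
  conserved_C1 : C1mx_on setT H;
  conserved_sym : forall p, (H p)^T = H p;
  conserved_ge0 : forall p v, 0 <= form (H p) v v;
  conserved_periodic : forall p, H (p + pd t) = H p;
  conserved_div : forall p Z, \sum_(a < m + m)
    ('D_(fr a p) (fun y => form (H y) (fr a p) Z) p
     - 2^-1 * 'D_Z (fun y => form (H y) (fr a p) (fr a p)) p) = 0 }.

Variable H : K -> 'M[R]_q.
Hypothesis okH : conserved_tensor H.
Local Notation bil p := (form (H p)).
Let HC1 := conserved_C1 okH.
Let Hsym := conserved_sym okH.
Let Hdiv := conserved_div okH.

Lemma conserved_formC p u v : bil p u v = bil p v u.
Proof. by rewrite -[in LHS](Hsym p) form_tr. Qed.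

Lemma form_frame_pd p a j : bil p (fr a p) (pd j) = H p (zix a) j + slope a p * H p t j.
Proof. by rewrite frame_zix formDl formZl !form_pd. Qed.

Lemma form_frame p a : bil p (fr a p) (fr a p) =
  H p (zix a) (zix a) + 2 * slope a p * H p (zix a) t + slope a p ^+ 2 * H p t t.
Proof.
have Ht : H p t (zix a) = H p (zix a) t by rewrite -[in LHS]Hsym mxE.
by rewrite [in X in bil p _ X]frame_zix formDr formZr !form_frame_pd Ht; ring.
Qed.

Definition energy p : R := 2^-1 * \sum_a bil p (fr a p) (fr a p).

(** This field has no [t] component, but is horizontal: it equals the combination
   [\sum_a z_a e_a] of the frame, in which the [t] components cancel
   ([sum_coord_slope]). *)
Definition radial (p : K) : K := \sum_a p 0 (zix a) *: pd (zix a).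

Definition radial_flux a p : R := bil p (fr a p) (radial p).

(** Since [- slope a / 2] are the coordinates of the radial field rotated by a
   quarter turn, this is [2 * H (J r, T)].  It measures the failure of the frame
   to commute, whose brackets are vertical. *)
Definition twist p : R := - \sum_a slope a p * bil p (fr a p) (2 *: pd t).

Lemma radial_fluxE a p : radial_flux a p =
  \sum_b p 0 (zix b) * (H p (zix a) (zix b) + slope a p * H p t (zix b)).
Proof.
by rewrite /radial_flux /radial form_sumr; apply: eq_bigr => b _; rewrite formZr form_frame_pd.
Qed.

Let C1c (c : R) : C1_on (setT : set K) (fun=> c) := C1_on_cst openT c.
Let C1x i : C1_on (setT : set K) (fun y : K => y 0 i) := C1_on_coord openT i.
Let C1s a : C1_on (setT : set K) (slope a) := @C1_slope R m a.

Lemma C1_frame_pd a j : C1_on setT (fun p => bil p (fr a p) (pd j)).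
Proof.
apply: (eq_C1_on openT _ (C1_onD openT (HC1 (zix a) j) (C1_onM openT (C1s a) (HC1 t j)))).
by move=> p _; rewrite form_frame_pd.
Qed.

Lemma C1_frame a : C1_on setT (fun p => bil p (fr a p) (fr a p)).
Proof.
apply: (eq_C1_on openT _ (C1_onD openT (C1_frame_pd a (zix a))
  (C1_onM openT (C1s a) (C1_frame_pd a t)))).
by move=> p _; rewrite [in X in _ = bil p _ X]frame_zix formDr formZr.
Qed.

Lemma C1_energy : C1_on setT energy.
Proof.
by apply: (C1_onM openT (C1c _)); apply: (C1_on_sum openT) => a _; exact: C1_frame.
Qed.

Lemma C1_radial_flux a : C1_on setT (radial_flux a).
Proof.
have c : C1_on setT (fun p => \sum_b p 0 (zix b) * bil p (fr a p) (pd (zix b))).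
  by apply: (C1_on_sum openT) => b _; exact: (C1_onM openT (C1x _) (C1_frame_pd a _)).
apply: (eq_C1_on openT _ c) => p _.
by rewrite /radial_flux /radial form_sumr; apply: eq_bigr => b _; rewrite formZr.
Qed.

Lemma slope_frame a p : slope a (fr a p) = 0.
Proof. by rewrite frame_zix slopeD slope_t slope_zix mulr0 addr0. Qed.

Lemma coord_decomposition p : p = radial p + p 0 t *: pd t.
Proof.
rewrite {1}[p](row_sum_delta p) big_split_ord /= big_ord_recl big_ord0 addr0.
by congr (_ + p 0 _ *: delta_mx 0 _); exact: val_inj.
Qed.

Lemma sum_coord_slope_pd a (p : K) : \sum_b p 0 (zix b) * slope a (pd (zix b)) = slope a p.
Proof.
rewrite [in RHS](coord_decomposition p) slopeD slope_t mulr0 addr0 /radial.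
elim/big_rec2: _ => [|b x y _ IH]; last by rewrite [in RHS]addrC slopeD -IH addrC.
by rewrite /slope; case: (fintype.split a) => j; rewrite mxE mulr0 ?oppr0.
Qed.

Lemma sum_coord_slope (p : K) : \sum_a p 0 (zix a) * slope a p = 0.
Proof.
rewrite big_split_ord /= -big_split big1 //= => j _.
by rewrite /slope split_lshift split_rshift /ix /iy; ring.
Qed.

Let dH p i j : differentiable (fun y => H y i j) p := (HC1 i j I).1.
Let ds p a : differentiable (slope a) p := (@C1_slope R m a p I).1.
Let dM (u w : K -> R) p : differentiable u p -> differentiable w p ->
  differentiable (fun y : K => u y * w y : R) p.
Proof. exact: differentiableM. Qed.
Let dD (u w : K -> R) p : differentiable u p -> differentiable w p ->
  differentiable (fun y : K => u y + w y : R) p.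
Proof. exact: differentiableD. Qed.
Let dc (c : R) (p : K) : differentiable (fun=> c) p := differentiable_cst c p.

Lemma derive_frozen_pd p w a j : 'D_w (fun y => bil y (fr a p) (pd j)) p =
  'D_w (fun y => H y (zix a) j) p + slope a p * 'D_w (fun y => H y t j) p.
Proof.
have -> : (fun y => bil y (fr a p) (pd j)) =
    (fun y => H y (zix a) j + (fun=> slope a p) y * H y t j).
  by apply/funext => y; rewrite frame_zix formDl formZl !form_pd.
rewrite deriveD_at ?deriveM_at ?derive_cst ?mul0r ?add0r //.
exact: dM.
Qed.

Lemma derive_frozen_frame p w a : 'D_w (fun y => bil y (fr a p) (fr a p)) p =
  'D_w (fun y => H y (zix a) (zix a)) p + 2 * slope a p * 'D_w (fun y => H y (zix a) t) p
  + slope a p ^+ 2 * 'D_w (fun y => H y t t) p.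
Proof.
have -> : (fun y => bil y (fr a p) (fr a p)) =
    (fun y => H y (zix a) (zix a) + (fun=> 2 * slope a p) y * H y (zix a) t
              + (fun=> slope a p ^+ 2) y * H y t t).
  apply/funext => y; have Ht : H y t (zix a) = H y (zix a) t by rewrite -[in LHS]Hsym mxE.
  by rewrite frame_zix !(formDl, formDr, formZl, formZr) !form_pd Ht; ring.
have h1 := dM (@dc (2 * slope a p) p) (dH p (zix a) t).
have h2 := dM (@dc (slope a p ^+ 2) p) (dH p t t).
have h3 := dD (dH p (zix a) (zix a)) h1.
rewrite (deriveD_at _ h3 h2) (deriveD_at _ (dH p _ _) h1).
rewrite (deriveM_at _ (dc (2 * slope a p) p) (dH p (zix a) t)).
rewrite (deriveM_at _ (dc (slope a p ^+ 2) p) (dH p t t)).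
by rewrite !derive_cst !mul0r !add0r.
Qed.

(** Letting the frame move adds the derivative of its slope. *)
Lemma derive_frame p w a : 'D_w (fun y => bil y (fr a y) (fr a y)) p =
  'D_w (fun y => bil y (fr a p) (fr a p)) p
  + 2 * slope a w * bil p (fr a p) (pd t).
Proof.
rewrite derive_frozen_frame form_frame_pd.
have -> : (fun y => bil y (fr a y) (fr a y)) =
    (fun y => H y (zix a) (zix a) + ((fun=> 2) y * (slope a y * H y (zix a) t))
              + (slope a y * (slope a y * H y t t))).
  by apply/funext => y; rewrite form_frame; ring.
have h0 := dM (ds p a) (dH p (zix a) t).
have h1 := dM (@dc 2 p) h0.
have h2 := dM (ds p a) (dH p t t).
have h3 := dM (ds p a) h2.
have h4 := dD (dH p (zix a) (zix a)) h1.
rewrite (deriveD_at _ h4 h3) (deriveD_at _ (dH p _ _) h1) (deriveM_at _ (@dc 2 p) h0).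
rewrite (deriveM_at _ (ds p a) (dH p (zix a) t)) (deriveM_at _ (ds p a) h2).
rewrite (deriveM_at _ (ds p a) (dH p t t)) derive_cst !derive_slope; ring.
Qed.

Lemma derive_radial_flux p a : 'D_(fr a p) (radial_flux a) p =
  bil p (fr a p) (pd (zix a)) +
  \sum_b p 0 (zix b) * 'D_(fr a p) (fun y => bil y (fr a p) (pd (zix b))) p.
Proof.
set w := fr a p.
have -> : radial_flux a = (fun y => \sum_b y 0 (zix b) *
    (H y (zix a) (zix b) + slope a y * H y t (zix b))).
  by apply/funext => y; rewrite radial_fluxE.
have dx b : differentiable (fun y : K => y 0 (zix b)) p by exact: differentiable_coord.
have h0 b := dM (ds p a) (dH p t (zix b)).
have h1 b := dD (dH p (zix a) (zix b)) (h0 b).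
rewrite derive_sum_at => [|b]; last exact: dM.
have wb b : w 0 (zix b) = (b == a)%:R.
  by rewrite /w frame_zix shift_coord basis_vecE eq_lshift eq_lrshift mulr0 addr0.
have E b : 'D_w (fun y : K => y 0 (zix b) * (H y (zix a) (zix b) + slope a y * H y t (zix b))) p
   = (b == a)%:R * bil p w (pd (zix b)) +
     p 0 (zix b) * 'D_w (fun y => bil y w (pd (zix b))) p.
  rewrite (deriveM_at _ (dx b) (h1 b)) derive_coord wb /w derive_frozen_pd form_frame_pd.
  rewrite (deriveD_at _ (dH p _ _) (h0 b)) (deriveM_at _ (ds p a) (dH p _ _)).
  by rewrite derive_slope slope_frame mul0r add0r.
rewrite (eq_bigr _ (fun b _ => E b)) big_split /=; congr (_ + _).
rewrite (bigD1 a) //= eqxx mul1r big1 ?addr0 // => b /negbTE ->.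
by rewrite mul0r.
Qed.

Lemma derive_energy p w : 'D_w energy p =
  \sum_a (2^-1 * 'D_w (fun y => bil y (fr a p) (fr a p)) p
           + slope a w * bil p (fr a p) (pd t)).
Proof.
have df a : differentiable (fun y => bil y (fr a y) (fr a y)) p by exact: (C1_frame a I).1.
have dS : differentiable (fun y => \sum_a bil y (fr a y) (fr a y)) p.
  have cS : C1_on setT (fun y => \sum_a bil y (fr a y) (fr a y)).
    by apply: (C1_on_sum openT) => a _; exact: C1_frame.
  exact: (cS p I).1.
rewrite (deriveM_at _ (@dc 2^-1 p) dS) derive_cst mul0r add0r derive_sum_at //.
rewrite mulr_sumr; apply: eq_bigr => a _; rewrite derive_frame mulrDr; congr (_ + _).
by rewrite -mulrA mulKf.
Qed.

(** The divergence of the flux of the radial field.  In the Euclidean case the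
   trace of the derivative of the radial field gives [2 * energy]; here the
   moving slopes contribute the twist, once in the flux and once in the energy. *)
Lemma flux_identity p :
  \sum_a 'D_(fr a p) (radial_flux a) p - \sum_b p 0 (zix b) * 'D_(pd (zix b)) energy p =
  2 * energy p + twist p.
Proof.
rewrite (eq_bigr _ (fun a _ => derive_radial_flux p a)) big_split /=.
have -> : \sum_b p 0 (zix b) * 'D_(pd (zix b)) energy p =
    \sum_b p 0 (zix b) * (\sum_a (2^-1 *
    'D_(pd (zix b)) (fun y => bil y (fr a p) (fr a p)) p)) +
    \sum_b p 0 (zix b) * (\sum_a slope a (pd (zix b)) * bil p (fr a p) (pd t)).
  by rewrite -big_split; apply: eq_bigr => b _; rewrite derive_energy big_split mulrDr.
have -> : \sum_b p 0 (zix b) * (\sum_a slope a (pd (zix b)) * bil p (fr a p) (pd t)) =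
    \sum_a slope a p * bil p (fr a p) (pd t).
  under eq_bigr do rewrite mulr_sumr.
  rewrite exchange_big; apply: eq_bigr => a _ /=.
  by under eq_bigr do rewrite mulrA; rewrite -mulr_suml sum_coord_slope_pd.
have -> : \sum_a \sum_b p 0 (zix b) * 'D_(fr a p) (fun y => bil y (fr a p) (pd (zix b))) p =
  \sum_b p 0 (zix b) * \sum_a (2^-1 * 'D_(pd (zix b)) (fun y => bil y (fr a p) (fr a p)) p).
  rewrite exchange_big; apply: eq_bigr => b _ /=; rewrite -mulr_sumr; congr (_ * _).
  by apply/eqP; rewrite -subr_eq0 -sumrB; apply/eqP; exact: Hdiv.
rewrite /twist /energy mulVKf //.
have -> (A B C : R) : A + B - (B + C) = A - C by ring.
rewrite -sumrB -sumrB; apply: eq_bigr => a _.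
have Ht : H p t (zix a) = H p (zix a) t by rewrite -[in LHS]Hsym mxE.
by rewrite formZr form_frame !form_frame_pd Ht; ring.
Qed.

End EnergyIdentity.

(** * Energy balance on disks *)

Section Trapezoid.
Variable R : realType.

Definition ramp (x : R) : R := Num.max x 0.

(** Half the square of a ramp is differentiable at its corner, because the
   remainder is quadratic. *)
Lemma is_derive_quadratic (f : R -> R) (x l : R) :
  (forall h, `|f (x + h) - f x - h * l| <= h ^+ 2) -> is_derive x (1 : R) f l.
Proof.
move=> fl; have c : (fun h : R => h^-1 *: ((f \o shift x) (h *: (1 : R)) - f x)) @ 0^' --> l.
  apply/cvgrPdist_le => e e0; near=> h.
  have h0 : h != 0 by near: h; exact: nbhs_dnbhs_neq.
  have he : `|h| <= e by near: h; exact: dnbhs0_le.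
  apply: le_trans he; rewrite /= [h *: 1]mulr1 [h + x]addrC distrC.
  have -> : h^-1 *: (f (x + h) - f x) - l = h^-1 * (f (x + h) - f x - h * l).
    by rewrite mulrBr mulKf.
  rewrite normrM normfV ler_pdivrMl ?normr_gt0 //.
  by rewrite -expr2 real_normK ?num_real.
by apply: DeriveDef; [apply: cvgP c|apply: cvg_lim c].
Unshelve. all: by end_near. Qed.

Lemma continuous_ramp : continuous ramp.
Proof. by move=> x; apply: continuous_max; [exact: id|exact: cst_continuous]. Qed.

Variables (s e d : R).
Hypotheses (e0 : 0 < e) (d0 : 0 < d).

(** A continuous trapezoid of height [1 / e] and integral 1, supported in the
   interval from [s] to [s + e + d]; [trapezoid_cutoff] is one minus its
   primitive. *)
Definition trapezoid (c : R) : R := (e * d)^-1 *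
  (ramp (c - s) - ramp (c - s - d) - ramp (c - s - e) + ramp (c - s - e - d)).

Definition trapezoid_cutoff (c : R) : R := 1 - (e * d)^-1 *
  (2^-1 * ramp (c - s) ^+ 2 - 2^-1 * ramp (c - s - d) ^+ 2
   - 2^-1 * ramp (c - s - e) ^+ 2 + 2^-1 * ramp (c - s - e - d) ^+ 2).

Lemma trapezoid_profile (x : R) :
  let T := ramp x - ramp (x - d) - ramp (x - e) + ramp (x - e - d) in
  [/\ 0 <= T, T <= d, x <= 0 -> T = 0 & e + d <= x -> T = 0].
Proof.
move: (e0) (d0) => e1 d1; rewrite /ramp /=; split;
  case: (leP x 0) => h1; case: (leP (x - d) 0) => h2;
  case: (leP (x - e) 0) => h3; case: (leP (x - e - d) 0) => h4; try move=> hx; lra.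
Qed.

Lemma trapezoid_primitive_profile (x : R) :
  let U := 2^-1 * ramp x ^+ 2 - 2^-1 * ramp (x - d) ^+ 2
    - 2^-1 * ramp (x - e) ^+ 2 + 2^-1 * ramp (x - e - d) ^+ 2 in
  [/\ 0 <= U, U <= e * d, x <= 0 -> U = 0 & e + d <= x -> U = e * d].
Proof.
move: (e0) (d0) => e1 d1; rewrite /ramp /=; split;
  case: (leP x 0) => h1; case: (leP (x - d) 0) => h2;
  case: (leP (x - e) 0) => h3; case: (leP (x - e - d) 0) => h4; try move=> hx; nra.
Qed.

Lemma trapezoid_bounds c :
  [/\ 0 <= trapezoid c, trapezoid c <= e^-1, c <= s -> trapezoid c = 0
    & s + e + d <= c -> trapezoid c = 0].
Proof.
have ed0 : 0 < e * d by exact: mulr_gt0.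
have E : e^-1 = (e * d)^-1 * d by rewrite invfM mulfVK ?gt_eqF.
rewrite E /trapezoid; have [T0 T1 T2 T3] := trapezoid_profile (c - s); split.
- by rewrite mulr_ge0 ?invr_ge0 ?(ltW ed0).
- by rewrite ler_pM2l ?invr_gt0.
- by move=> cs; rewrite T2 ?mulr0 // subr_le0.
- by move=> cs; rewrite T3 ?mulr0 // lerBrDl addrA.
Qed.

Lemma trapezoid_cutoff_bounds c :
  [/\ 0 <= trapezoid_cutoff c, trapezoid_cutoff c <= 1, c <= s -> trapezoid_cutoff c = 1
    & s + e + d <= c -> trapezoid_cutoff c = 0].
Proof.
have ed0 : 0 < e * d by exact: mulr_gt0.
rewrite /trapezoid_cutoff; have [U0 U1 U2 U3] := trapezoid_primitive_profile (c - s).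
split.
- by rewrite subr_ge0 mulrC ler_pdivrMr // mul1r.
- by rewrite lerBlDr lerDl mulr_ge0 ?invr_ge0 ?(ltW ed0).
- by move=> cs; rewrite U2 ?mulr0 ?subr0 // subr_le0.
- by move=> cs; rewrite U3 ?mulVf ?gt_eqF ?subrr // lerBrDl addrA.
Qed.

Lemma is_derive_trapezoid_cutoff (c : R) :
  is_derive c (1 : R) trapezoid_cutoff (- trapezoid c).
Proof.
have r (b : R) : is_derive c (1 : R) (fun y => 2^-1 * ramp (y - b) ^+ 2) (ramp (c - b)).
  apply: is_derive_quadratic => h; rewrite /ramp [c + h - b]addrAC.
  by move: (c - b) => x; case: (leP x 0) => x0; case: (leP (x + h) 0) => xh;
    rewrite ler_norml; apply/andP; split; nra.
have rr := is_deriveB (@is_derive_cst _ _ _ (1 : R) c (1 : R))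
 (@is_deriveZ _ _ _ _ (e * d)^-1 _ _ _ (is_deriveD (is_deriveB (is_deriveB (r s) (r (s + d))) (r (s + e))) (r (s + e + d)))).
have E : trapezoid_cutoff = cst 1 - (e * d)^-1 *: ((fun y => 2^-1 * ramp (y - s) ^+ 2) - (fun y => 2^-1 * ramp (y - (s + d)) ^+ 2)
  - (fun y => 2^-1 * ramp (y - (s + e)) ^+ 2) + (fun y => 2^-1 * ramp (y - (s + e + d)) ^+ 2)).
  by apply/funext => y; rewrite /trapezoid_cutoff !fctE !opprD !addrA.
rewrite E; apply: is_derive_eq rr _.
by rewrite /trapezoid sub0r !opprD !addrA.
Qed.

Lemma continuous_trapezoid : continuous trapezoid.
Proof.
have r (b : R) : continuous (fun c => ramp (c - b)).
  move=> c; apply: (@continuous_comp _ _ _ (fun c => c - b) ramp); last exact: continuous_ramp.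
  by apply: continuousB; [exact: id|exact: cst_continuous].
have E : trapezoid = fun c => (e * d)^-1 * (ramp (c - s) - ramp (c - (s + d)) - ramp (c - (s + e)) + ramp (c - (s + e + d))).
  by apply/funext => c; rewrite /trapezoid !opprD !addrA.
rewrite E => c; apply: cvgM; first exact: cvg_cst.
by apply: cvgD; [apply: cvgB; [apply: cvgB|]|]; exact: r.
Qed.

End Trapezoid.

Section EnergyInequality.
Variables (R : realType) (m : nat).
Local Notation q := (m + m + 1)%N.
Local Notation K := (heisenberg R m).
Local Notation zix a := (lshift 1 a : 'I_q).
Local Notation "'t'" := (it m).
Local Notation pd i := (basis_vec R i : K).
Local Notation fr a p := (webster_frame (zix a) p : K).
Variable S : coord_space R q.
Hypothesis okS : lebesgue_coords S.
Variable H : K -> 'M[R]_q.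
Hypothesis okH : conserved_tensor H.
Local Notation bil p := (form (H p)).
Local Notation Int := (@Int R m S).
Local Notation D s u := (Int (disk_weight s) u).
Local Notation e := (energy H).

Let Hpos := conserved_ge0 okH.

Lemma continuous_energy : continuous e.
Proof. exact: C1_onT_continuous (C1_energy okH). Qed.

Lemma energy_ge0 p : 0 <= e p.
Proof. by rewrite mulr_ge0 ?invr_ge0 // sumr_ge0. Qed.

Lemma sum_coord_frame (p : K) : \sum_a p 0 (zix a) *: fr a p = radial p.
Proof.
under eq_bigr do rewrite frame_zix scalerDr scalerA.
by rewrite big_split /= -scaler_suml sum_coord_slope scale0r addr0.
Qed.

Lemma continuous_twist : continuous (twist H).
Proof.
apply: C1_onT_continuous; apply: (C1_onN openT).
apply: (C1_on_sum openT) => a _; apply: (C1_onM openT (@C1_slope R m a)).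
apply: (eq_C1_on openT _ (C1_onM openT (C1_on_cst openT 2) (C1_frame_pd okH a t))).
by move=> p _; rewrite formZr.
Qed.

Section Weighted.
Variables (chi dchi : R -> R).
Hypothesis chiD : forall s : R, is_derive s (1 : R) chi (dchi s).
Hypothesis dchi_cont : continuous dchi.
Hypothesis chi_weight : weight chi.
Hypothesis dchi_weight : weight dchi.

(** The stress identity integrated against a radial cutoff.  The frame field over
   [z_a] is [d/dz_a + slope a * d/dt], and both parts are integrated by parts;
   the second contributes nothing because all integrands are periodic in [t]. *)
Lemma weighted_energy_identity :
  Int chi (fun p => 2 * e p + twist H p) =
  - Int dchi (fun p => 2 * bil p (radial p) (radial p))
  + Int dchi (fun p => 2 * zsq p * e p) + (m + m)%:R * Int chi e.
Proof.
have cflux a : C1_on setT (radial_flux H a) by exact: C1_radial_flux.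
have csf a : C1_on setT (fun p => slope a p * radial_flux H a p).
  exact: (C1_onM openT (@C1_slope R m a) (cflux a)).
have ce := C1_energy okH.
have cxe b : C1_on setT (fun p : K => p 0 (zix b) * e p).
  exact: (C1_onM openT (C1_on_coord openT (zix b)) ce).
pose A p : R := \sum_a ('D_(pd (zix a)) (radial_flux H a) p
    + 'D_(pd t) (fun p => slope a p * radial_flux H a p) p).
pose B p : R := \sum_b ('D_(pd (zix b)) (fun p : K => p 0 (zix b) * e p) p - e p).
have E p : 2 * e p + twist H p = A p - B p.
  rewrite -(flux_identity okH) /A /B; congr (_ - _); apply: eq_bigr => a _.
    rewrite frame_zix addrC derive_linear_dir; last exact: (cflux a p I).1.
    rewrite addrC deriveM_at; [|exact: (C1_slope a I).1|exact: (cflux a p I).1].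
    by rewrite derive_slope slope_t mul0r add0r.
  rewrite (@deriveM_at _ _ (fun p : K => p 0 (zix a)) e); last exact: (ce p I).1.
    by rewrite derive_coord basis_vecE eqxx mul1r [X in _ = X - _]addrC addrK.
  exact: (@C1_on_coord R q setT openT (zix a) p I).1.
have cA1 a : continuous (fun p => 'D_(pd (zix a)) (radial_flux H a) p).
  exact: (C1_pd_continuous (cflux a)).
have cA2 a : continuous (fun p => 'D_(pd t) (fun p => slope a p * radial_flux H a p) p).
  exact: (C1_pd_continuous (csf a)).
have cA a : continuous (fun p => 'D_(pd (zix a)) (radial_flux H a) p
    + 'D_(pd t) (fun p => slope a p * radial_flux H a p) p).
  exact: (continuous_add (cA1 a) (cA2 a)).
have cB1 b : continuous (fun p => 'D_(pd (zix b)) (fun p : K => p 0 (zix b) * e p) p).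
  exact: (C1_pd_continuous (cxe b)).
have cB b : continuous (fun p => 'D_(pd (zix b)) (fun p : K => p 0 (zix b) * e p) p - e p).
  exact: (continuous_sub (cB1 b) continuous_energy).
have cAs : continuous A := continuous_sum cA.
have cBs : continuous B := continuous_sum cB.
rewrite (_ : Int chi _ = Int chi (fun p => A p - B p)); last first.
  by apply: eq_Int => p; rewrite E.
have cx2 a : continuous (fun p : K => 2 * p 0 (zix a) * radial_flux H a p).
  exact: (C1_onT_continuous (C1_onM openT (C1_onM openT (C1_on_cst openT 2)
    (C1_on_coord openT (zix a))) (cflux a))).
have cx3 b : continuous (fun p : K => 2 * p 0 (zix b) * (p 0 (zix b) * e p)).
  exact: (C1_onT_continuous (C1_onM openT (C1_onM openT (C1_on_cst openT 2)
    (C1_on_coord openT (zix b))) (cxe b))).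
have per_flux p a : slope a (p + pd t) * radial_flux H a (p + pd t) =
    slope a p * radial_flux H a p.
  have s1 : slope a (p + pd t) = slope a p.
    by rewrite -[pd t]scale1r slopeD slope_t mulr0 addr0.
  rewrite !radial_fluxE s1; congr (_ * _); apply: eq_bigr => b _.
  by rewrite (conserved_periodic okH) mxE basis_vecE eq_lrshift addr0.
have IA a : Int chi (fun p => 'D_(pd (zix a)) (radial_flux H a) p
    + 'D_(pd t) (fun p => slope a p * radial_flux H a p) p)
    = - Int dchi (fun p : K => 2 * p 0 (zix a) * radial_flux H a p).
  rewrite (IntD okS) // (Int_byparts_t okS chiD) // addr0.
  apply/eqP; rewrite -addr_eq0; apply/eqP; exact: (Int_byparts_z okS chiD).
have IB b : Int chi (fun p => 'D_(pd (zix b)) (fun p : K => p 0 (zix b) * e p) p - e p)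
    = - Int dchi (fun p : K => 2 * p 0 (zix b) * (p 0 (zix b) * e p)) - Int chi e.
  rewrite (IntB okS) //; last exact: continuous_energy.
  congr (_ - _).
  apply/eqP; rewrite -addr_eq0; apply/eqP; exact: (Int_byparts_z okS chiD).
rewrite (IntB okS) // (Int_sum okS) // (Int_sum okS) //.
rewrite (eq_bigr _ (fun a _ => IA a)) [X in _ - X](eq_bigr _ (fun b _ => IB b)).
rewrite sumrB !sumrN -(Int_sum okS) // -(Int_sum okS) // sumr_const card_ord.
have -> : Int dchi (fun p : K => \sum_a 2 * p 0 (zix a) * radial_flux H a p) =
    Int dchi (fun p => 2 * bil p (radial p) (radial p)).
  apply: eq_Int => p; congr (_ * _).
  rewrite -[in X in bil p X _](sum_coord_frame p) form_suml mulr_sumr.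
  by apply: eq_bigr => a _; rewrite formZl mulrA.
have -> : Int dchi (fun p : K => \sum_b 2 * p 0 (zix b) * (p 0 (zix b) * e p)) =
    Int dchi (fun p => 2 * zsq p * e p).
  apply: eq_Int => p; congr (_ * _); rewrite /zsq mulr_sumr mulr_suml.
  by apply: eq_bigr => b _; ring.
by rewrite -mulr_natl; ring.
Qed.

(** The flux through the boundary of the disk is bounded below by minus the
   energy there, since the radial derivative has nonnegative square. *)
Lemma weighted_energy_le : (forall c, dchi c <= 0) ->
  Int chi (fun p => ((m + m)%:R - 2) * e p - twist H p) <=
  Int (fun c => - dchi c) (fun p => 2 * zsq p * e p).
Proof.
move=> dchi0.
have wN : weight (fun c => - dchi c).
  have [mw [C [s wP]]] := dchi_weight; split; first exact: measurableT_comp mw.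
  by exists C, s => c; rewrite normrN; split; [exact: (wP c).1|move=> /(wP c).2 ->; rewrite oppr0].
have cz : continuous (fun p : K => 2 * zsq p * e p).
  exact: (C1_onT_continuous (C1_onM openT (C1_onM openT (C1_on_cst openT 2) (@C1_zsq R m)) (C1_energy okH))).
have crad : continuous (fun p => 2 * bil p (radial p) (radial p)).
  have c : C1_on setT (fun p : K => \sum_a 2 * p 0 (zix a) * radial_flux H a p).
    apply: (C1_on_sum openT) => a _; apply: (C1_onM openT); last exact: C1_radial_flux.
    exact: (C1_onM openT (C1_on_cst openT 2) (C1_on_coord openT (zix a))).
  apply: C1_onT_continuous; apply: (eq_C1_on openT _ c) => p _.
  rewrite -[in X in bil p X _](sum_coord_frame p) form_suml mulr_sumr.
  by apply: eq_bigr => a _; rewrite formZl mulrA.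
have c2e : continuous (fun p => 2 * e p).
  exact: (C1_onT_continuous (C1_onM openT (C1_on_cst openT 2) (C1_energy okH))).
have cne : continuous (fun p => (m + m)%:R * e p).
  exact: (C1_onT_continuous (C1_onM openT (C1_on_cst openT _) (C1_energy okH))).
have ct := continuous_twist.
have := weighted_energy_identity; rewrite (IntD okS) //.
have -> : Int chi (fun p => ((m + m)%:R - 2) * e p - twist H p) =
    (m + m)%:R * Int chi e - (Int chi (fun p => 2 * e p) + Int chi (twist H)).
  rewrite -(IntZ okS) // ; last exact: continuous_energy.
  rewrite -(IntD okS) // -(IntB okS) //; first by apply: eq_Int => p; ring.
  exact: continuous_add c2e ct.
move=> ->.
have -> : Int (fun c => - dchi c) (fun p => 2 * zsq p * e p) =
    - Int dchi (fun p => 2 * zsq p * e p).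
  rewrite -mulN1r -(IntZ okS) //; apply: eq_Int => p; ring.
have : Int dchi (fun p => 2 * bil p (radial p) (radial p)) <= 0.
  rewrite -oppr_ge0 -mulN1r -(IntZ okS) //; apply: Int_ge0 => p.
  by rewrite mulN1r mulNr -mulrN mulr_ge0 ?oppr_ge0 // mulr_ge0.
by set X := Int _ _; set Y := Int _ _; set Z := Int _ _; lra.
Qed.

End Weighted.
End EnergyInequality.

Section DiskInequality.
Variables (R : realType) (m : nat).
Local Notation q := (m + m + 1)%N.
Local Notation K := (heisenberg R m).
Local Notation zix a := (lshift 1 a : 'I_q).
Local Notation "'t'" := (it m).
Local Notation pd i := (basis_vec R i : K).
Local Notation fr a p := (webster_frame (zix a) p : K).
Variable S : coord_space R q.
Hypothesis okS : lebesgue_coords S.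
Variable H : K -> 'M[R]_q.
Hypothesis okH : conserved_tensor H.
Local Notation bil p := (form (H p)).
Local Notation Int := (@Int R m S).
Local Notation D s u := (Int (disk_weight s) u).
Local Notation e := (energy H).

Let Hpos := conserved_ge0 okH.

Lemma weightB (chi chi' : R -> R) : weight chi -> weight chi' ->
  weight (fun c => chi c - chi' c).
Proof.
move=> [mc [C [s cP]]] [mc' [C' [s' cP']]]; split; first exact: measurable_funB.
exists (C + C'), (Num.max s s') => c; split.
  by rewrite (le_trans (ler_normB _ _)) // lerD //; [exact: (cP c).1|exact: (cP' c).1].
by rewrite gt_max => /andP[h h']; rewrite (cP c).2 ?(cP' c).2 ?subrr.
Qed.

Lemma weight_trapezoid (s eps d : R) : 0 < eps -> 0 < d ->
  weight (trapezoid s eps d) /\ weight (trapezoid_cutoff s eps d).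
Proof.
move=> e0 d0; split; split.
- by apply: continuous_measurable_fun; exact: continuous_trapezoid.
- exists eps^-1, (s + eps + d) => c.
  have [h1 h2 _ h4] := trapezoid_bounds s e0 d0 c.
  by split; [rewrite ger0_norm|move=> /ltW].
- apply: continuous_measurable_fun => c; apply/differentiable_continuous/derivable1_diffP.
  by have [] := is_derive_trapezoid_cutoff s eps d c.
- exists 1, (s + eps + d) => c.
  have [h1 h2 _ h4] := trapezoid_cutoff_bounds s e0 d0 c.
  by split; [rewrite ger0_norm|move=> /ltW].
Qed.

(** The integral of this over a disk is what the boundary flux must dominate. *)
Definition balance p : R := ((m + m)%:R - 2) * e p - twist H p.

Lemma continuous_balance : continuous balance.
Proof.
apply: (continuous_sub (u := fun p => ((m + m)%:R - 2) * e p)); last exact: continuous_twist.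
exact: (C1_onT_continuous (C1_onM openT (C1_on_cst openT _) (C1_energy okH))).
Qed.

Lemma continuous_abs_balance : continuous (fun p => `|balance p|).
Proof. by move=> p; apply: continuous_comp; [exact: continuous_balance|exact: norm_continuous]. Qed.

(** The cutoff is 1 up to [s] and 0 from [s'] on, with slope at most [1 / eps].
   Between [s] and [s'] the balance has no sign, which costs the integral of its
   absolute value over the annulus. *)
Lemma disk_balance_trapezoid (s s' eps d : R) : 0 <= s -> 0 < eps -> 0 < d ->
  s' = s + eps + d ->
  eps * (D s balance - (D s' (fun p => `|balance p|) - D s (fun p => `|balance p|)))
    <= 2 * s' * (D s' e - D s e).
Proof.
move=> s0 e0 d0 s'E.
have [wt wc] := weight_trapezoid s e0 d0.
have wd := @disk_weightP R.
have wN : weight (fun c => - trapezoid s eps d c).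
  have [mw [C [r wP]]] := wt; split; first exact: measurableT_comp mw.
  by exists C, r => c; rewrite normrN; split; [exact: (wP c).1|move=> /(wP c).2 ->; rewrite oppr0].
have cN : continuous (fun c => - trapezoid s eps d c).
  by move=> c; apply: cvgN; exact: continuous_trapezoid.
have cb := continuous_balance; have cab := continuous_abs_balance.
have ce := continuous_energy okH.
have ss' : s <= s' by rewrite s'E -addrA lerDl addr_ge0 ?ltW.
have lo : D s balance - (D s' (fun p => `|balance p|) - D s (fun p => `|balance p|))
    <= Int (trapezoid_cutoff s eps d) balance.
  rewrite lerBlDr -lerBlDl (IntB_weight okS) // (IntB_weight okS) //.
  apply: (le_Int okS) => //; try exact: weightB.
  move=> p; rewrite /disk_weight.
  have [t0 t1 t2 t3] := trapezoid_cutoff_bounds s e0 d0 (zsq p); rewrite -s'E in t3.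
  case: (leP (zsq p) s) => zs.
    by rewrite (le_trans zs ss') t2 //= !subrr !mulr0.
  case: (leP (zsq p) s') => zs'; rewrite /= ?mulr0n ?mulr1n; last by rewrite t3 ?(ltW zs') // !subrr !mulr0.
  rewrite sub0r subr0 mulr1 mulrN -mulNr.
  have := ler_norm (- balance p); rewrite normrN; have := normr_ge0 (balance p).
  move: (trapezoid_cutoff _ _ _ _) t0 t1 => T t0 t1.
  move: (balance p) `|_| => b B; nra.
have hi : Int (fun c => - - trapezoid s eps d c) (fun p => 2 * zsq p * e p) <=
    2 * s' * eps^-1 * (D s' e - D s e).
  rewrite (IntB_weight okS) // -(IntZ okS) //; last exact: weightB.
  apply: (le_Int okS) => //.
  - have [mw [C [r wP]]] := wt; split; first by apply: measurableT_comp => //; exact: (proj1 wN).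
    by exists C, r => c; rewrite opprK; exact: wP.
  - exact: weightB.
  - exact: (C1_onT_continuous (C1_onM openT (C1_onM openT (C1_on_cst openT 2) (@C1_zsq R m)) (C1_energy okH))).
  - exact: (C1_onT_continuous (C1_onM openT (C1_on_cst openT _) (C1_energy okH))).
  move=> p; rewrite opprK /disk_weight.
  have [t0 t1 t2 t3] := trapezoid_bounds s e0 d0 (zsq p); rewrite -s'E in t3.
  case: (leP (zsq p) s) => zs.
    by rewrite (le_trans zs ss') t2 //= subrr !mulr0.
  case: (leP (zsq p) s') => zs'; rewrite /= ?mulr0n ?mulr1n; last by rewrite t3 ?(ltW zs') // subrr !mulr0.
  rewrite subr0 mulr1; have ep := energy_ge0 okH p; have z0 := zsq_ge0 p.
  have -> : 2 * s' * eps^-1 * e p = 2 * s' * e p * eps^-1 by ring.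
  apply: ler_pM; [|exact: t0| |exact: t1].
    by apply: mulr_ge0 => //; apply: mulr_ge0.
  by apply: ler_wpM2r => //; rewrite ler_pM2l.
have := weighted_energy_le okS okH (is_derive_trapezoid_cutoff s eps d) cN wc wN.
have dn c : - trapezoid s eps d c <= 0.
  by rewrite oppr_le0; have [] := trapezoid_bounds s e0 d0 c.
move=> /(_ dn) mid.
have := le_trans lo (le_trans mid hi).
by rewrite mulrAC ler_pdivlMr // mulrC.
Qed.

(** Letting the ramps of the trapezoid shrink leaves the difference quotient of
   the energy of disks. *)
Lemma disk_balance (s s' : R) : 0 <= s -> s < s' ->
  (s' - s) * (D s balance - (D s' (fun p => `|balance p|) - D s (fun p => `|balance p|)))
    <= 2 * s' * (D s' e - D s e).
Proof.
move=> s0 ss'; set X := (X in _ * X); set Y := (Y in _ <= _ * Y).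
have Y0 : 0 <= Y.
  rewrite subr_ge0; apply: (Int_disk_mono okS); [exact: continuous_energy|exact: energy_ge0|exact: ltW].
rewrite leNgt; apply/negP => XY.
have d0 : 0 < s' - s by rewrite subr_gt0.
have X0 : 0 < X by rewrite -(pmulr_rgt0 _ d0) (le_lt_trans _ XY) // !mulr_ge0 // (le_trans s0) // ltW.
pose k := ((s' - s) * X - 2 * s' * Y) / (2 * X).
have kX : k * (2 * X) = (s' - s) * X - 2 * s' * Y by rewrite divfK // mulf_neq0 // gt_eqF.
have k0 : 0 < k by rewrite divr_gt0 ?mulr_gt0 // subr_gt0.
have k1 : k < s' - s.
  rewrite /k ltr_pdivrMr ?mulr_gt0 //.
  have : 0 <= 2 * s' * Y by rewrite !mulr_ge0 // (le_trans s0) // ltW.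
  nra.
have k1' : 0 < s' - s - k by rewrite subr_gt0.
have kE : s' = s + (s' - s - k) + k by ring.
have := disk_balance_trapezoid s0 k1' k0 kE; rewrite -/X -/Y; nra.
Qed.

(** Cauchy-Schwarz for [2 * H (J r, T)], linearised with a parameter [l] so that it
   can be integrated.  The bound of [H (J r, J r)] by [|z| ^ 2] times the trace of
   [H] is the sum of squares over pairs of frame vectors. *)
Lemma twist_le (l : R) p : 0 < l ->
  twist H p <= l^-1 * zsq p * (2 * e p) + l * bil p (2 *: pd t) (2 *: pd t).
Proof.
move=> l0; set T := 2 *: pd t.
pose c a := - 2^-1 * slope a p.
pose J := \sum_a c a *: fr a p.
have sc : \sum_a c a ^+ 2 = zsq p.
  under eq_bigr do rewrite exprMn sqrrN.
  by rewrite -mulr_sumr sum_slope_sqr mulrA -[X in X * _ = _](_ : 1 = _) ?mul1r //; field.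
have QE : twist H p = 2 * bil p J T.
  rewrite /twist /J form_suml mulr_sumr -sumrN; apply: eq_bigr => a _.
  by rewrite formZl /c; field.
have e2 : 2 * e p = \sum_a bil p (fr a p) (fr a p) by rewrite /energy mulVKf.
have JJ : bil p J J <= zsq p * (2 * e p).
  have h : 0 <= \sum_a \sum_b bil p (c b *: fr a p - c a *: fr b p) (c b *: fr a p - c a *: fr b p).
    by apply: sumr_ge0 => a _; apply: sumr_ge0 => b _; exact: Hpos.
  have E a b : bil p (c b *: fr a p - c a *: fr b p) (c b *: fr a p - c a *: fr b p) =
      c b ^+ 2 * bil p (fr a p) (fr a p) + c a ^+ 2 * bil p (fr b p) (fr b p)
      - 2 * (c a * c b * bil p (fr a p) (fr b p)).
    rewrite -scaleNr formDl !formDr !formZl !formZr.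
    by rewrite (conserved_formC okH p (fr b p) (fr a p)); ring.
  move: h; under eq_bigr do under eq_bigr do rewrite E.
  under eq_bigr do rewrite sumrB big_split /= -mulr_suml -mulr_sumr -mulr_sumr.
  rewrite sumrB big_split /= -!mulr_suml -!mulr_sumr sc -e2.
  have -> : \sum_a \sum_b c a * c b * bil p (fr a p) (fr b p) = bil p J J.
    rewrite /J form_suml; apply: eq_bigr => a _.
    rewrite formZl form_sumr mulr_sumr; apply: eq_bigr => b _.
    by rewrite formZr mulrA.
  move: (bil p J J) (zsq p * _) => x y; lra.
have gen (u v : K) : 0 <= bil p u u - 2 * l * bil p u v + l ^+ 2 * bil p v v.
  have := Hpos p (u - l *: v).
  rewrite -scaleNr formDl !formDr !formZl !formZr (conserved_formC okH p v u).
  by move: (bil p u u) (bil p u v) (bil p v v) => x y z; nra.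
have h := gen J T; rewrite QE -(ler_pM2l l0).
rewrite (_ : l * (_ + _) = zsq p * (2 * e p) + l ^+ 2 * bil p T T); last first.
  by field; rewrite gt_eqF.
move: JJ h; move: (bil p J J) (bil p J T) (bil p T T) (zsq p * (2 * e p)) => x y z w; nra.
Qed.

Lemma C1_form_TT : C1_on setT (fun p => bil p (2 *: pd t) (2 *: pd t)).
Proof.
apply: (eq_C1_on openT _ (C1_onM openT (C1_on_cst openT 4) (conserved_C1 okH t t))).
by move=> p _; rewrite formZl formZr form_pd; ring.
Qed.

(** Cauchy-Schwarz for integrals is obtained from the pointwise linear bounds by
   choosing the parameter [l] after integration; the cases where one of the
   norms vanishes are limits. *)
Lemma disk_twist_le (rho delta : R) : 0 < rho ->
  2 * rho * Num.sqrt (D (rho ^+ 2) (fun p => bil p (2 *: pd t) (2 *: pd t)))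
    <= delta * Num.sqrt (D (rho ^+ 2) (fun p => 2 * e p)) ->
  D (rho ^+ 2) (twist H) <= 2 * delta * D (rho ^+ 2) e.
Proof.
move=> r0; set A2 := D _ (fun p => bil _ _ _); set B2 := D _ (fun p => 2 * e p).
have wd := @disk_weightP R.
have ce := continuous_energy okH; have ct := C1_onT_continuous C1_form_TT.
have clt l : continuous (fun p => l * bil p (2 *: pd t) (2 *: pd t)).
  exact: (C1_onT_continuous (C1_onM openT (C1_on_cst openT l) C1_form_TT)).
have c2e : continuous (fun p => 2 * e p).
  exact: (C1_onT_continuous (C1_onM openT (C1_on_cst openT 2) (C1_energy okH))).
have -> : D (rho ^+ 2) e = 2^-1 * B2 by rewrite -(IntZ okS) //; apply: eq_Int => p; rewrite mulKf.
have A0 : 0 <= A2.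
  by apply: Int_ge0 => p; rewrite mulr_ge0 ?disk_weight_ge0.
have B0 : 0 <= B2.
  apply: Int_ge0 => p; rewrite mulr_ge0 ?disk_weight_ge0 // mulr_ge0 //; exact: energy_ge0.
have key l : 0 < l -> D (rho ^+ 2) (twist H) <= l^-1 * rho ^+ 2 * B2 + l * A2.
  move=> l0; have cTl := clt l.
  have cel : continuous (fun p => l^-1 * rho ^+ 2 * (2 * e p)).
    exact: (C1_onT_continuous (C1_onM openT (C1_on_cst openT _)
      (C1_onM openT (C1_on_cst openT 2) (C1_energy okH)))).
  rewrite -(IntZ okS) // -(IntZ okS) // -(IntD okS) //.
  apply: (le_Int okS) => //; first exact: (continuous_twist okH).
    exact: continuous_add cel cTl.
  move=> p; rewrite /disk_weight; case: (leP (zsq p) (rho ^+ 2)) => zr; last by rewrite !mulr0.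
  rewrite !mulr1 (le_trans (twist_le p l0)) // lerD2r ler_wpM2r //.
    by rewrite mulr_ge0 //; exact: energy_ge0.
  by rewrite ler_pM2l ?invr_gt0.
have := sqr_sqrtr A0; have := sqr_sqrtr B0.
move: (sqrtr_ge0 A2) (sqrtr_ge0 B2); set A := Num.sqrt A2; set B := Num.sqrt B2 => A_ge0 B_ge0 BE AE AB.
move: key; rewrite -AE -BE => {A0 B0 AE BE}; set Q := D _ _ => key.
suff QAB : Q <= 2 * rho * A * B by rewrite (le_trans QAB) //; nra.
have [B0|B0] := eqVneq B 0.
  rewrite B0 mulr0; apply/ler_addgt0Pr => x x0; rewrite add0r.
  have l0 : 0 < x / (1 + A ^+ 2) by rewrite divr_gt0 // ltr_pwDl // sqr_ge0.
  apply: le_trans (key _ l0) _; rewrite B0 expr0n /= mulr0 add0r -mulrA ler_piMr ?(ltW x0) //.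
  by rewrite mulrC ler_pdivrMr ?mul1r ?lerDr // ltr_pwDl // sqr_ge0.
have Bp : 0 < B by rewrite lt_def B0.
have [A0|A0] := eqVneq A 0.
  rewrite A0 mulr0 mul0r; apply/ler_addgt0Pr => x x0; rewrite add0r.
  have l0 : 0 < rho ^+ 2 * B ^+ 2 / x by rewrite !(divr_gt0, mulr_gt0, exprn_gt0).
  apply: le_trans (key _ l0) _; rewrite A0 expr0n /= mulr0 addr0 invf_div -mulrA divfK //.
  by rewrite mulf_neq0 // expf_neq0 // gt_eqF.
have Ap : 0 < A by rewrite lt_def A0.
have l0 : 0 < rho * B / A by rewrite !(divr_gt0, mulr_gt0).
apply: le_trans (key _ l0) _; rewrite le_eqVlt; apply/orP; left; apply/eqP.
by field; rewrite !gt_eqF.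
Qed.

End DiskInequality.

(** * From the differential inequality to monotonicity *)

Section DiniMonotonicity.
Variable R : realType.

(** Take the supremum of the points up to which [G s1] is a lower bound: the
   condition on limits from the left keeps it in that set, and monotonicity to
   its right shows that it is [s2].  The function may jump upwards. *)
Lemma local_right_monotone (G : R -> R) (s1 s2 : R) : s1 <= s2 ->
  (forall s, s1 <= s < s2 -> exists2 e, 0 < e &
     forall u, s < u < s + e -> G s <= G u) ->
  (forall s c, s1 < s <= s2 -> (forall u, s1 <= u < s -> c <= G u) -> c <= G s) ->
  G s1 <= G s2.
Proof.
move=> s12 hr hl.
pose A := [set t | s1 <= t <= s2 /\ forall u, s1 <= u <= t -> G s1 <= G u].
have A1 : A s1.
  split; first by rewrite lexx.
  by move=> u; rewrite -eq_le => /eqP <-.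
have supA : has_sup A by split; [exists s1|exists s2 => x [/andP[_ ->]]].
pose t := sup A.
have t1 : s1 <= t by apply: sup_upper_bound.
have t2 : t <= s2 by apply: sup_le_ub; [exists s1|move=> x [/andP[_ ->]]].
have below u : s1 <= u < t -> G s1 <= G u.
  move=> /andP[u1 ut]; have tu : 0 < t - u by rewrite subr_gt0.
  have [x [_ xP] xu] := sup_adherent tu supA.
  by apply: xP; rewrite u1 /= ltW // (le_lt_trans _ xu) // -/t; lra.
have Gt : G s1 <= G t.
  move: t1; rewrite le_eqVlt => /orP[/eqP <- //|t1].
  by apply: hl => //; rewrite t1.
have At u : s1 <= u <= t -> G s1 <= G u.
  move=> /andP[u1]; rewrite le_eqVlt => /orP[/eqP -> //|ut].
  by apply: below; rewrite u1.
move: t2; rewrite le_eqVlt => /orP[/eqP <- //|t2].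
have [|e e0 eP] := hr t; first by rewrite t1.
pose v := Num.min s2 (t + e / 2).
have tv : t < v by rewrite lt_min t2 ltrDl divr_gt0.
suff : v <= t by rewrite leNgt tv.
apply: sup_upper_bound => //; split.
  by rewrite (le_trans t1 (ltW tv)) /= ge_min lexx.
move=> u /andP[u1 uv]; have [ut|tu] := leP u t; first by apply: At; rewrite u1.
apply: le_trans Gt (eP _ _); rewrite tu /= (le_lt_trans uv) //.
by rewrite gt_min ltrD2l orbC ltr_pdivrMr // ltr_pMr // ltr1n.
Qed.

Section Comparison.
Variables (E : R -> R) (a s0 : R).
Hypotheses (a0 : 0 < a) (s0_gt0 : 0 < s0).
Hypothesis E_ge0 : forall s, 0 <= E s.
Hypothesis E_mono : forall s s', s <= s' -> E s <= E s'.
(** This bounds the lower right derivative of [E] below by [a * E / (2 * s)]. *)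
Hypothesis E_growth : forall s eta, s0 <= s -> 0 < eta -> exists2 e, 0 < e &
  forall s', s < s' < s + e -> (s' - s) * (a * E s - eta) <= 2 * s' * (E s' - E s).

Lemma expR_ln_le (b s s' : R) : 0 < s -> s < s' -> 0 <= b ->
  b * (s' - s) < s ->
  expR (- (b * ln s)) * (1 - b * ((s' - s) / s)) <= expR (- (b * ln s')).
Proof.
move=> sp ss' b0 bs; set x := (s' - s) / s.
have x0 : 0 < x by rewrite divr_gt0 // subr_gt0.
have s'E : s' = s * (1 + x) by rewrite /x mulrDr mulr1 mulrCA divff ?gt_eqF // mulr1 addrC subrK.
rewrite s'E lnM ?posrE // ?addr_gt0 // [b * (ln _ + _)]mulrDr opprD expRD ler_pM2l ?expR_gt0 //.
apply: le_trans (expR_ge1Dx _) _; rewrite ler_expR lerN2 ler_wpM2l //.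
by apply: le_ln1Dx; rewrite (lt_trans _ x0) // ltrN10.
Qed.

(** With an exponent strictly below the critical one there is room for the error
   terms of first order. *)
Lemma power_local_monotone (b s : R) : 0 < b -> b < a / 2 -> s0 <= s ->
  exists2 e, 0 < e & forall u, s < u < s + e ->
    expR (- (b * ln s)) * E s <= expR (- (b * ln u)) * E u.
Proof.
move=> b0 ba ss0; have sp : 0 < s by exact: lt_le_trans s0_gt0 ss0.
have [Es|Es] := eqVneq (E s) 0.
  by exists 1 => // u _; rewrite Es mulr0 mulr_ge0 // expR_ge0.
have Ep : 0 < E s by rewrite lt_def Es E_ge0.
pose eta := (a / 2 - b) * E s.
have eta0 : 0 < eta by rewrite mulr_gt0 // subr_gt0.
have [e e0 eP] := E_growth ss0 eta0.
pose b' := (a / 2 + b) / 2.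
have bb' : b < b' by rewrite /b'; lra.
have b'0 : 0 < b' by exact: lt_trans bb'.
pose x0 := (b' - b) / (b * (1 + b')).
have den0 : 0 < b * (1 + b') by rewrite mulr_gt0 // addr_gt0.
have x0p : 0 < x0 by rewrite divr_gt0 // subr_gt0.
exists (Num.min e (s * x0)); first by rewrite lt_min e0 mulr_gt0.
move=> u /andP[su]; rewrite -ltrBlDl lt_min => /andP[ue ux].
pose x := (u - s) / s.
have xp : 0 < x by rewrite divr_gt0 // subr_gt0.
have xx0 : x < x0 by rewrite ltr_pdivrMr // mulrC.
have uE : u = s * (1 + x) by rewrite /x mulrDr mulr1 mulrCA divff ?gt_eqF // mulr1 addrC subrK.
have bx : b * (1 + b') * x < b' - b.
  by move: xx0; rewrite /x0 ltr_pdivlMr // mulrC.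
have bx1 : b * x < 1.
  have h : b * x * (1 + b') < 1 * (1 + b') by move: bx; nra.
  by move: h; rewrite ltr_pM2r // addr_gt0.
have up : 0 < u by exact: lt_trans su.
have g : E s * (1 + x + b' * x) <= (1 + x) * E u.
  have : (u - s) * (a * E s - eta) <= 2 * u * (E u - E s).
    by apply: eP; rewrite su /= -ltrBlDl.
  have -> : a * E s - eta = 2 * b' * E s by rewrite /eta /b'; field.
  rewrite (_ : u - s = s * x); last by rewrite /x mulrC divfK // gt_eqF.
  rewrite (_ : 2 * u * _ = 2 * s * ((1 + x) * (E u - E s))); last by rewrite uE; ring.
  rewrite (_ : s * x * _ = 2 * s * (b' * x * E s)); last by ring.
  by rewrite ler_pM2l ?mulr_gt0 //; lra.
have key : E s <= (1 - b * x) * E u.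
  have q0 : 0 <= x * (b' - b - b * (1 + b') * x) by rewrite mulr_ge0 ?(ltW xp) // subr_ge0 ltW.
  have h1 : (1 + x) * E s <= (1 - b * x) * (E s * (1 + x + b' * x)) by nra.
  have h2 : (1 - b * x) * (E s * (1 + x + b' * x)) <= (1 - b * x) * ((1 + x) * E u).
    by rewrite ler_wpM2l // subr_ge0 ltW.
  have := le_trans h1 h2; rewrite mulrCA ler_pM2l //.
  by rewrite addr_gt0.
apply: le_trans (_ : expR (- (b * ln s)) * ((1 - b * x) * E u) <= _).
  by rewrite ler_pM2l ?expR_gt0.
rewrite mulrA ler_wpM2r //; apply: expR_ln_le => //; first exact: ltW.
by move: bx1; rewrite /x mulrA ltr_pdivrMr // mul1r.
Qed.

Lemma cvg_expR_ln (b s c : R) : 0 < s ->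
  (fun u => expR (- (b * ln u)) * c) @ s --> expR (- (b * ln s)) * c.
Proof.
move=> sp; apply: cvgM; last exact: cvg_cst.
apply: (@continuous_comp _ _ _ (fun u : R => - (b * ln u)) expR); last exact: continuous_expR.
by apply: cvgN; apply: cvgM; [exact: cvg_cst|exact: continuous_ln].
Qed.

Lemma cvg_expR_exponent (b l c : R) :
  (fun b => expR (- (b * l)) * c) @ b --> expR (- (b * l)) * c.
Proof.
apply: cvgM; last exact: cvg_cst.
apply: (@continuous_comp _ _ _ (fun b : R => - (b * l)) expR); last exact: continuous_expR.
by apply: cvgN; apply: cvgM; [exact: cvg_id|exact: cvg_cst].
Qed.

Lemma power_monotone_subcritical (b s1 s2 : R) : 0 < b -> b < a / 2 ->
  s0 <= s1 -> s1 <= s2 ->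
  expR (- (b * ln s1)) * E s1 <= expR (- (b * ln s2)) * E s2.
Proof.
move=> b0 ba s01 s12.
apply: (@local_right_monotone (fun s => expR (- (b * ln s)) * E s)) => //.
  by move=> s /andP[s1s _]; apply: power_local_monotone => //; exact: le_trans s1s.
move=> s c /andP[s1s ss2] cG; rewrite leNgt; apply/negP => lt.
have sp : 0 < s by apply: lt_trans s1s; exact: lt_le_trans s01.
have : \forall u \near s, expR (- (b * ln u)) * E s < c.
  by have /cvgr_lt := @cvg_expR_ln b s (E s) sp; apply.
move=> /nbhs_ballP[r /= r0 rP].
pose u := Num.max s1 (s - r / 2).
have us : u < s by rewrite gt_max s1s /= ltrBlDr ltrDl divr_gt0.
have : expR (- (b * ln u)) * E s < c.
  apply: rP; rewrite /ball /= ltr_distlC; apply/andP; split.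
    rewrite lt_max; apply/orP; right; lra.
  by rewrite (lt_trans us) // ltrDl.
have := cG u; rewrite le_max lexx us => /(_ isT) cu; rewrite ltNge => /negP; apply.
by rewrite (le_trans cu) // ler_wpM2l ?expR_ge0 // E_mono // ltW.
Qed.

(** The critical exponent is the limit of subcritical ones. *)
Lemma power_monotone (s1 s2 : R) : s0 <= s1 -> s1 <= s2 ->
  expR (- (a / 2 * ln s1)) * E s1 <= expR (- (a / 2 * ln s2)) * E s2.
Proof.
move=> s01 s12; rewrite leNgt; apply/negP => lt.
have : \forall b \near a / 2, expR (- (b * ln s2)) * E s2 - expR (- (b * ln s1)) * E s1 < 0.
  have h : (fun b => expR (- (b * ln s2)) * E s2 - expR (- (b * ln s1)) * E s1) @ (a / 2) -->
      expR (- (a / 2 * ln s2)) * E s2 - expR (- (a / 2 * ln s1)) * E s1.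
    by apply: cvgB; exact: cvg_expR_exponent.
  by move/cvgr_lt : h; apply; rewrite subr_lt0.
move=> /nbhs_ballP[r /= r0 rP].
pose b := Num.max (a / 4) (a / 2 - r / 2).
have a2 : a / 4 < a / 2 by move: (a0) => a00; lra.
have ba : b < a / 2 by rewrite gt_max a2 /= ltrBlDr ltrDl divr_gt0.
have b0 : 0 < b by rewrite lt_max divr_gt0.
have : expR (- (b * ln s2)) * E s2 - expR (- (b * ln s1)) * E s1 < 0.
  apply: rP; rewrite /ball /= ltr_distlC; apply/andP; split.
    rewrite lt_max; apply/orP; right; lra.
  by rewrite (lt_trans ba) // ltrDl.
by rewrite subr_lt0 ltNge => /negP; apply; exact: power_monotone_subcritical.
Qed.

End Comparison.
End DiniMonotonicity.

Section ConservedMonotone.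
Variables (R : realType) (m : nat).
Local Notation q := (m + m + 1)%N.
Local Notation K := (heisenberg R m).
Local Notation "'t'" := (it m).
Local Notation pd i := (basis_vec R i : K).
Variable S : coord_space R q.
Hypothesis okS : lebesgue_coords S.
Variable H : K -> 'M[R]_q.
Hypothesis okH : conserved_tensor H.
Local Notation D s u := (Int S (disk_weight s) u).

(** The balance of energy, the bound of the twist and the right continuity of the
   energy of disks give the growth condition of [power_monotone] with
   [a = 2m - 2 - 2 delta], in the variable [s = rho ^+ 2]. *)
Lemma conserved_tensor_monotone (delta rho0 : R) : 0 < rho0 ->
  (forall rho, rho0 <= rho ->
    2 * rho * Num.sqrt (D (rho ^+ 2) (fun p => form (H p) (2 *: pd t) (2 *: pd t)))
    <= delta * Num.sqrt (D (rho ^+ 2) (fun p => 2 * energy H p))) ->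
  0 < (m + m)%:R - 2 - 2 * delta ->
  forall s1 s2, rho0 ^+ 2 <= s1 -> s1 <= s2 ->
    expR (- (((m + m)%:R - 2 - 2 * delta) / 2 * ln s1)) * D s1 (energy H) <=
    expR (- (((m + m)%:R - 2 - 2 * delta) / 2 * ln s2)) * D s2 (energy H).
Proof.
move=> r0 growth a0; set a := _ - _ - _ in a0 *.
have wd := @disk_weightP R.
have ce := continuous_energy okH.
apply: (@power_monotone R (fun s => D s (energy H)) a (rho0 ^+ 2)) => //.
- by rewrite exprn_gt0.
- by move=> s; apply: Int_ge0 => p; rewrite mulr_ge0 ?disk_weight_ge0 //; exact: energy_ge0.
- by move=> s s' ss'; apply: Int_disk_mono => //; exact: energy_ge0.
move=> s eta ss0 eta0.
have s0 : 0 < s by apply: lt_le_trans ss0; rewrite exprn_gt0.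
pose rho := Num.sqrt s.
have rhoE : rho ^+ 2 = s by rewrite sqr_sqrtr // ltW.
have rho_gt0 : 0 < rho by rewrite sqrtr_gt0.
have rho_ge : rho0 <= rho.
  by rewrite /rho -(ger0_norm (ltW r0)) -sqrtr_sqr ler_sqrt // ltW.
have tw : D s (twist H) <= 2 * delta * D s (energy H).
  by rewrite -rhoE; apply: disk_twist_le => //; exact: growth.
have cab := continuous_abs_balance okH.
have [e e0 eP] := @Int_disk_right R m S okS s eta _ cab (fun p => normr_ge0 _) eta0.
exists e => // s' /andP[ss' s'e].
have := disk_balance okS okH (ltW s0) ss'.
apply: le_trans; rewrite ler_wpM2l ?subr_ge0 ?(ltW ss') //.
have -> : D s (balance H) = ((m + m)%:R - 2) * D s (energy H) - D s (twist H).
  rewrite -(IntZ okS) // -(IntB okS) //; last exact: continuous_twist.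
  exact: (C1_onT_continuous (C1_onM openT (C1_on_cst openT _) (C1_energy okH))).
have := eP s' (ltW s'e); rewrite /a.
set X := D s _ in tw *; set Y := D s (energy H) in tw *.
by set Z := Int _ _ _; set W := Int _ _ _; lra.
Qed.

End ConservedMonotone.

(** * Riemannian geometry of a local foliation *)

Section Projections.
Variables (R : realType) (n : nat).
Variables (g V : 'rV[R]_n -> 'M[R]_n) (x : 'rV[R]_n).
Hypothesis gsym : (g x)^T = g x.
Hypothesis gpos : forall v : 'rV[R]_n, v != 0 -> 0 < inner g x v v.
Local Notation inn := (inner g x).
Local Notation hor := (horizontal g V x).
Local Notation PH := (projH g V x).
Local Notation PV := (projV g V x).

Lemma innerC u v : inn u v = inn v u.
Proof. by rewrite -[LHS]form_tr gsym. Qed.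

Lemma innerDl u u' v : inn (u + u') v = inn u v + inn u' v.
Proof. exact: formDl. Qed.

Lemma innerZl a u v : inn (a *: u) v = a * inn u v.
Proof. exact: formZl. Qed.

Lemma innerDr u v v' : inn u (v + v') = inn u v + inn u v'.
Proof. by rewrite !(innerC u) innerDl. Qed.

Lemma inner0l v : inn 0 v = 0.
Proof. exact: form0l. Qed.

Lemma inner_suml (I : finType) (F : I -> 'rV[R]_n) v :
  inn (\sum_i F i) v = \sum_i inn (F i) v.
Proof. exact: form_suml. Qed.

Lemma inner_eq0 v : inn v v = 0 -> v = 0.
Proof.
by move=> v0; apply/eqP; apply/negPn/negP => /gpos; rewrite v0 ltxx.
Qed.

Lemma inner_ge0 v : 0 <= inn v v.
Proof. by have [->|/gpos/ltW//] := eqVneq v 0; rewrite inner0l. Qed.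

Lemma metric_unit : g x \in unitmx.
Proof.
rewrite -row_free_unit -kermx_eq0; apply/eqP/row_matrixP => i; rewrite row0.
apply: inner_eq0; rewrite /inner (_ : row i _ *m g x = 0) ?mul0mx ?mxE //.
by apply/sub_kermxP; rewrite row_sub.
Qed.

Lemma horizontalP u : reflect (forall v, (v <= V x)%MS -> inn u v = 0) (u <= hor)%MS.
Proof.
apply: (iffP sub_kermxP) => [uV v /submxP[c ->]|h].
  rewrite /inner trmx_mul !mulmxA -(mulmxA u) uV mul0mx mxE //.
apply/rowP => i; rewrite [RHS]mxE.
have := h (row i (V x)) (row_sub _ _); rewrite /inner tr_row colE mulmxA -colE.
by rewrite [X in X = _ -> _]mxE -mulmxA.
Qed.

Lemma cap_vertical_horizontal : (V x :&: hor = 0)%MS.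
Proof.
apply/eqP/rowV0P => v; rewrite sub_capmx => /andP[vV /horizontalP hv].
by apply: inner_eq0; exact: hv.
Qed.

Lemma add_vertical_horizontal : ((1%:M : 'M[R]_n) <= V x + hor)%MS.
Proof.
rewrite sub1mx /row_full -[X in _ == X]/n eqn_leq rank_leq_row /=.
have := mxrank_sum_cap (V x) hor; rewrite cap_vertical_horizontal mxrank0 addn0 => ->.
rewrite mxrank_ker.
have : (\rank (g x *m (V x)^T) <= \rank (V x))%N by rewrite -(mxrank_tr (V x)) mxrankM_maxr.
by rewrite -(leq_add2r (n - \rank (g x *m (V x)^T))) subnKC // rank_leq_row.
Qed.

Lemma cap_horizontal_vertical : (hor :&: V x = 0)%MS.
Proof. by rewrite capmxC cap_vertical_horizontal. Qed.

Lemma proj_add (u : 'rV[R]_n) : u *m PH + u *m PV = u.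
Proof.
rewrite addrC; apply: add_proj_mx; first exact: cap_vertical_horizontal.
exact: submx_trans (submx1 u) add_vertical_horizontal.
Qed.

Lemma projH_sub (u : 'rV[R]_n) : (u *m PH <= hor)%MS.
Proof. exact: proj_mx_sub. Qed.

Lemma projV_sub (u : 'rV[R]_n) : (u *m PV <= V x)%MS.
Proof. exact: proj_mx_sub. Qed.

Lemma projH_id (u : 'rV[R]_n) : (u <= hor)%MS -> u *m PH = u.
Proof. exact: proj_mx_id cap_horizontal_vertical. Qed.

Lemma projV_id (u : 'rV[R]_n) : (u <= V x)%MS -> u *m PV = u.
Proof. exact: proj_mx_id cap_vertical_horizontal. Qed.

Lemma projH_vertical (u : 'rV[R]_n) : (u <= V x)%MS -> u *m PH = 0.
Proof. exact: proj_mx_0 cap_horizontal_vertical. Qed.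

Lemma projV_horizontal (u : 'rV[R]_n) : (u <= hor)%MS -> u *m PV = 0.
Proof. exact: proj_mx_0 cap_vertical_horizontal. Qed.

Lemma inner_horizontal_vertical (u v : 'rV[R]_n) : (u <= hor)%MS -> (v <= V x)%MS -> inn u v = 0.
Proof. by move=> /horizontalP; exact. Qed.

Lemma inner_projH (u v : 'rV[R]_n) : inn (u *m PH) (v *m PH) = inn (u *m PH) v.
Proof.
rewrite -[in RHS](proj_add v) innerDr.
by rewrite (inner_horizontal_vertical (projH_sub u) (projV_sub v)) addr0.
Qed.

Lemma inner_projV (u v : 'rV[R]_n) : inn (u *m PV) (v *m PV) = inn (u *m PV) v.
Proof.
rewrite -[in RHS](proj_add v) innerDr (innerC _ (v *m PH)).
by rewrite (inner_horizontal_vertical (projH_sub v) (projV_sub u)) add0r.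
Qed.

(** This closed formula is how the horizontal projection inherits its regularity
   from a local frame [B] of the leaves. *)
Lemma projH_frame (r : nat) (B : 'M[R]_(r, n)) : row_free B -> (B == V x)%MS ->
  B *m g x *m B^T \in unitmx /\
  PH = 1%:M - g x *m B^T *m invmx (B *m g x *m B^T) *m B.
Proof.
move=> fB /eqmxP BV.
have uB : B *m g x *m B^T \in unitmx.
  rewrite -row_free_unit -kermx_eq0; apply/eqP/row_matrixP => i; rewrite row0.
  set c := row i _; have c0 : c *m (B *m g x *m B^T) = 0.
    by apply/sub_kermxP; rewrite row_sub.
  have : c *m B = 0.
    apply: inner_eq0; rewrite /inner trmx_mul !mulmxA.
    by move: c0; rewrite !mulmxA => ->; rewrite mul0mx mxE.
  by move=> cB; apply: (row_free_inj fB); rewrite /= cB mul0mx.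
split=> //; set Q := _ *m B.
apply/row_matrixP => i; rewrite !rowE; set u := delta_mx 0 i.
have uQ : (u *m Q <= V x)%MS by rewrite -BV /Q mulmxA submxMl.
have uP : (u *m (1%:M - Q) <= hor)%MS.
  apply/horizontalP => v; rewrite -BV => /submxP[c ->].
  rewrite /inner trmx_mul !mulmxA (_ : u *m (1%:M - Q) *m g x *m B^T = 0) ?mul0mx ?mxE //.
  rewrite mulmxBr mulmx1 !mulmxBl /Q -!mulmxA (mulmxA B (g x)) mulVmx // mulmx1 subrr //.
by rewrite -[in LHS](subrK (u *m Q) u) mulmxDl (projH_vertical uQ) addr0
  -[X in X - _]mulmx1 -mulmxBr projH_id.
Qed.

End Projections.

Section MatrixCalculus.
Variable R : realType.

Lemma differentiable_mulmx (n k l p : nat) (A : 'rV[R]_n -> 'M[R]_(k, l))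
    (B : 'rV[R]_n -> 'M[R]_(l, p)) x :
  differentiable A x -> differentiable B x -> differentiable (fun y => A y *m B y) x.
Proof.
move=> dA dB; apply: differentiable_mx => i j.
rewrite (_ : (fun y => _) = \sum_s ((fun y => A y i s) * (fun y => B y s j))).
  by apply: differentiable_sum => s; apply: differentiableM; exact: differentiable_entry.
by apply/funext => y; rewrite fct_sumE mxE.
Qed.

Lemma differentiable_trmx (n k l : nat) (A : 'rV[R]_n -> 'M[R]_(k, l)) x :
  differentiable A x -> differentiable (fun y => (A y)^T) x.
Proof.
move=> dA; apply: differentiable_mx => i j.
rewrite (_ : (fun y => _) = fun y => A y j i); first exact: differentiable_entry.
by apply/funext => y; rewrite mxE.
Qed.

Lemma derive_mulmx (n k l p : nat) (A : 'rV[R]_n -> 'M[R]_(k, l))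
    (B : 'rV[R]_n -> 'M[R]_(l, p)) x v :
  differentiable A x -> differentiable B x ->
  'D_v (fun y => A y *m B y) x = 'D_v A x *m B x + A x *m 'D_v B x.
Proof.
move=> dA dB.
have da i j := differentiable_entry i j dA; have db i j := differentiable_entry i j dB.
have dAB := differentiable_mulmx dA dB.
apply/matrixP => i j; rewrite coord_derive; last exact: diff_derivable.
rewrite (_ : (fun y => _) = fun y => \sum_s A y i s * B y s j); last first.
  by apply/funext => y; rewrite mxE.
rewrite derive_sum_at => [|s]; last exact: differentiableM.
rewrite mxE [X in _ = X + _]mxE [X in _ = _ + X]mxE -big_split; apply: eq_bigr => s _ /=.
rewrite deriveM_at // !coord_derive //; exact: diff_derivable.
Qed.

Lemma derive_trmx (n k l : nat) (A : 'rV[R]_n -> 'M[R]_(k, l)) x v :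
  differentiable A x -> 'D_v (fun y => (A y)^T) x = ('D_v A x)^T.
Proof.
move=> dA; have dAt := differentiable_trmx dA.
apply/matrixP => i j; rewrite mxE !coord_derive; try exact: diff_derivable.
by congr ('D_v _ x); apply/funext => y; rewrite mxE.
Qed.

Lemma derive_form (n k : nat) (A : 'rV[R]_n -> 'M[R]_k) x v (a b : 'rV[R]_k) :
  differentiable A x -> 'D_v (fun y => form (A y) a b) x = form ('D_v A x) a b.
Proof.
move=> dA; have dE i j := differentiable_entry i j dA.
rewrite (_ : (fun y => _) = fun y => \sum_i \sum_j A y i j * (a 0 i * b 0 j)); last first.
  apply/funext => y; rewrite formE; apply: eq_bigr => i _; apply: eq_bigr => j _; ring.
have dc i j : differentiable (fun y => A y i j * (a 0 i * b 0 j)) x.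
  by apply: differentiableM => //; exact: differentiable_cst.
have ds i : differentiable (fun y => \sum_j A y i j * (a 0 i * b 0 j)) x.
  rewrite (_ : (fun y => _) = \sum_j (fun y => A y i j * (a 0 i * b 0 j))).
    exact: differentiable_sum.
  by apply/funext => y; rewrite fct_sumE.
rewrite derive_sum_at // formE; apply: eq_bigr => i _; rewrite derive_sum_at //.
apply: eq_bigr => j _.
rewrite (@deriveM_at _ _ (fun y => A y i j) (fun=> a 0 i * b 0 j)) //.
by rewrite derive_cst mulr0 addr0 -coord_derive; [ring|exact: diff_derivable].
Qed.

Definition christoffel_row (n : nat) (g : 'rV[R]_n -> 'M[R]_n) (x u v : 'rV[R]_n) : 'rV[R]_n :=
  \row_(k < n) \sum_(i < n) \sum_(j < n) christoffel g x i j k * u 0 i * v 0 j.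

(** Lowering the index turns the connection into the Christoffel symbols of the
   first kind, which contain no inverse metric. *)
Lemma inner_christoffel_row (n : nat) (g : 'rV[R]_n -> 'M[R]_n) (x u v z : 'rV[R]_n) :
  differentiable g x -> (g x)^T = g x -> g x \in unitmx ->
  inner g x (christoffel_row g x u v) z =
  2^-1 * (form ('D_u g x) v z + form ('D_v g x) u z - form ('D_z g x) u v).
Proof.
move=> dg gs gu.
pose pdg i j l := 'D_(basis_vec R i) (fun y => g y j l) x.
have dgE w j l : ('D_w g x) j l = \sum_i w 0 i * pdg i j l.
  rewrite coord_derive; last exact: diff_derivable.
  exact/derive_partials/differentiable_entry.
pose tt : 'rV[R]_n := \row_l \sum_i \sum_j (pdg i j l + pdg j i l - pdg l i j) * u 0 i * v 0 j.
have invs : (invmx (g x))^T = invmx (g x) by rewrite trmx_inv gs.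
have -> : christoffel_row g x u v = 2^-1 *: (tt *m invmx (g x)).
  apply/rowP => k; rewrite mxE [RHS]mxE [(_ *m _) 0 k]mxE.
  have -> : \sum_l tt 0 l * invmx (g x) l k = \sum_l \sum_i \sum_j
      (pdg i j l + pdg j i l - pdg l i j) * u 0 i * v 0 j * invmx (g x) k l.
    apply: eq_bigr => l _; rewrite mxE -[in LHS]invs [(_^T) l k]mxE mulr_suml.
    by apply: eq_bigr => i _; rewrite mulr_suml.
  rewrite [in RHS]exchange_big [RHS]mulr_sumr; apply: eq_bigr => i _ /=.
  rewrite [in RHS]exchange_big [RHS]mulr_sumr; apply: eq_bigr => j _ /=.
  rewrite /christoffel -!mulrA mulr_suml; congr (_ * _); apply: eq_bigr => l _.
  by rewrite /pdg; ring.
rewrite /inner -scalemxAl -scalemxAl mxE -(mulmxA tt) mulVmx // mulmx1.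
congr (_ * _); rewrite mxE.
have -> : form ('D_u g x) v z = \sum_l \sum_i \sum_j pdg i j l * u 0 i * v 0 j * z 0 l.
  rewrite formE [LHS]exchange_big; apply: eq_bigr => l _ /=.
  rewrite [RHS]exchange_big; apply: eq_bigr => j _ /=.
  by rewrite dgE mulr_sumr mulr_suml; apply: eq_bigr => i _; ring.
have -> : form ('D_v g x) u z = \sum_l \sum_i \sum_j pdg j i l * u 0 i * v 0 j * z 0 l.
  rewrite formE [LHS]exchange_big; apply: eq_bigr => l _ /=; apply: eq_bigr => i _ /=.
  by rewrite dgE mulr_sumr mulr_suml; apply: eq_bigr => j _; ring.
have -> : form ('D_z g x) u v = \sum_l \sum_i \sum_j pdg l i j * u 0 i * v 0 j * z 0 l.
  rewrite formE [RHS]exchange_big; apply: eq_bigr => i _ /=.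
  rewrite [RHS]exchange_big; apply: eq_bigr => j _ /=.
  by rewrite dgE mulr_sumr mulr_suml; apply: eq_bigr => l _; ring.
rewrite -big_split -sumrB; apply: eq_bigr => l _ /=.
rewrite -big_split -sumrB [tt 0 l]mxE [z^T l 0]mxE mulr_suml; apply: eq_bigr => i _ /=.
rewrite -big_split -sumrB mulr_suml; apply: eq_bigr => j _ /=; ring.
Qed.

End MatrixCalculus.

(** This is the horizontal part [g_H] of the metric, which is zero on vertical
   vectors. *)
Definition transverse (R : realType) (n : nat) (g V : 'rV[R]_n -> 'M[R]_n)
    (x : 'rV[R]_n) : 'M[R]_n := projH g V x *m g x *m (projH g V x)^T.

Lemma inner_horizontalE (R : realType) (n : nat) (g V : 'rV[R]_n -> 'M[R]_n)
  (x u v : 'rV[R]_n) : inner_horizontal g V x u v = form (transverse g V x) u v.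
Proof. by rewrite /inner_horizontal /inner /form /transverse trmx_mul !mulmxA. Qed.

(* Linear arithmetic kept apart from the matrix expressions it is used on. *)
Lemma connection_arith (R : realType)
    (i1 i2 k1 k2 tu tps tzps tspz tzuu tzpp gupz gpuz gzup gppz gspz gpsz gpzs gzpp gzsp gzps : R) :
  i1 = tu - gupz -> i2 = tps - gpsz ->
  k1 = 2^-1 * (gupz + gpuz - gzup) -> k2 = 2^-1 * (gpzs + gzps - gspz) ->
  gupz = gppz + gspz -> gpuz = gppz + gpsz -> gzup = gzpp + gzsp ->
  gpzs = gpsz -> gzps = gzsp -> tspz = tps + tzps -> tspz = gspz -> tzpp = gzpp ->
  tzuu = tzpp + 2 * tzps -> i1 + k1 + (i2 + k2) = tu - 2^-1 * tzuu.
Proof. by move=> -> -> -> -> -> -> -> -> -> h1 h2 -> ->; lra. Qed.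

Section TransverseCalculus.
Variables (R : realType) (n : nat).
Variables (g V : 'rV[R]_n -> 'M[R]_n) (U : set 'rV[R]_n) (x : 'rV[R]_n).
Hypothesis oU : open U.
Hypothesis Ux : U x.
Hypothesis gsym : forall y, U y -> (g y)^T = g y.
Hypothesis gpos : forall y (v : 'rV[R]_n), U y -> v != 0 -> 0 < inner g y v v.
Hypothesis dg : differentiable g x.
Hypothesis dP : differentiable (projH g V) x.
Local Notation P := (projH g V).
Local Notation T := (transverse g V).

Let near_U (Q : 'rV[R]_n -> Prop) : (forall y, U y -> Q y) -> \near x, Q x.
Proof. by move=> h; have := open_near oU Ux; apply: filterS. Qed.

Lemma transverse_mulr y : U y -> T y = P y *m g y.
Proof.
move=> Uy; apply: form_mx_inj => u v.
rewrite -inner_horizontalE /inner_horizontal (inner_projH V (gsym Uy) (fun v => @gpos y v Uy)).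
by rewrite form_mulmx.
Qed.

Lemma transverse_sym y : U y -> (T y)^T = T y.
Proof.
move=> Uy; rewrite /transverse [LHS]trmx_mul trmxK [X in _ *m X]trmx_mul (gsym Uy).
exact: mulmxA.
Qed.

Lemma proj_idem y : U y -> P y *m P y = P y.
Proof.
move=> Uy; apply/row_matrixP => i; rewrite !rowE mulmxA.
exact: projH_id (fun v => @gpos y v Uy) _ (projH_sub g V y _).
Qed.

Lemma differentiable_transverse : differentiable T x.
Proof.
apply: (near_eq_differentiable (u := fun y => P y *m g y)).
  by apply: near_U => y Uy; rewrite transverse_mulr.
exact: differentiable_mulmx dP dg.
Qed.

Lemma derive_transverse_r v : 'D_v T x = 'D_v P x *m g x + P x *m 'D_v g x.
Proof.
rewrite -(derive_mulmx v dP dg); apply: near_eq_derive.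
by apply: near_U => y; exact: transverse_mulr.
Qed.

Lemma derive_transverse_sym v : ('D_v T x)^T = 'D_v T x.
Proof.
rewrite -derive_trmx; last exact: differentiable_transverse.
by apply: near_eq_derive; apply: near_U => y; exact: transverse_sym.
Qed.

Lemma derive_metric_sym v : ('D_v g x)^T = 'D_v g x.
Proof.
by rewrite -derive_trmx //; apply: near_eq_derive; apply: near_U => y; exact: gsym.
Qed.

Lemma derive_proj v : 'D_v P x *m P x + P x *m 'D_v P x = 'D_v P x.
Proof.
rewrite -(derive_mulmx v dP dP); apply: near_eq_derive.
by apply: near_U => y; exact: proj_idem.
Qed.

Let gs := gsym Ux.
Let gp (v : 'rV[R]_n) := @gpos x v Ux.
Local Notation hor := (horizontal g V x).

(** On horizontal vectors the derivative of the projection drops out, being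
   off-diagonal by [derive_proj]; the same holds on vertical ones below. *)
Lemma derive_transverse_horizontal v a b : (a <= hor)%MS -> (b <= hor)%MS ->
  form ('D_v T x) a b = form ('D_v g x) a b.
Proof.
move=> ha hb; have aP : a *m P x = a := projH_id gp ha.
rewrite derive_transverse_r form_addmx !form_mulmx aP -[RHS]add0r; congr (_ + _).
have w0 : a *m 'D_v P x *m P x = 0.
  have := congr1 (mulmx a) (derive_proj v).
  rewrite mulmxDr (mulmxA a ('D_v P x) (P x)) (mulmxA a (P x)) aP.
  by move/eqP; rewrite -subr_eq0 addrK => /eqP.
have := inner_projH V gs gp b (a *m 'D_v P x).
rewrite w0 (projH_id gp hb) (innerC gs) inner0l => /esym.
by rewrite (innerC gs).
Qed.

Lemma derive_transverse_vertical v a b : (a <= V x)%MS -> (b <= V x)%MS ->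
  form ('D_v T x) a b = 0.
Proof.
move=> ha hb; have aP : a *m P x = 0 := projH_vertical gp ha.
rewrite derive_transverse_r form_addmx !form_mulmx aP form0l addr0.
have w : a *m 'D_v P x *m P x = a *m 'D_v P x.
  have := congr1 (mulmx a) (derive_proj v).
  by rewrite mulmxDr (mulmxA a ('D_v P x) (P x)) (mulmxA a (P x)) aP mul0mx addr0.
have := inner_horizontal_vertical (projH_sub g V x (a *m 'D_v P x)) hb.
by rewrite w.
Qed.

(** The first Christoffel symbols of the transverse metric with a vertical last
   entry vanish: this is how invariance of the transverse metric under vertical
   fields is used. *)
Definition vertical_killing : Prop := forall psi a b, (psi <= V x)%MS ->
  form ('D_psi T x) a b = form ('D_a T x) psi b + form ('D_b T x) a psi.

Hypothesis killing : vertical_killing.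

(** The left-hand side is what remains of the tension field of the target besides
   second derivatives of the map.  It is the Christoffel symbol of the first kind
   of the transverse metric: the Levi-Civita terms contain vertical components of
   [u], and the second summand, which comes from the adjoint of the integrability
   tensor, cancels them together with the invariance along the leaves. *)
Lemma connection_transverse (u z : 'rV[R]_n) : (z <= hor)%MS ->
  let phi := u *m P x in let psi := u *m projV g V x in
  inner g x (u *m 'D_u P x + christoffel_row g x u phi) z
  + inner g x psi (z *m 'D_phi P x + christoffel_row g x phi z) =
  form ('D_u T x) u z - 2^-1 * form ('D_z T x) u u.
Proof.
move=> hz phi psi.
have uE : u = phi + psi := esym (proj_add V gp u).
have hphi : (phi <= hor)%MS := projH_sub g V x u.
have hpsi : (psi <= V x)%MS := projV_sub g V x u.
have zP : z *m P x = z := projH_id gp hz.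
have gu := metric_unit gp.
have Dg w w' : 'D_(w + w') g x = 'D_w g x + 'D_w' g x.
  by rewrite -[w]scale1r derive_linear_dir // !scale1r.
have DT w w' : 'D_(w + w') T x = 'D_w T x + 'D_w' T x.
  by rewrite -[w]scale1r derive_linear_dir ?scale1r //; exact: differentiable_transverse.
have sg w a b : form ('D_w g x) a b = form ('D_w g x) b a.
  by rewrite -[in LHS]derive_metric_sym form_tr.
have sT w a b : form ('D_w T x) a b = form ('D_w T x) b a.
  by rewrite -[in LHS]derive_transverse_sym form_tr.
(* the two terms with a derivative of the projection *)
have e1 : inner g x (u *m 'D_u P x) z = form ('D_u T x) u z - form ('D_u g x) phi z.
  by rewrite derive_transverse_r form_addmx !form_mulmx addrK.
have e2 : inner g x psi (z *m 'D_phi P x) = form ('D_phi T x) psi z - form ('D_phi g x) psi z.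
  by rewrite sT derive_transverse_r form_addmx !form_mulmx zP (sg _ z psi) addrK (innerC gs).
have c1 := inner_christoffel_row u phi z dg gs gu.
have c2 := inner_christoffel_row phi z psi dg gs gu.
have d1 : form ('D_u g x) phi z = form ('D_phi g x) phi z + form ('D_psi g x) phi z.
  by rewrite -form_addmx -Dg -uE.
have d2 : form ('D_phi g x) u z = form ('D_phi g x) phi z + form ('D_phi g x) psi z.
  by rewrite -formDl -uE.
have d3 : form ('D_z g x) u phi = form ('D_z g x) phi phi + form ('D_z g x) psi phi.
  by rewrite -formDl -uE.
have e3 := killing phi z hpsi.
have e4 := derive_transverse_horizontal psi hphi hz.
have e5 := derive_transverse_horizontal z hphi hphi.
have e6 := derive_transverse_vertical z hpsi hpsi.
have e7 : form ('D_z T x) u u = form ('D_z T x) phi phi + 2 * form ('D_z T x) phi psi.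
  have -> : form ('D_z T x) u u = form ('D_z T x) (phi + psi) (phi + psi) by rewrite -uE.
  by rewrite !(formDl, formDr) e6 (sT z psi phi) addr0 mulr2n mulrDl mul1r addrA.
have s1 := sg phi z psi; have s2 := sg z phi psi.
have -> : inner g x (u *m 'D_u P x + christoffel_row g x u phi) z =
    inner g x (u *m 'D_u P x) z + inner g x (christoffel_row g x u phi) z by exact: innerDl.
have -> : inner g x psi (z *m 'D_phi P x + christoffel_row g x phi z) =
    inner g x psi (z *m 'D_phi P x) + inner g x (christoffel_row g x phi z) psi.
  by rewrite (innerDr gs); congr (_ + _); exact: innerC.
exact: connection_arith e1 e2 c1 c2 d1 d2 d3 s1 s2 e3 e4 e5 e7.
Qed.

End TransverseCalculus.

(** * Charts of a Riemannian foliation *)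

Section FoliationCharts.
Variables (R : realType) (n : nat).

Lemma killing_arith (a b c : R) : a - b - c = 0 -> a = b + c.
Proof. by move/eqP; rewrite subr_eq add0r subr_eq addrC => /eqP. Qed.

Lemma smooth_on_cst (k : nat) (U : set 'rV[R]_n) (a : 'rV[R]_k) :
  smooth_on U (fun=> a).
Proof.
move=> s x Ux; have [c ->] : exists c, iter_pd s (fun=> a) = (fun=> c).
  elim: s => [|i s [c sE]]; first by exists a.
  by exists 0; rewrite /= sE; apply/funext => y; exact: derive_cst.
exact: differentiable_cst.
Qed.

Lemma smooth_on_mull (k r : nat) (U : set 'rV[R]_n) (w : 'rV[R]_r)
    (B : 'rV[R]_n -> 'M[R]_(r, k)) : open U ->
  smooth_on U B -> smooth_on U (fun y => w *m B y).
Proof.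
move=> oU sB s.
have sE x : U x -> iter_pd s (fun y => w *m B y) x = w *m iter_pd s B x.
  elim: s x => //= i s IH x Ux.
  rewrite (@near_eq_derive _ _ _ _ (fun y => w *m iter_pd s B y)); last first.
    by have := open_near oU Ux; apply: filterS => y; exact: IH.
  rewrite (derive_mulmx _ (differentiable_cst w x) (sB s x Ux)) derive_cst.
  by rewrite mul0mx add0r.
move=> x Ux; apply: (near_eq_differentiable (u := fun y => w *m iter_pd s B y)).
  by have := open_near oU Ux; apply: filterS => y Uy; rewrite sE.
by apply: differentiable_mulmx; [exact: differentiable_cst|exact: sB].
Qed.

Lemma C1mx_local (k l : nat) (U : set 'rV[R]_n) (A : 'rV[R]_n -> 'M[R]_(k, l)) :
  (forall x, U x -> exists2 W : set 'rV[R]_n, W x & C1mx_on W A) -> C1mx_on U A.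
Proof. by move=> h i j x Ux; have [W Wx cA] := h x Ux; exact: cA. Qed.

Variable N : riemannianFoliation R n.
Implicit Types c d : chart N.

Let gsym c x : chart_img c x -> (metric c x)^T = metric c x.
Proof. exact: (Defs.metric_sym (metricP N)). Qed.

Let gpos c x (v : 'rV[R]_n) : chart_img c x -> v != 0 -> 0 < inner (metric c) x v v.
Proof. exact: (metric_pos (metricP N)). Qed.

Lemma chart_img_openN c : open (chart_img c).
Proof. exact: chart_img_open. Qed.

Arguments chart_img_openN c : clear implicits.

Lemma metric_C1 c : C1mx_on (chart_img c) (metric c).
Proof.
move=> i j; have sm : smooth_on (chart_img c) (metric c) := @metric_smooth _ _ _ _ (metricP N) c.
exact: (smooth_on_C1 i j [::] (chart_img_openN c) sm).
Qed.

Arguments metric_C1 c : clear implicits.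

Lemma projH_C1 c : C1mx_on (chart_img c) (projH (metric c) (vertical c)).
Proof.
apply: C1mx_local => x cx.
have [U [B [oU Ux Uc sB fB]]] := distribution_frame (verticalP N) cx.
exists U => //.
have cB : C1mx_on U B by move=> i j; exact: (smooth_on_C1 i j [::] oU sB).
have cg : C1mx_on U (metric c) by move=> i j y Uy; apply: metric_C1; exact: Uc.
have PE y : U y -> B y *m metric c y *m (B y)^T \in unitmx /\
   projH (metric c) (vertical c) y = 1%:M - metric c y *m (B y)^T *m
     invmx (B y *m metric c y *m (B y)^T) *m B y.
  move=> Uy; have [f e] := fB y Uy.
  exact: (projH_frame (fun v => @gpos c y v (Uc y Uy)) f e).
have cBt := C1mx_tr oU cB.
apply: (eq_C1mx oU (A := fun y => 1%:M - metric c y *m (B y)^T *m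
     invmx (B y *m metric c y *m (B y)^T) *m B y)).
  by move=> y Uy; have [_ ->] := PE y Uy.
apply: (C1mx_sub oU); first exact: C1mx_cst.
apply: (C1mx_mul oU) => //; apply: (C1mx_mul oU); first exact: C1mx_mul.
apply: (C1mx_inv oU); first by move=> y Uy; have [] := PE y Uy.
by apply: (C1mx_mul oU) => //; exact: C1mx_mul.
Qed.

Arguments projH_C1 c : clear implicits.

Lemma transverse_C1 c : C1mx_on (chart_img c) (transverse (metric c) (vertical c)).
Proof.
have oc := chart_img_openN c; have cP := projH_C1 c.
apply: (C1mx_mul oc); last exact: (C1mx_tr oc).
by apply: (C1mx_mul oc) => //; exact: metric_C1.
Qed.

Arguments transverse_C1 c : clear implicits.

(** A vertical vector extends to a vertical field with constant coefficients in a
   local frame of the leaves.  Its brackets with the constant fields [a] and [b]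
   contain derivatives of the frame, which are traded for derivatives of the
   transverse metric by differentiating the fact that vertical vectors are in
   its kernel. *)
Lemma foliation_killing c x : chart_img c x ->
  vertical_killing (metric c) (vertical c) x.
Proof.
move=> cx psi a b.
have [U [B [oU Ux Uc sB fB]]] := distribution_frame (verticalP N) cx.
have [_ /eqmxP BV] := fB x Ux.
rewrite -BV => /submxP[k ->{psi}].
pose X y := k *m B y.
have sX : smooth_on U X by exact: smooth_on_mull.
have XV y : U y -> (X y <= vertical c y)%MS.
  by move=> Uy; have [_ /eqmxP <-] := fB y Uy; exact: submxMl.
have dX : differentiable X x by exact: (sX [::] x Ux).
set T := transverse (metric c) (vertical c).
have dg : differentiable (metric c) x := C1mx_differentiable (@metric_C1 c) cx.
have dP : differentiable (projH (metric c) (vertical c)) x.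
  exact: C1mx_differentiable (@projH_C1 c) cx.
have dT : differentiable T x := C1mx_differentiable (@transverse_C1 c) cx.
have vert y u v : U y -> (u <= vertical c y)%MS -> form (T y) u v = 0.
  move=> Uy uV; rewrite /T /transverse !form_mulmx_tr !form_mulmx.
  by rewrite (projH_vertical (fun w => @gpos c y w (Uc y Uy)) uV) form0l.
have symT y u v : U y -> form (T y) u v = form (T y) v u.
  by move=> Uy; rewrite -[RHS]form_tr (transverse_sym (vertical c) (@gsym c) (Uc y Uy)).
(* differentiating T (X, v) = 0 *)
have dvert w v : form ('D_w T x) (X x) v = - form (T x) ('D_w X x) v.
  have E : 'D_w (fun y => (X y *m T y *m v^T)) x = 0.
    rewrite (@near_eq_derive _ _ _ _ (fun=> 0)) ?derive_cst //.
    have := open_near oU Ux; apply: filterS => y Uy; apply/matrixP => i j.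
    by rewrite (ord1 i) (ord1 j) [RHS]mxE; exact: vert _ _ v Uy (XV y Uy).
  have dXT : differentiable (fun y => X y *m T y) x := differentiable_mulmx dX dT.
  rewrite (derive_mulmx _ dXT (differentiable_cst v^T x)) in E.
  rewrite (derive_mulmx _ dX dT) derive_cst mulmx0 addr0 mulmxDl in E.
  have := congr1 (fun M : 'M[R]_1 => M 0 0) E; rewrite mxE [RHS]mxE.
  by move/eqP; rewrite addrC addr_eq0 => /eqP.
have lb (v : 'rV[R]_n) : lie_bracket X (fun=> v) x = - 'D_v X x.
  by rewrite /lie_bracket [X in X - _]derive_cst sub0r.
have := metric_bundle_like (r := N) oU Uc (conj sX XV) (smooth_on_cst a) (smooth_on_cst b) Ux.
rewrite (lb a) (lb b) inner_horizontalE [X in _ - X]inner_horizontalE.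
rewrite (_ : (fun y => _) = fun y => form (T y) a b); last first.
  by apply/funext => y; rewrite inner_horizontalE.
rewrite (derive_form _ a b dT) -/T => h.
have neg (u v : 'rV[R]_n) : form (T x) (- u) v = - form (T x) u v.
  by rewrite -scaleN1r formZl mulN1r.
have sd w u v : form ('D_w T x) u v = form ('D_w T x) v u.
  by rewrite -[RHS]form_tr (derive_transverse_sym (chart_img_openN c) cx (@gsym c) (@gpos c) dg dP).
have e1 := neg ('D_a X x) b; have e2 := neg ('D_b X x) a.
have e3 := symT x a (- 'D_b X x) Ux; have e4 := sd b a (X x).
have e5 := etrans e1 (esym (dvert a b)).
have e6 := etrans (etrans e3 e2) (etrans (esym (dvert b a)) (esym e4)).
exact: (etrans (killing_arith h) (congr2 +%R e5 e6)).
Qed.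

Lemma transition_differentiable c d x : overlap c d x -> differentiable (transition c d) x.
Proof. by move=> cx; have := @transition_smooth _ _ N c d [::] x cx. Qed.

(** A change of charts preserves the metric and the vertical distribution, hence
   it commutes with the orthogonal projections. *)
Lemma transverse_compat c d x u v : overlap c d x ->
  form (transverse (metric c) (vertical c) x) u v =
  form (transverse (metric d) (vertical d) (transition c d x))
    ('D_u (transition c d) x) ('D_v (transition c d) x).
Proof.
move=> cdx.
have cx : chart_img c x by case: cdx => a [ca _] <-; exists a.
set y := transition c d x.
have dy : chart_img d y.
  by case: cdx => a [ca da] ax; exists a; rewrite // /y /transition /= -ax chart_mapK.
have dt := transition_differentiable cdx.
pose L u := 'D_u (transition c d) x.
have LD u1 u2 : L (u1 + u2) = L u1 + L u2.
  by rewrite /L -[u1]scale1r derive_linear_dir // !scale1r.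
have mc u1 u2 : inner (metric c) x u1 u2 = inner (metric d) y (L u1) (L u2).
  exact: (metric_compat (metricP N)).
have vc u1 : (u1 <= vertical c x)%MS = (L u1 <= vertical d y)%MS.
  exact: (distribution_compat (verticalP N)).
have gpx w := @gpos c x w cx; have gpy w := @gpos d y w dy.
have gsx := gsym cx; have gsy := gsym dy.
pose J := lin1_mx ('d (transition c d) x).
have LJ u1 : L u1 = u1 *m J by rewrite /L (deriveEjacobian _ dt).
have uJ : J \in unitmx.
  rewrite -row_free_unit -kermx_eq0; apply/eqP/row_matrixP => i; rewrite row0.
  apply: (inner_eq0 gpx); rewrite mc LJ.
  rewrite (_ : row i (kermx J) *m J = 0) ?inner0l //.
  by apply/sub_kermxP; exact: row_sub.
have LP w : L (w *m projH (metric c) (vertical c) x) =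
    L w *m projH (metric d) (vertical d) y.
  have h1 : (L (w *m projH (metric c) (vertical c) x) <= horizontal (metric d) (vertical d) y)%MS.
    apply/horizontalP => z zV.
    have zE : z = L (z *m invmx J) by rewrite LJ mulmxKV.
    rewrite zE -mc; apply: inner_horizontal_vertical (projH_sub _ _ _ _) _.
    by rewrite vc -zE.
  have h2 : (L (w *m projV (metric c) (vertical c) x) <= vertical d y)%MS.
    by rewrite -vc; exact: projV_sub.
  rewrite -{2}(proj_add (vertical c) gpx w) LD mulmxDl.
  by rewrite [X in _ = _ + X](projH_vertical gpy h2) [X in _ = X + _](projH_id gpy h1) [RHS]addr0.
rewrite -!inner_horizontalE /inner_horizontal mc !LP //.
Qed.

End FoliationCharts.
Arguments chart_img_openN {R n N} c.
Arguments metric_C1 {R n N} c.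
Arguments projH_C1 {R n N} c.
Arguments transverse_C1 {R n N} c.

(** * The pull-back of the transverse metric *)

Section PulledBackMetric.
Variables (R : realType) (m n : nat) (N : riemannianFoliation R n).
Variable f : heisenberg R m -> N.
Hypothesis f_smooth : smooth_map f.
Local Notation K := (heisenberg R m).
Local Notation q := (m + m + 1)%N.
Implicit Types (c d : chart N) (p u v : K).

Definition chart_preim c : set K := f @^-1` chart_dom c.
Definition chart_rep c : K -> 'rV[R]_n := chart_map c \o f.

Lemma chart_preim_open c : open (chart_preim c).
Proof.
have cf : continuous f := f_smooth.1.
by have /continuousP := cf; apply; exact: chart_dom_open.
Qed.

Lemma chart_preim_at p : chart_preim (chart_at (f p)) p.
Proof. exact: chart_at_dom. Qed.

Lemma chart_rep_img c p : chart_preim c p -> chart_img c (chart_rep c p).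
Proof. by move=> cp; exists (f p). Qed.

Lemma chart_rep_smooth c : smooth_on (chart_preim c) (chart_rep c).
Proof. exact: f_smooth.2. Qed.

Lemma chart_rep_differentiable c p : chart_preim c p -> differentiable (chart_rep c) p.
Proof. by move=> cp; have := @chart_rep_smooth c [::] p cp. Qed.

Definition jacobian_mx c p : 'M[R]_(q, n) := \matrix_i 'D_(basis_vec R i) (chart_rep c) p.

Lemma jacobian_mxE c p v : chart_preim c p ->
  v *m jacobian_mx c p = 'D_v (chart_rep c) p.
Proof.
move=> cp; rewrite (derive_partials v (chart_rep_differentiable cp)) mulmx_sum_row.
by apply: eq_bigr => i _; rewrite rowK.
Qed.

Lemma jacobian_mx_C1 c : C1mx_on (chart_preim c) (jacobian_mx c).
Proof.
move=> i k; have oc := @chart_preim_open c.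
have h := smooth_on_C1 ord0 k [:: i] oc (@chart_rep_smooth c).
by apply: (eq_C1_on oc _ h) => p _; rewrite [RHS]mxE.
Qed.

Local Notation T c := (transverse (metric c) (vertical c)).

Definition pull c p : 'M[R]_q :=
  jacobian_mx c p *m T c (chart_rep c p) *m (jacobian_mx c p)^T.

Lemma pull_form c p u v : chart_preim c p ->
  form (pull c p) u v =
  form (T c (chart_rep c p)) ('D_u (chart_rep c) p) ('D_v (chart_rep c) p).
Proof. by move=> cp; rewrite -!(jacobian_mxE _ cp) /form /pull trmx_mul !mulmxA. Qed.

Lemma transverse_rep_C1 c : C1mx_on (chart_preim c) (fun p => T c (chart_rep c p)).
Proof.
move=> i j; have oc := @chart_preim_open c.
apply: (C1_on_comp oc (V := chart_img c) (F := chart_rep c)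
  (u := fun y => T c y i j)).
- by move=> p; exact: chart_rep_img.
- by move=> k; exact: (smooth_on_C1 ord0 k [::] oc (@chart_rep_smooth c)).
- exact: (@transverse_C1 _ _ _ c i j).
Qed.

Lemma pull_C1 c : C1mx_on (chart_preim c) (pull c).
Proof.
have oc := @chart_preim_open c; have cJ := @jacobian_mx_C1 c.
have cJt := C1mx_tr oc cJ; have cT := @transverse_rep_C1 c.
by have cJT := C1mx_mul oc cJ cT; exact: (C1mx_mul oc cJT cJt).
Qed.

(** The chain rule for the change of charts and the invariance of the transverse
   metric; so the local pull-backs glue. *)
Lemma pull_chart c d p : chart_preim c p -> chart_preim d p -> pull c p = pull d p.
Proof.
move=> cp dp; apply: form_mx_inj => u v.
apply: etrans (pull_form u v cp) (etrans _ (esym (pull_form u v dp))).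
have cdp : overlap c d (chart_rep c p) by exists (f p).
have tE : transition c d (chart_rep c p) = chart_rep d p.
  by rewrite /transition /chart_rep /= chart_mapK.
have near_rep : \forall p' \near p, transition c d (chart_rep c p') = chart_rep d p'.
  have := open_near (@chart_preim_open c) cp; apply: filterS => p' cp'.
  by rewrite /transition /chart_rep /= chart_mapK.
have DE w : 'D_w (chart_rep d) p = 'D_('D_w (chart_rep c) p) (transition c d) (chart_rep c p).
  rewrite -(derive_comp w (chart_rep_differentiable cp) (transition_differentiable cdp)).
  by apply/esym; exact: near_eq_derive.
by rewrite (transverse_compat _ _ cdp) tE -!DE.
Qed.

Definition pullback p : 'M[R]_q := pull (chart_at (f p)) p.

Lemma pullbackE c p : chart_preim c p -> pullback p = pull c p.
Proof. by move=> cp; apply: pull_chart => //; exact: chart_preim_at. Qed.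

Lemma pullback_form c p u v : chart_preim c p ->
  form (pullback p) u v =
  form (T c (chart_rep c p)) ('D_u (chart_rep c) p) ('D_v (chart_rep c) p).
Proof. by move=> cp; rewrite (pullbackE cp) pull_form. Qed.

Lemma pullback_C1 : C1mx_on setT pullback.
Proof.
apply: C1mx_local => p _; pose c := chart_at (f p).
exists (chart_preim c); first exact: chart_preim_at.
apply: (eq_C1mx (@chart_preim_open c) _ (@pull_C1 c)).
by move=> p' cp'; rewrite (pullbackE cp').
Qed.

Lemma pullback_sym p : (pullback p)^T = pullback p.
Proof.
have sT : (T (chart_at (f p)) (chart_rep (chart_at (f p)) p))^T = T (chart_at (f p)) (chart_rep (chart_at (f p)) p).
  apply: (transverse_sym _ (U := chart_img (chart_at (f p)))).
    by move=> y; exact: (Defs.metric_sym (metricP N)).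
  by apply: chart_rep_img; exact: chart_preim_at.
by rewrite /pullback /pull [LHS]trmx_mul trmxK [X in _ *m X]trmx_mul sT mulmxA.
Qed.

Lemma pullback_ge0 p v : 0 <= form (pullback p) v v.
Proof.
have cp := chart_preim_at p.
rewrite (pullback_form v v cp) -inner_horizontalE /inner_horizontal.
by apply: inner_ge0 => w; apply: (metric_pos (metricP N)); exact: chart_rep_img.
Qed.

Lemma pullback_periodic p : K_map f -> pullback (p + basis_vec R (it m)) = pullback p.
Proof.
move=> f_K; have fE p' : f (p' + basis_vec R (it m)) = f p'.
  by have := f_K p' 1; rewrite scale1r.
have repE c p' : chart_rep c (p' + basis_vec R (it m)) = chart_rep c p'.
  by rewrite /chart_rep /= fE.
have JE c : jacobian_mx c (p + basis_vec R (it m)) = jacobian_mx c p.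
  apply/row_matrixP => i; rewrite !rowK /derive repE.
  suff -> : chart_rep c \o shift (p + basis_vec R (it m)) = chart_rep c \o shift p by [].
  by apply/funext => y; rewrite /= addrA repE.
by rewrite /pullback /pull fE JE repE.
Qed.

End PulledBackMetric.

(** * The harmonic map equation *)

Section TensionPairing.
Variables (R : realType) (n : nat).
Variables (g V : 'rV[R]_n -> 'M[R]_n) (U : set 'rV[R]_n) (x : 'rV[R]_n).
Hypothesis oU : open U.
Hypothesis Ux : U x.
Hypothesis gsym : forall y, U y -> (g y)^T = g y.
Hypothesis gpos : forall y (v : 'rV[R]_n), U y -> v != 0 -> 0 < inner g y v v.
Hypothesis dg : differentiable g x.
Hypothesis dP : differentiable (projH g V) x.
Local Notation P := (projH g V).
Local Notation T := (transverse g V).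
Local Notation hor := (horizontal g V x).
Let gs := gsym Ux.
Let gp (v : 'rV[R]_n) := @gpos x v Ux.

Lemma christoffel_row_linear (u v w : 'rV[R]_n) a :
  christoffel_row g x u (a *: v + w) = a *: christoffel_row g x u v + christoffel_row g x u w.
Proof.
apply/rowP => k; rewrite !mxE mulr_sumr -big_split; apply: eq_bigr => i _ /=.
rewrite mulr_sumr -big_split; apply: eq_bigr => j _ /=.
by rewrite !mxE; ring.
Qed.

Lemma nabla_mull (v w : 'rV[R]_n) :
  nabla g w (fun y => v *m P y) x = v *m 'D_w P x + christoffel_row g x w (v *m P x).
Proof.
rewrite /nabla /pullback_nabla derive_id.
by rewrite (derive_mulmx w (differentiable_cst v x) dP) derive_cst mul0mx add0r.
Qed.

Lemma tensorTE (u v : 'rV[R]_n) : (u <= hor)%MS ->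
  tensorT g V x u v =
  (v *m 'D_u P x + christoffel_row g x u (v *m P x)) *m projV g V x.
Proof. by move=> hu; rewrite /tensorT (projH_id gp hu) nabla_mull. Qed.

Lemma tensorT_linear (u v w : 'rV[R]_n) a : (u <= hor)%MS ->
  tensorT g V x u (a *: v + w) = a *: tensorT g V x u v + tensorT g V x u w.
Proof.
move=> hu; rewrite (tensorTE _ hu) (tensorTE v hu) (tensorTE w hu).
rewrite scalemxAl -[RHS]mulmxDl; congr (_ *m _).
rewrite (mulmxDl (a *: v) w ('D_u P x)) (mulmxDl (a *: v) w (P x)).
rewrite -(scalemxAl a v ('D_u P x)) -(scalemxAl a v (P x)) christoffel_row_linear.
by rewrite scalerDr addrACA.
Qed.

(** The definition of the adjoint tests against the coordinate basis; linearity of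
   the tensor gives all vectors. *)
Lemma inner_tensorTadj (u y z : 'rV[R]_n) : (u <= hor)%MS ->
  inner g x (tensorTadj g V x u y) z = inner g x y (tensorT g V x u z).
Proof.
move=> hu; rewrite {1}/inner /tensorTadj -(mulmxA _ (invmx _)) mulVmx ?mulmx1; last first.
  exact: metric_unit gp.
have suml (F : 'I_n -> 'rV[R]_n) :
    tensorT g V x u (\sum_l F l) = \sum_l tensorT g V x u (F l).
  elim/big_rec2: _ => [|l a b _ IH].
    have := tensorT_linear 0 0 (-1) hu; rewrite scaleN1r oppr0 addr0 scaleN1r addNr //.
  by rewrite -[F l]scale1r (tensorT_linear _ _ _ hu) IH !scale1r.
have zE : z = \sum_l z 0 l *: basis_vec R l := row_sum_delta z.
rewrite {2}zE suml (innerC gs) inner_suml mxE; apply: eq_bigr => l _.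
have -> : tensorT g V x u (z 0 l *: basis_vec R l) = z 0 l *: tensorT g V x u (basis_vec R l).
  have := tensorT_linear (basis_vec R l) 0 (z 0 l) hu.
  have := suml (fun=> 0); rewrite addr0.
  have -> : tensorT g V x u 0 = 0.
    by have := tensorT_linear 0 0 (-1) hu; rewrite scaleN1r oppr0 addr0 scaleN1r addNr.
  by rewrite addr0.
by rewrite innerZl (innerC gs) mulrC [z^T l 0]mxE; congr (_ * _); rewrite mxE.
Qed.

Hypothesis killing : vertical_killing g V x.

(** The terms of the tension field which are of order zero in the second
   derivatives of the map, paired with a horizontal vector. *)
Lemma tension_pairing (u z : 'rV[R]_n) : (z <= hor)%MS ->
  let phi := u *m P x in let psi := u *m projV g V x in
  inner g x (u *m 'D_u P x + christoffel_row g x u phi) z +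
  inner g x (tensorTadj g V x phi psi + tensorW g V x phi psi) z =
  form ('D_u T x) u z - 2^-1 * form ('D_z T x) u u.
Proof.
move=> hz phi psi; rewrite -(connection_transverse oU Ux gsym gpos dg dP killing u hz).
congr (_ + _); have hphi : (phi <= hor)%MS := projH_sub g V x u.
have hpsi : (psi <= V x)%MS := projV_sub g V x u.
rewrite innerDl (inner_tensorTadj _ _ hphi) (tensorTE _ hphi) (projH_id gp hz).
have -> : inner g x (tensorW g V x phi psi) z = 0.
  rewrite /tensorW -scaleN1r innerZl (innerC gs).
  by rewrite (inner_horizontal_vertical hz (projV_sub g V x _)) mulr0.
rewrite addr0 -/psi.
have := inner_projV V gs gp u (z *m 'D_phi P x + christoffel_row g x phi z).
by rewrite -/psi.
Qed.

End TensionPairing.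

Section WebsterGeometry.
Variables (R : realType) (m : nat).
Local Notation K := (heisenberg R m).
Local Notation q := (m + m + 1)%N.
Local Notation t := (it m).
Local Notation zix a := (lshift 1 a : 'I_q).
Local Notation g := (@webster_metric R m).
Local Notation V := (@webster_vertical R m).
Implicit Types (p u v z : K) (a : 'I_(m + m)).

Lemma webster_sym p : (g p)^T = g p.
Proof. by apply/matrixP => i j; rewrite !mxE webster_formC. Qed.

Lemma webster_pos p (v : 'rV[R]_q) : v != 0 -> 0 < inner g p v v.
Proof.
move=> v0; rewrite inner_webster lt_neqAle /webster_form; apply/andP; split; last first.
  by rewrite addr_ge0 ?sqr_ge0 // sumr_ge0 // => j _; rewrite addr_ge0 // sqr_ge0.
apply/eqP => /esym/eqP; rewrite paddr_eq0; last 2 first.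
- by rewrite sumr_ge0 // => j _; rewrite addr_ge0 // sqr_ge0.
- exact: sqr_ge0.
move=> /andP[]; rewrite psumr_eq0; last by move=> j _; rewrite addr_ge0 // sqr_ge0.
move=> /allP vz /eqP e0; move/negP: v0; apply; apply/eqP.
have z0 j : v 0 (ix j) = 0 /\ v 0 (iy j) = 0.
  have := vz j (mem_index_enum _).
  by rewrite /= paddr_eq0 ?sqr_ge0 // !mulf_eq0 !orbb => /andP[/eqP -> /eqP ->].
have t0 : v 0 t = 0.
  move/eqP: e0; rewrite mulf_eq0 orbb /eta big1 ?addr0; last first.
    by move=> j _; rewrite (z0 j).1 (z0 j).2 !mulr0 subr0.
  by rewrite mulf_eq0 invr_eq0 pnatr_eq0 /= => /eqP.
apply/rowP => i; rewrite [RHS]mxE.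
case: (split_ordP i) => [a ->|b ->]; last by rewrite (ord1 b).
by case: (split_ordP a) => j ->; rewrite ?(z0 j).1 ?(z0 j).2.
Qed.

Lemma frame_it_vertical p : (webster_frame t p <= V p)%MS.
Proof.
rewrite frame_it scalemx_sub //; apply/submxP; exists (delta_mx 0 t).
by rewrite /webster_vertical mul_delta_mx.
Qed.

Lemma frame_zix_horizontal p a : (webster_frame (zix a) p <= horizontal g V p)%MS.
Proof.
apply/horizontalP => v /submxP[k ->].
have -> : k *m V p = (2^-1 * k 0 t) *: webster_frame t p.
  rewrite frame_it scalerA mulrAC mulVf ?mul1r // /webster_vertical.
  apply/rowP => i; rewrite !mxE (bigD1 t) //= big1 => [|j /negbTE jt].
    by rewrite !mxE ?eqxx /= addr0.
  by rewrite mxE jt mulr0.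
rewrite (innerC (webster_sym p)) innerZl (innerC (webster_sym p)).
by rewrite webster_frame_orthonormal eq_lrshift mulr0.
Qed.

Lemma frame_zix_projH p a : webster_frame (zix a) p *m projH g V p = webster_frame (zix a) p.
Proof. exact: (@projH_id _ _ g V p (@webster_pos p) _ (frame_zix_horizontal p a)). Qed.

Lemma frame_zix_projV p a : webster_frame (zix a) p *m projV g V p = 0.
Proof. exact: (@projV_horizontal _ _ g V p (@webster_pos p) _ (frame_zix_horizontal p a)). Qed.

Lemma frame_it_projH p : webster_frame t p *m projH g V p = 0.
Proof. exact: (@projH_vertical _ _ g V p (@webster_pos p) _ (frame_it_vertical p)). Qed.

Lemma frame_it_projV p : webster_frame t p *m projV g V p = webster_frame t p.
Proof. exact: (@projV_id _ _ g V p (@webster_pos p) _ (frame_it_vertical p)). Qed.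

(** The derivative of [eta _ u] along [v], which is half of [d eta (v, u)]. *)
Definition area v u : R :=
  \sum_(j < m) (v 0 (ix j) * u 0 (iy j) - v 0 (iy j) * u 0 (ix j)).

Lemma area_diag u : area u u = 0.
Proof. by apply: big1 => j _; rewrite mulrC subrr. Qed.

Lemma areaC u v : area v u = - area u v.
Proof. by rewrite -sumrN; apply: eq_bigr => j _; ring. Qed.

Lemma eta_C1 u : C1_on setT (fun p : K => eta p u).
Proof.
rewrite /eta; apply: (C1_onD openT); first exact: (C1_on_cst openT).
apply: (C1_on_sum openT) => j _; apply: (C1_onB openT).
  by apply: (C1_onM openT); [exact: (C1_on_coord openT)|exact: (C1_on_cst openT)].
by apply: (C1_onM openT); [exact: (C1_on_coord openT)|exact: (C1_on_cst openT)].
Qed.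

Lemma derive_eta p u v : 'D_v (fun y : K => eta y u) p = area v u.
Proof.
have dc i : differentiable (fun y : K => y 0 i) p by exact: differentiable_coord.
have dcu i (b : R) : differentiable (fun y : K => y 0 i * b) p.
  by apply: differentiableM => //; exact: differentiable_cst.
rewrite /eta deriveD_at ?derive_cst ?add0r; last 2 first.
- exact: differentiable_cst.
- rewrite (_ : (fun y => _) = \sum_j (fun y : K => y 0 (ix j) * u 0 (iy j) - y 0 (iy j) * u 0 (ix j))).
    by apply: differentiable_sum => j; apply: differentiableB.
  by apply/funext => y; rewrite fct_sumE.
rewrite derive_sum_at => [|j]; last exact: differentiableB.
apply: eq_bigr => j _.
have dm i (b : R) : 'D_v (fun y : K => y 0 i * b) p = v 0 i * b.
  by rewrite (@deriveM_at _ _ (fun y : K => y 0 i) (fun=> b)) ?derive_cst ?mulr0 ?addr0 ?derive_coord // mulrC.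
rewrite deriveB; last 2 first.
- by apply: diff_derivable; exact: dcu.
- by apply: diff_derivable; exact: dcu.
by rewrite !dm.
Qed.

Lemma webster_C1 : C1mx_on setT g.
Proof.
move=> i j; apply: (eq_C1_on openT (u := fun p : K => webster_form p (basis_vec R i) (basis_vec R j))).
  by move=> p _; rewrite mxE.
rewrite /webster_form; apply: (C1_onD openT); first exact: (C1_on_cst openT).
by apply: (C1_onM openT); exact: eta_C1.
Qed.

Lemma webster_differentiable p : differentiable g p.
Proof. exact: (C1mx_differentiable webster_C1). Qed.

Lemma derive_webster p u v z :
  form ('D_v g p) u z = area v u * eta p z + eta p u * area v z.
Proof.
have de w : differentiable (fun y : K => eta y w) p := (@eta_C1 w p I).1.
rewrite -derive_form; last exact: webster_differentiable.
rewrite (_ : (fun y => _) = fun y : K => \sum_(j < m) (u 0 (ix j) * z 0 (ix j) +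
    u 0 (iy j) * z 0 (iy j)) + eta y u * eta y z); last first.
  by apply/funext => y; rewrite -[LHS]/(inner g y u z) inner_webster.
rewrite deriveD_at ?derive_cst ?add0r; last 2 first.
- exact: differentiable_cst.
- exact: differentiableM.
rewrite (@deriveM_at _ _ (fun y : K => eta y u) (fun y : K => eta y z)) // !derive_eta.
by rewrite addrC mulrC; congr (_ + _); rewrite mulrC.
Qed.

(** By the formula for the first Christoffel symbols, the pairing with [w] is
   [2 * eta p e * area e w]: a horizontal [e] is in the kernel of [eta], and the
   vertical one in the kernel of [area]. *)
Lemma christoffel_frame p A :
  christoffel_row g p (webster_frame A p) (webster_frame A p) = 0.
Proof.
have hw w : eta p (webster_frame A p) * area (webster_frame A p) w = 0.
  case: (split_ordP A) => [a|b] ->.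
    rewrite /webster_frame split_lshift.
    by case: (split_ordP a) => j _; rewrite ?eta_frameX ?eta_frameY mul0r.
  rewrite /webster_frame split_rshift /area big1 ?mulr0 // => j _.
  by rewrite frameT_ix frameT_iy !mul0r subrr.
move: hw; set e := webster_frame A p => hw.
apply: (inner_eq0 (@webster_pos p)).
move: (christoffel_row _ _ _ _) (@inner_christoffel_row R q g p e e) => w h.
apply: (etrans (h w (webster_differentiable p) (webster_sym p) (metric_unit (@webster_pos p)))).
have aux (x y z : R) : x = 0 -> y = 0 -> z = 0 -> 2^-1 * (x + y - z) = 0.
  by move=> -> -> ->; rewrite subr0 addr0 mulr0.
apply: aux.
- by apply: (etrans (derive_webster p e e w)); rewrite area_diag mul0r add0r.
- by apply: (etrans (derive_webster p e e w)); rewrite area_diag mul0r add0r.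
- apply: (etrans (derive_webster p e w e)).
  by rewrite (areaC e w) mulNr [area e w * _]mulrC mulrN hw oppr0 addr0.
Qed.

Lemma derive_frame_self p A : 'D_(webster_frame A p) (webster_frame A) p = 0.
Proof.
case: (split_ordP A) => [a ->|b ->]; last first.
  rewrite (ord1 b) -[rshift _ _]/t (_ : webster_frame t = fun=> 2 *: basis_vec R t); last first.
    by apply/funext => y; exact: frame_it.
  exact: derive_cst.
have fE : webster_frame (zix a) = fun y : K => basis_vec R (zix a) + slope a y *: basis_vec R t.
  by apply/funext => y; exact: frame_zix.
have ds : differentiable (@slope R m a) p := (@C1_slope R m a p I).1.
set e := webster_frame (zix a) p.
have es : slope a e = 0 by rewrite /e frame_zix slopeD slope_zix slope_t mulr0 addr0.
apply/rowP => i; rewrite fE coord_derive; last first.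
  apply: diff_derivable; apply: differentiableD; first exact: differentiable_cst.
  by apply: (@differentiableZl _ _ _ (@slope R m a) (basis_vec R t)).
rewrite (_ : (fun y => _) = fun y : K => basis_vec R (zix a) 0 i + slope a y * basis_vec R t 0 i); last first.
  by apply/funext => y; rewrite mxE [X in _ + X]mxE.
rewrite deriveD_at ?derive_cst ?add0r; last 2 first.
- exact: differentiable_cst.
- by apply: differentiableM => //; exact: differentiable_cst.
rewrite (@deriveM_at _ _ (slope a) (fun=> basis_vec R t 0 i)) //.
by rewrite derive_cst mulr0 addr0 derive_slope es mul0r [RHS]mxE.
Qed.

(** So the source connection contributes nothing to the tension field. *)
Lemma nabla_frame p A : nabla g (webster_frame A p) (webster_frame A) p = 0.
Proof.
by rewrite /nabla /pullback_nabla derive_frame_self derive_id add0r; exact: christoffel_frame.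
Qed.

End WebsterGeometry.

Section SecondDerivatives.
Variables (R : realType) (q n : nat) (U : set 'rV[R]_q) (F : 'rV[R]_q -> 'rV[R]_n).
Hypothesis oU : open U.
Hypothesis sF : smooth_on U F.
Implicit Types p v w : 'rV[R]_q.

Lemma smooth_differentiable p : U p -> differentiable F p.
Proof. by move=> Up; have := @sF [::] p Up. Qed.

Lemma C1_derive_dir w k : C1_on U (fun y => ('D_w F y) 0 k).
Proof.
apply: (eq_C1_on oU (u := fun y => \sum_i w 0 i * ('D_(basis_vec R i) F y) 0 k)).
  move=> p Up; rewrite (derive_partials w (smooth_differentiable Up)) summxE.
  by apply: eq_bigr => i _; rewrite [RHS]mxE.
apply: (C1_on_sum oU) => i _; apply: (C1_onM oU); first exact: C1_on_cst.
exact: (smooth_on_C1 ord0 k [:: i] oU sF).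
Qed.

Lemma differentiable_derive_dir w p : U p -> differentiable (fun y => 'D_w F y) p.
Proof.
move=> Up; apply: differentiable_mx => i k; rewrite (ord1 i).
exact: (@C1_derive_dir w k p Up).1.
Qed.

Lemma derive_entry w k p : U p -> 'D_w (fun y => F y 0 k) p = ('D_w F p) 0 k.
Proof. by move=> Up; rewrite coord_derive //; exact/diff_derivable/smooth_differentiable. Qed.

Lemma C1_derive_continuous (u : 'rV[R]_q -> R) w p : C1_on U u -> U p ->
  {for p, continuous (fun y => 'D_w u y)}.
Proof.
move=> cu Up.
have E : (fun y => \sum_j w 0 j * 'D_(basis_vec R j) u y) @ p --> 'D_w u p.
  rewrite (derive_partials w (cu p Up).1).
  apply: (@continuous_at_sum _ _ _ _ _ (fun j y => w 0 j * 'D_(basis_vec R j) u y)) => j _.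
  by apply: continuousM; [exact: cst_continuous|exact: (cu p Up).2].
apply: cvg_trans E; apply: (@near_eq_cvg _ _ (nbhs p)).
have := open_near oU Up; apply: filterS => y Uy.
by rewrite (derive_partials w (cu y Uy).1).
Qed.

Lemma smooth_derive_comm v w p : U p ->
  'D_v (fun y => 'D_w F y) p = 'D_w (fun y => 'D_v F y) p.
Proof.
move=> Up; apply/rowP => k.
have dd a : derivable (fun y => 'D_a F y) p v /\ derivable (fun y => 'D_a F y) p w.
  by split; apply: diff_derivable; exact: differentiable_derive_dir.
apply: (etrans (coord_derive 0 k (dd w).1) (etrans _ (esym (coord_derive 0 k (dd v).2)))).
have near_entry a : \near p, ('D_a F p) 0 k = 'D_a (fun y => F y 0 k) p.
  by have := open_near oU Up; apply: filterS => y Uy; rewrite derive_entry.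
apply: (etrans (near_eq_derive v (near_entry w)) (etrans _ (esym (near_eq_derive w (near_entry v))))).
have cD a : C1_on U (fun y => 'D_a (fun z => F z 0 k) y).
  by apply: (eq_C1_on oU _ (C1_derive_dir a k)) => y Uy; rewrite derive_entry.
apply: (derive_comm oU Up).
- move=> y Uy; split.
  + exact: differentiable_entry (smooth_differentiable Uy).
  + exact: (cD v y Uy).1.
  + exact: (cD w y Uy).1.
- exact: C1_derive_continuous (cD v) Up.
- exact: C1_derive_continuous (cD w) Up.
Qed.

Lemma derive_form_prod (M : 'rV[R]_q -> 'M[R]_n) (X Y : 'rV[R]_q -> 'rV[R]_n) p v :
  differentiable M p -> differentiable X p -> differentiable Y p ->
  'D_v (fun y => form (M y) (X y) (Y y)) p =
  form ('D_v M p) (X p) (Y p) + form (M p) ('D_v X p) (Y p) +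
  form (M p) (X p) ('D_v Y p).
Proof.
move=> dM dX dY.
have dXM := differentiable_mulmx dX dM.
have dYt := differentiable_trmx dY.
have dXMY : derivable (fun y => X y *m M y *m (Y y)^T) p v.
  by apply: diff_derivable; exact: differentiable_mulmx.
rewrite -(coord_derive _ _ dXMY) (derive_mulmx v dXM dYt) (derive_mulmx v dX dM).
rewrite derive_trmx // mulmxDl mxE [X in X + _]mxE /form.
by rewrite [X in X + _]addrC.
Qed.

End SecondDerivatives.

(* Linear arithmetic kept apart from the matrix expressions it is used on. *)
Lemma pairing_add (R : realType) (a b c a1 a2 b1 b2 c1 c2 : R) :
  a = a1 + a2 -> b = b1 + b2 -> c = c1 + c2 ->
  a + (b - 2^-1 * c) = a1 + (b1 - 2^-1 * c1) + (a2 + (b2 - 2^-1 * c2)).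
Proof. by move=> -> -> ->; ring. Qed.

Lemma pairing_vertical (R : realType) (a b c d : R) :
  a = 0 -> c = d + b -> d = b -> a + (b - 2^-1 * c) = 0.
Proof. by move=> -> -> ->; lra. Qed.

Section HarmonicMapEquation.
Variables (R : realType) (m n : nat) (N : riemannianFoliation R n).
Variable f : heisenberg R m -> N.
Hypothesis f_smooth : smooth_map f.
Local Notation K := (heisenberg R m).
Local Notation q := (m + m + 1)%N.
Local Notation t := (it m).
Local Notation zix a := (lshift 1 a : 'I_q).
Local Notation g := (@webster_metric R m).
Local Notation V := (@webster_vertical R m).
Local Notation fr a p := (webster_frame (zix a) p : K).
Implicit Types (p v w : K) (a : 'I_(m + m)).

Section InChart.
Variables (c : chart N) (p : K).
Hypothesis cp : chart_preim f c p.
Local Notation F := (chart_rep f c).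
Local Notation g' := (metric c).
Local Notation V' := (vertical c).
Local Notation P := (projH g' V').
Local Notation T := (transverse g' V').
Local Notation x := (F p).
Let oU : open (chart_preim f c) := @chart_preim_open _ _ _ _ f f_smooth c.
Let sF : smooth_on (chart_preim f c) F := @chart_rep_smooth _ _ _ _ f f_smooth c.
Let cx : chart_img c x := chart_rep_img cp.
Let dg : differentiable g' x := C1mx_differentiable (@metric_C1 _ _ N c) cx.
Let dP : differentiable P x := C1mx_differentiable (@projH_C1 _ _ N c) cx.
Let dT : differentiable T x := C1mx_differentiable (@transverse_C1 _ _ N c) cx.
Let dF : differentiable F p := smooth_differentiable sF cp.
Let gsym y : chart_img c y -> (g' y)^T = g' y := @Defs.metric_sym _ _ _ _ (metricP N) c y.
Let gpos y (v : 'rV[R]_n) : chart_img c y -> v != 0 -> 0 < inner g' y v v :=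
  @metric_pos _ _ _ _ (metricP N) c y v.
Let gp (v : 'rV[R]_n) : v != 0 -> 0 < inner g' x v v := gpos cx.

Lemma dHH_frame_zix p' a : dHH g V g' V' F p' (fr a p') = 'D_(fr a p') F p' *m P (F p').
Proof. by rewrite /dHH frame_zix_projH. Qed.

Lemma dHH_frame_it p' : dHH g V g' V' F p' (webster_frame t p') = 0.
Proof. by rewrite /dHH frame_it_projH derive0 mul0mx. Qed.

Lemma pullback_nablaE (s : K -> 'rV[R]_n) v :
  pullback_nabla g' F v s p = 'D_v s p + christoffel_row g' x ('D_v F p) (s p).
Proof. by []. Qed.

Lemma betaHH_frame A : betaHH g V g' V' F (webster_frame A) (webster_frame A) p =
  pullback_nabla g' F (webster_frame A p) (fun p' => dHH g V g' V' F p' (webster_frame A p')) p.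
Proof. by rewrite /betaHH nabla_frame /dHH mul0mx derive0 mul0mx subr0. Qed.

Lemma betaHH_frame_it : betaHH g V g' V' F (webster_frame t) (webster_frame t) p = 0.
Proof.
rewrite betaHH_frame (_ : (fun p' => _) = fun=> 0); last first.
  by apply/funext => p'; exact: dHH_frame_it.
rewrite pullback_nablaE derive_cst add0r.
apply/rowP => k; rewrite !mxE big1 // => i _; rewrite big1 // => j _.
by rewrite mxE mulr0.
Qed.

(** The slope of a frame field does not change along the field, so that the frame
   may be frozen at [p] in the second derivative. *)
Lemma derive_frame_field a :
  differentiable (fun p' => 'D_(fr a p') F p') p /\
  'D_(fr a p) (fun p' => 'D_(fr a p') F p') p = 'D_(fr a p) (fun p' => 'D_(fr a p) F p') p.
Proof.
set w := fr a p.
pose B := 'D_(basis_vec R t) F : K -> 'rV[R]_n.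
pose s p' : R := slope a p' - slope a p.
have dB : differentiable B p := differentiable_derive_dir oU sF _ cp.
have dW : differentiable (fun p' => 'D_w F p') p := differentiable_derive_dir oU sF w cp.
have dsl : differentiable (@slope R m a) p := (@C1_slope R m a p I).1.
have ds : differentiable s p.
  by apply: differentiableB => //; exact: differentiable_cst.
have s0 : s p = 0 by rewrite /s subrr.
have Ds : 'D_w s p = 0.
  rewrite /s deriveB; [|exact: diff_derivable|exact: derivable_cst].
  rewrite derive_cst subr0 derive_slope /w frame_zix slopeD slope_zix slope_t.
  by rewrite mulr0 addr0.
have E : \near p, 'D_w F p + s p *: B p = 'D_(fr a p) F p.
  have := open_near oU cp; apply: filterS => p' Up'.
  have -> : fr a p' = s p' *: basis_vec R t + w.
    by rewrite /w !frame_zix addrCA -scalerDl /s subrK.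
  apply/esym; apply: (etrans (derive_linear_dir (s p') (basis_vec R t) w (smooth_differentiable sF Up'))).
  exact: addrC.
have dk k : differentiable (fun p' => ('D_w F p') 0 k + s p' * (B p') 0 k) p.
  apply: differentiableD; first exact: differentiable_entry.
  by apply: differentiableM => //; exact: differentiable_entry.
have dE : differentiable (fun p' => 'D_w F p' + s p' *: B p') p.
  apply: differentiable_mx => i k; rewrite (ord1 i).
  rewrite (_ : (fun p' => _) = fun p' => ('D_w F p') 0 k + s p' * (B p') 0 k) //.
  by apply/funext => p'; rewrite mxE [X in _ + X]mxE.
split; first exact: near_eq_differentiable E dE.
apply: (etrans (esym (near_eq_derive w E))); apply/rowP => k.
apply: (etrans (coord_derive 0 k (diff_derivable dE))).
apply: (etrans _ (esym (coord_derive 0 k (diff_derivable dW)))).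
rewrite (_ : (fun p' => _) = fun p' => ('D_w F p') 0 k + s p' * (B p') 0 k); last first.
  by apply/funext => p'; rewrite mxE [X in _ + X]mxE.
rewrite deriveD_at; last 2 first.
- exact: differentiable_entry.
- by apply: differentiableM => //; exact: differentiable_entry.
rewrite (@deriveM_at _ _ s (fun p' => B p' 0 k)) //; last exact: differentiable_entry.
by rewrite s0 Ds !mul0r !addr0.
Qed.

Lemma betaHH_frame_zix a : let u := 'D_(fr a p) F p in
  betaHH g V g' V' F (webster_frame (zix a)) (webster_frame (zix a)) p =
  'D_(fr a p) (fun p' => 'D_(fr a p) F p') p *m P x +
  (u *m 'D_u P x + christoffel_row g' x u (u *m P x)).
Proof.
move=> u; have [dX DX] := derive_frame_field a.
rewrite betaHH_frame (_ : (fun p' => _) = fun p' => 'D_(fr a p') F p' *m P (F p')); last first.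
  by apply/funext => p'; exact: dHH_frame_zix.
have dPF : differentiable (fun p' => P (F p')) p := differentiable_comp dF dP.
apply: (etrans (congr1 (fun y => y + _) (derive_mulmx (fr a p) dX dPF))).
apply: (etrans _ (esym (addrA _ _ _))).
exact: (congr2 (fun y z => y *m P x + u *m z + _) DX (derive_comp (fr a p) dF dP)).
Qed.

Lemma horizontal_tension_frame :
  horizontal_tension g V g' V' F (fun A => A != t) (@webster_frame R m) p =
  \sum_a ('D_(fr a p) (fun p' => 'D_(fr a p) F p') p *m P x +
    (('D_(fr a p) F p) *m 'D_('D_(fr a p) F p) P x +
      christoffel_row g' x ('D_(fr a p) F p) (('D_(fr a p) F p) *m P x)) +
    (tensorTadj g' V' x (('D_(fr a p) F p) *m P x) (('D_(fr a p) F p) *m projV g' V' x) +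
     tensorW g' V' x (('D_(fr a p) F p) *m P x) (('D_(fr a p) F p) *m projV g' V' x))).
Proof.
have split_t (G : 'I_q -> 'rV[R]_n) : \sum_A G A = \sum_a G (zix a) + G t.
  by rewrite big_split_ord big_ord1.
have split_neq (G : 'I_q -> 'rV[R]_n) : \sum_(A | A != t) G A = \sum_a G (zix a).
  rewrite big_split_ord /= [X in _ + X]big_pred0 => [|b]; last by rewrite (ord1 b) eqxx.
  by rewrite addr0; apply: eq_bigl => a; rewrite eq_lrshift.
rewrite /horizontal_tension split_t split_neq betaHH_frame_it addr0 -big_split.
apply: eq_bigr => a _ /=.
by rewrite betaHH_frame_zix dHH_frame_zix /dHV frame_zix_projH.
Qed.

Hypothesis f_harmonic : horizontally_harmonic f.

(** For horizontal [z] this is the harmonic map equation paired with [z].  For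
   vertical [z] every summand vanishes, by invariance of the transverse metric
   along the leaves. *)
Lemma harmonic_pairing (z : 'rV[R]_n) :
  \sum_a (form (T x) ('D_(fr a p) (fun p' => 'D_(fr a p) F p') p) z +
    (form ('D_('D_(fr a p) F p) T x) ('D_(fr a p) F p) z -
     2^-1 * form ('D_z T x) ('D_(fr a p) F p) ('D_(fr a p) F p))) = 0.
Proof.
have oc : open (chart_img c) := chart_img_openN c.
have killing := foliation_killing cx.
have sT (w u v : 'rV[R]_n) : form ('D_w T x) u v = form ('D_w T x) v u.
  by rewrite -[RHS]form_tr (derive_transverse_sym oc cx gsym gpos dg dP).
have gs := gsym cx.
pose S (z : 'rV[R]_n) := \sum_a (form (T x) ('D_(fr a p) (fun p' => 'D_(fr a p) F p') p) z +
    (form ('D_('D_(fr a p) F p) T x) ('D_(fr a p) F p) z -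
     2^-1 * form ('D_z T x) ('D_(fr a p) F p) ('D_(fr a p) F p))).
have SD z1 z2 : S (z1 + z2) = S z1 + S z2.
  rewrite /S -big_split; apply: eq_bigr => a _ /=.
  have D : 'D_(z1 + z2) T x = 'D_z1 T x + 'D_z2 T x.
    by rewrite -[z1]scale1r derive_linear_dir // !scale1r.
  set u := 'D_(fr a p) F p; set W := 'D_(fr a p) _ p.
  have e := etrans (congr1 (fun M => form M u u) D) (form_addmx _ _ _ _).
  exact: (pairing_add (formDr (T x) z1 z2 W) (formDr ('D_u T x) z1 z2 u) e).
rewrite -/(S z) -(proj_add V' gp z) SD.
have -> : S (z *m projV g' V' x) = 0.
  set y := z *m _; have yV : (y <= V' x)%MS := projV_sub g' V' x z.
  have Ty W : form (T x) W y = 0.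
    rewrite -[LHS]form_tr (transverse_sym V' gsym cx) /transverse form_mulmx_tr form_mulmx.
    by rewrite (projH_vertical gp yV) form0l.
  apply: big1 => a _; set u := 'D_(fr a p) F p.
  exact: (pairing_vertical (Ty _) (killing y u u yV) (sT u y u)).
rewrite addr0; set y := z *m _; have yH : (y <= horizontal g' V' x)%MS := projH_sub g' V' x z.
have := f_harmonic cp; rewrite -/F horizontal_tension_frame => h.
have := congr1 (fun s => inner g' x s y) h; rewrite /= inner0l inner_suml => <-.
apply: eq_bigr => a _; set u := 'D_(fr a p) F p; set W := 'D_(fr a p) _ p.
have e1 : inner g' x (W *m P x) y = form (T x) W y.
  by rewrite -inner_horizontalE /inner_horizontal (projH_id gp yH).
have e2 := tension_pairing oc cx gsym gpos dg dP killing u yH.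
rewrite innerDl [X in _ = X + _]innerDl -[RHS]addrA e1; congr (_ + _).
exact: esym e2.
Qed.

End InChart.

End HarmonicMapEquation.

(** * The monotonicity formula *)

Lemma stress_arith (R : realType) (d1 d2 a b k g1 g2 g3 : R) :
  d1 = a + b + g1 -> d2 = k + g2 + g3 -> g1 = g3 -> g2 = g3 ->
  d1 - 2^-1 * d2 = b + (a - 2^-1 * k).
Proof. by move=> -> -> -> ->; lra. Qed.

Section PullbackConserved.
Variables (R : realType) (m n : nat) (N : riemannianFoliation R n).
Variable f : heisenberg R m -> N.
Hypothesis f_smooth : smooth_map f.
Local Notation K := (heisenberg R m).
Local Notation q := (m + m + 1)%N.
Local Notation t := (it m).
Local Notation zix a := (lshift 1 a : 'I_q).
Local Notation g := (@webster_metric R m).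
Local Notation V := (@webster_vertical R m).
Local Notation fr a p := (webster_frame (zix a) p : K).
Local Notation H := (pullback f).
Implicit Types (p v w z : K) (a : 'I_(m + m)).

Section InChart.
Variables (c : chart N) (p : K).
Hypothesis cp : chart_preim f c p.
Local Notation F := (chart_rep f c).
Local Notation T := (transverse (metric c) (vertical c)).
Let oU : open (chart_preim f c) := @chart_preim_open _ _ _ _ f f_smooth c.
Let sF : smooth_on (chart_preim f c) F := @chart_rep_smooth _ _ _ _ f f_smooth c.
Let cx : chart_img c (F p) := chart_rep_img cp.
Let dT : differentiable T (F p) := C1mx_differentiable (@transverse_C1 _ _ N c) cx.
Let dF : differentiable F p := smooth_differentiable sF cp.

Lemma derive_pullback v w z :
  'D_v (fun y => form (H y) w z) p =
  form ('D_('D_v F p) T (F p)) ('D_w F p) ('D_z F p) +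
  form (T (F p)) ('D_v (fun y => 'D_w F y) p) ('D_z F p) +
  form (T (F p)) ('D_w F p) ('D_v (fun y => 'D_z F y) p).
Proof.
have E : \near p, form (H p) w z = form (T (F p)) ('D_w F p) ('D_z F p).
  by have := open_near oU cp; apply: filterS => y cy; exact: pullback_form.
apply: (etrans (near_eq_derive v E)).
have dM : differentiable (fun y => T (F y)) p := differentiable_comp dF dT.
apply: (etrans (derive_form_prod v dM (differentiable_derive_dir oU sF w cp)
  (differentiable_derive_dir oU sF z cp))).
exact: (congr1 (fun M => form M _ _ + _ + _) (derive_comp v dF dT)).
Qed.

Lemma transverse_rep_sym (u v : 'rV[R]_n) : form (T (F p)) u v = form (T (F p)) v u.
Proof.
rewrite -[RHS]form_tr (transverse_sym _ (U := chart_img c)) // => y.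
exact: (Defs.metric_sym (metricP N)).
Qed.

End InChart.

Hypothesis f_K : K_map f.
Hypothesis f_harmonic : horizontally_harmonic f.

(** In [D_w (H (w, Z)) - D_Z (H (w, w)) / 2] the derivatives of [df (Z)] and half
   of those of [df (w)] are exchanged by the symmetry of second derivatives and
   cancel; what remains is the pairing of the tension field with [df (Z)]. *)
Lemma pullback_conserved : conserved_tensor H.
Proof.
split.
- exact: pullback_C1.
- exact: pullback_sym.
- by move=> p v; exact: pullback_ge0.
- by move=> p; exact: pullback_periodic.
move=> p z; set c := chart_at (f p); have cp : chart_preim f c p := chart_preim_at f p.
apply: (etrans _ (harmonic_pairing f_smooth cp f_harmonic ('D_z (chart_rep f c) p))).
apply: eq_bigr => a _.
have oU := @chart_preim_open _ _ _ _ f f_smooth c.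
have sF := @chart_rep_smooth _ _ _ _ f f_smooth c.
apply: (stress_arith (derive_pullback cp _ _ _) (derive_pullback cp _ _ _)).
  exact: congr1 (smooth_derive_comm oU sF _ _ cp).
exact: transverse_rep_sym.
Qed.

Lemma inner_dHH (c : chart N) (x u : 'rV[R]_n) :
  inner (metric c) x (u *m projH (metric c) (vertical c) x) (u *m projH (metric c) (vertical c) x) =
  form (transverse (metric c) (vertical c) x) u u.
Proof. by rewrite -inner_horizontalE. Qed.

Lemma sqnorm_dHHE p : sqnorm_dHH f p = 2 * energy H p.
Proof.
have cp := chart_preim_at f p.
rewrite /energy mulrA mulfV // mul1r /sqnorm_dHH big_split_ord big_ord1 /=.
rewrite [X in _ + X](_ : _ = 0) ?addr0; last first.
  by rewrite dHH_frame_it inner0l.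
apply: eq_bigr => a _; rewrite dHH_frame_zix.
apply: (etrans (inner_dHH _ _ _)); apply/esym.
exact: (pullback_form f_smooth _ _ cp).
Qed.

Lemma sqnorm_dVHE p :
  sqnorm_dVH f p = form (H p) (2 *: basis_vec R t) (2 *: basis_vec R t).
Proof.
have cp := chart_preim_at f p.
rewrite /sqnorm_dVH big_split_ord big_ord1 /= big1 ?add0r => [|a _]; last first.
  by rewrite /dVH frame_zix_projV derive0 mul0mx inner0l.
rewrite /dVH frame_it_projV frame_it.
apply: (etrans (inner_dHH _ _ _)); apply/esym.
exact: (pullback_form f_smooth _ _ cp).
Qed.

Lemma energy_densityE : energy_density f = energy H.
Proof.
by apply/funext => p; rewrite /energy_density sqnorm_dHHE mulrA mulVf ?mul1r.
Qed.

End PullbackConserved.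

Lemma growth_cancel (R : realType) (c a b x y delta r : R) : 0 < c ->
  x = c * a -> y = c * b ->
  2 * r * Num.sqrt x <= delta * Num.sqrt y -> 2 * r * Num.sqrt a <= delta * Num.sqrt b.
Proof.
move=> c0 -> ->; rewrite !(sqrtrM _ (ltW c0)).
by rewrite mulrCA (mulrCA delta) ler_pM2l // sqrtr_gt0.
Qed.

Theorem lemma5p5 (R : realType) (m n : nat) (N : riemannianFoliation R n)
  (f : heisenberg R m -> N) (delta rho0 : R)
  (f_K : K_map f) (f_smooth : smooth_map f)
  (f_harmonic : horizontally_harmonic f)
  (rho0_gt0 : 0 < rho0)
  (growth : forall rho : R, rho0 <= rho ->
     2 * rho * Num.sqrt (integral_disk rho (sqnorm_dVH f))
     <= delta * Num.sqrt (integral_disk rho (sqnorm_dHH f)))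
  (delta_small : 0 < 2 * m%:R - 2 - 2 * delta) :
  forall sigma rho : R, rho0 < sigma -> sigma <= rho ->
    sigma `^ (2 - 2 * m%:R + 2 * delta) * integral_disk sigma (energy_density f)
    <= rho `^ (2 - 2 * m%:R + 2 * delta) * integral_disk rho (energy_density f).
Proof.
move=> sigma rho sigma_gt rho_ge.
have [S okS] := lebesgue_coords_exist R (m + m + 1).
have okH := pullback_conserved f_smooth f_K f_harmonic.
set H := pullback f in okH.
have sigma0 : 0 < sigma := lt_trans rho0_gt0 sigma_gt.
have rho_gt0 : 0 < rho := lt_le_trans sigma0 rho_ge.
set c0 := Num.sqrt (\det (webster_metric (0 : heisenberg R m))).
pose D (r : R) (h : heisenberg R m -> R) := Int S (disk_weight (r ^+ 2)) h.
have ce : continuous (energy H) := continuous_energy okH.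
have e0 p : 0 <= energy H p := energy_ge0 okH p.
have DE r : 0 < r -> integral_disk r (energy_density f) = c0 * D r (energy H).
  move=> r0; rewrite (energy_densityE f_smooth); exact: (integral_disk_Int okS (ltW r0) ce e0).
have DH r : 0 < r -> integral_disk r (sqnorm_dHH f) = c0 * D r (fun p => 2 * energy H p).
  move=> r0; rewrite (_ : sqnorm_dHH f = fun p => 2 * energy H p); last first.
    by apply/funext => p; exact: sqnorm_dHHE.
  apply: (integral_disk_Int okS (ltW r0)); last by move=> p; rewrite mulr_ge0.
  exact: C1_onT_continuous (C1_onM openT (C1_on_cst openT 2) (C1_energy okH)).
have DV r : 0 < r -> integral_disk r (sqnorm_dVH f) =
    c0 * D r (fun p => form (H p) (2 *: basis_vec R (it m)) (2 *: basis_vec R (it m))).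
  move=> r0; rewrite (_ : sqnorm_dVH f = fun p => form (H p) (2 *: basis_vec R (it m)) (2 *: basis_vec R (it m))); last first.
    by apply/funext => p; exact: sqnorm_dVHE.
  apply: (integral_disk_Int okS (ltW r0)); first exact: C1_onT_continuous (C1_form_TT okH).
  by move=> p; exact: (conserved_ge0 okH).
rewrite (DE sigma sigma0) (DE rho rho_gt0).
have : 0 <= c0 by exact: sqrtr_ge0.
rewrite le_eqVlt => /orP[/eqP <-|c0_gt0]; first by rewrite !mul0r !mulr0.
(* The density cancels, from the growth condition as well. *)
rewrite mulrCA (mulrCA (rho `^ _)) ler_pM2l //.
have growth' (r : R) : rho0 <= r ->
    2 * r * Num.sqrt (D r (fun p => form (H p) (2 *: basis_vec R (it m)) (2 *: basis_vec R (it m))))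
    <= delta * Num.sqrt (D r (fun p => 2 * energy H p)).
  move=> r0r; have r0 : 0 < r := lt_le_trans rho0_gt0 r0r.
  exact: (growth_cancel c0_gt0 (DV r r0) (DH r r0) (growth r r0r)).
have mE : (m + m)%:R = 2 * m%:R :> R by rewrite natrD mulr2n mulrDl !mul1r.
have dm : 0 < (m + m)%:R - 2 - 2 * delta by rewrite mE.
(* In the squared radius the exponent is halved. *)
have powE (r : R) : 0 < r -> r `^ (2 - 2 * m%:R + 2 * delta) =
    expR (- (((m + m)%:R - 2 - 2 * delta) / 2 * ln (r ^+ 2))).
  move=> r0; rewrite /powR gt_eqF // lnXn // mE; congr expR.
  by rewrite -[_ *+ 2]mulr_natl; move: (ln r) => l; field.
rewrite (powE sigma sigma0) (powE rho rho_gt0).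
apply: (conserved_tensor_monotone okS okH rho0_gt0 growth' dm).
  by rewrite ler_pXn2r ?nnegrE ?ltW.
by rewrite ler_pXn2r // nnegrE ltW.
Qed.
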